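(* Assume condition (DG) stated in the context. Let $h(\cdot)$ be a positive nondecreasing function on $[c,\infty)$ for some constant $c\ge1$ such that $\int_c^\infty (th(t))^{-1}dt=\infty$. Let $\Psi(t)=\int_c^t(sh(s))^{-1}ds$ for $t\ge c$, and let $m$ be the smallest positive integer $t\ge c$ with $\Psi(t)>1$. Then for real numbers $\varepsilon$ and $n\ge m$, we have $$\mathbb{P}\left(|S_n|>(1+\varepsilon)\sigma_n\sqrt{2\ln\Psi(n)}\right)\propto\frac{1}{\sqrt{\ln\Psi(n)}}\Psi(n)^{-(1+\varepsilon)^2},$$ where $a_n\propto b_n$ means that $a_n/b_n\to C$ as $n\to\infty$ for some constant $C>0$. Define $$S_\Psi:=\sum_{n=m}^\infty\frac{1}{nh(n)}\mathbb{P}\left(|S_n|>(1+\varepsilon)\sigma_n\sqrt{2\ln\Psi(n)}\right).$$ Then $S_\Psi<\infty$ if $\varepsilon>0$ and $S_\Psi=\infty$ if $\varepsilon\le0$.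
   Context: Let $\{a_{r,s}\}_{(r,s)\in\mathbb{Z}^2}$ be a square summable family of real constants and let $\{\xi_{r,s}\}_{(r,s)\in\mathbb{Z}^2}$ and $\xi_0$ be i.i.d. real random variables with $\mathbb{E}\xi_0=0$ and $\mathbb{E}\xi_0^2=1$. The linear random field is $X_{j,k}=\sum_{r,s\in\mathbb{Z}}a_{r,s}\xi_{j-r,k-s}$, $(j,k)\in\mathbb{Z}^2$ (the series converges in $L^2$ and almost surely). Let $\Gamma_n=[1,n]^2\cap\mathbb{Z}^2$, $S_n=\sum_{(j,k)\in\Gamma_n}X_{j,k}$ and $\sigma_n^2=\mathbb{E}S_n^2$, with $\sigma_n>0$ for every $n$. Condition (DG): $\|\xi_0\|_p=(\mathbb{E}|\xi_0|^p)^{1/p}<\infty$ for some $p>2$, and $\{a_{r,s}\}$ satisfies either (short memory) $\sum_{r,s\in\mathbb{Z}}|a_{r,s}|<\infty$ and $\sum_{r,s\in\mathbb{Z}}a_{r,s}\ne0$, or (long memory) for $r\ne0$ or $s\ne0$, $$a_{r,s}=(|r|+|s|)^{-\beta}L(|r|+|s|)\,g\Big(\frac{r}{\sqrt{r^2+s^2}},\frac{s}{\sqrt{r^2+s^2}}\Big),$$ where $\beta\in(1,2)$, $L(\cdot)$ is a slowly varying function at infinity (measurable, positive, with $\lim_{x\to\infty}L(\lambda x)/L(x)=1$ for all constants $\lambda>0$), and $g(\cdot,\cdot)$ is a bounded piecewise continuous function defined on the unit circle.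
   Formalization: The relation ∝ is stated only for ε > −1, since for ε ≤ −1 the probability tends to 1 while the right-hand side tends to 0, so it fails; the claims on S_Ψ are kept for all real ε. *)

(* Defs.v *)
From HB Require Import structures.
From mathcomp Require Import all_boot all_order all_algebra finmap.
From mathcomp Require Import all_classical all_reals all_analysis.
From mathcomp.analysis.showcase Require summability.

Set Implicit Arguments.
Unset Strict Implicit.
Unset Printing Implicit Defensive.

Import Order.TTheory GRing.Theory Num.Theory.
Import numFieldNormedType.Exports.

Local Open Scope classical_set_scope.
Local Open Scope ring_scope.

(* Multiple series over a countable index set are limits along the filter
   [totally] of the finite subsets ordered by inclusion. *)
Notation totally := summability.totally.
Notation partial_sum := summability.partial_sum.
Notation family_sum := summability.sum.

Section iid.
Context d (T : measurableType d) (R : realType) (P : probability T R).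
Variables (I : choiceType) (X : I -> {RV P >-> R}).

Definition mutually_independent : Prop :=
  forall (J : {fset I}) (B : I -> set R), (forall i, measurable (B i)) ->
    fine (P (\bigcap_(i in [set` J]) (X i @^-1` B i))) =
    \prod_(i <- J) fine (P (X i @^-1` B i)).

(* Only measurable sets are tested: the library's measures are total functions
   whose values on other sets carry no information. *)
Definition identically_distributed : Prop :=
  forall (i j : I) (B : set R), measurable B ->
    distribution P (X i) B = distribution P (X j) B.

Definition iid : Prop := mutually_independent /\ identically_distributed.

End iid.

(* The innovations together with their generic copy, as a single family. *)
Definition innovations d (T : measurableType d) (R : realType)
    (P : probability T R) (xi0 : {RV P >-> R}) (xi : int * int -> {RV P >-> R})
    (i : option (int * int)) : {RV P >-> R} :=
  if i is Some rs then xi rs else xi0.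

Section linear_field.
Context d (T : measurableType d) (R : realType) (P : probability T R).
Implicit Types (a : int * int -> R) (xi X : int * int -> {RV P >-> R}).

Definition square_summable a : Prop :=
  esum.summable [set: int * int] (fun rs => (a rs ^+ 2)%:E).

(* The series defining X_{j,k} converges in L^2; this determines X_{j,k} up to
   almost sure equality. *)
Definition is_linear_field a xi X : Prop :=
  forall j k : int,
    'N[P]_2%:E[(fun w =>
      (X (j, k) w
       - partial_sum (fun rs => a rs * xi (j - rs.1, k - rs.2) w) A)%:E)]%E
    @[A --> totally] --> 0%E.

Definition field_sum X (n : nat) (w : T) : R :=
  \sum_(1 <= j < n.+1) \sum_(1 <= k < n.+1) X (j%:Z, k%:Z) w.

Definition field_sigma X (n : nat) : R :=
  Num.sqrt (fine 'E_P[(fun w => field_sum X n w ^+ 2)]).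

End linear_field.

Section condition_DG.
Context (R : realType).
Implicit Types (a : int * int -> R) (L : R -> R) (g : R * R -> R).

Definition short_memory a : Prop :=
  esum.summable [set: int * int] (fun rs => (a rs)%:E) /\ family_sum a != 0.

Definition slowly_varying L : Prop :=
  [/\ measurable_fun (`]0, +oo[ : set R) L,
      forall x : R, 0 < x -> 0 < L x &
      forall l : R, 0 < l -> L (l * x) / L x @[x --> +oo] --> (1 : R)].

Definition unit_circle : set (R * R) := [set p | p.1 ^+ 2 + p.2 ^+ 2 = 1].

(* g matters only on the circle, hence the relative neighbourhoods. One-sided
   limits at the exceptional points are not required; boundedness is a
   separate condition. *)
Definition piecewise_continuous_on_circle g : Prop :=
  exists2 D : set (R * R), finite_set D &
    forall p, (unit_circle `\` D) p -> g q @[q --> within unit_circle (nbhs p)] --> g p.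

Definition bounded_on_circle g : Prop :=
  exists M : R, forall p, unit_circle p -> `|g p| <= M.

Definition long_memory a : Prop :=
  exists (beta : R) (L : R -> R) (g : R * R -> R),
    [/\ 1 < beta < 2,
        slowly_varying L,
        bounded_on_circle g,
        piecewise_continuous_on_circle g &
        forall r s : int, r != 0 \/ s != 0 ->
          let l1 : R := (`|r| + `|s|)%:~R in
          let l2 : R := Num.sqrt ((r ^+ 2 + s ^+ 2)%:~R) in
          a (r, s) = l1 `^ (- beta) * L l1 * g (r%:~R / l2, s%:~R / l2)].

Definition condition_DG d (T : measurableType d) (P : probability T R)
    (xi0 : {RV P >-> R}) a : Prop :=
  (exists2 p : R, 2 < p & ('N[P]_p%:E[EFin \o xi0] < +oo)%E) /\
  (short_memory a \/ long_memory a).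

End condition_DG.

Definition Psi (R : realType) (c : R) (h : R -> R) (t : R) : R :=
  \int[lebesgue_measure]_(s in `[c, t]) (s * h s)^-1.

Definition first_time_above_one (R : realType) (c : R) (h : R -> R) (m : nat) :
    Prop :=
  let admissible k := [/\ (0 < k)%N, c <= k%:R & 1 < Psi c h k%:R] in
  admissible m /\ forall k : nat, admissible k -> (m <= k)%N.

Definition propto (R : realType) (u v : R^nat) : Prop :=
  exists2 C : R, 0 < C & u n / v n @[n --> \oo] --> C.

Definition tail_prob d (T : measurableType d) (R : realType)
    (P : probability T R) (X : int * int -> {RV P >-> R}) (c : R) (h : R -> R)
    (eps : R) (n : nat) : \bar R :=
  P [set w | (1 + eps) * field_sigma X n * Num.sqrt (2 * ln (Psi c h n%:R))
             < `|field_sum X n w|].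

Definition S_Psi d (T : measurableType d) (R : realType)
    (P : probability T R) (X : int * int -> {RV P >-> R}) (c : R) (h : R -> R)
    (m : nat) (eps : R) : \bar R :=
  (\sum_(m <= n <oo) ((n%:R * h n%:R)^-1)%:E * tail_prob X c h eps n)%E.

(* Main.v *)
(* The function h is nondecreasing, so Psi grows more slowly than every power
   and the thresholds x_n = (1 + eps) sqrt (2 ln Psi(n)) are so small that any
   polynomial rate of normal approximation, uniform in x, gives
   P(|S_n| > x_n sigma_n) the asymptotics of a Gaussian tail; Mills' ratio then
   yields the stated equivalent.

   For the rate, S_n / sigma_n is approximated in L^2 by a finite combination
   sum_u b_u xi_u of independent innovations, to which Stein's method with a
   smoothed indicator applies: the error is a power of max_u |b_u|. The maximum
   decays polynomially as soon as each squared coefficient is at most n^(-kap)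
   times their sum. With short memory, all the coefficients deep inside the box
   are close to sum a <> 0. With long memory, one looks at the innovations for
   which the box is seen at distance of order n in a direction where g does not
   vanish: there the summands all have the same sign and slow variation costs
   only small powers. If g vanishes at all its continuity points, the a_v live on
   finitely many rays and the same count is made along one ray.

   The series is compared with the increments of Psi^(1-q), q = (1 + eps)^2, when
   eps > 0, and with those of sqrt (ln Psi) when eps = 0; the case eps < 0 follows
   by monotonicity. *)

Require Import Defs.
From HB Require Import structures.
From mathcomp Require Import all_boot all_order all_algebra finmap.
From mathcomp Require Import all_classical all_reals all_analysis.
From mathcomp Require Import measurable_realfun ring lra zify.
Set Implicit Arguments.
Unset Strict Implicit.
Unset Printing Implicit Defensive.
Import Order.TTheory GRing.Theory Num.Theory.
Import numFieldNormedType.Exports.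
Local Open Scope classical_set_scope.
Local Open Scope ring_scope.

(** * Gaussian tails and Stein's equation *)

(** The fields [X v] are known only as L^2 limits along finite sets [A], so no infinite combination
    of innovations is ever formed. Coefficients are estimated for the truncation of [a] to [A],
    uniformly over all [A] containing some [A0]; such statements combine with the L^2 convergence by
    taking the union of two sets. The growth of the sum of squared coefficients separates the two
    long-memory cases. Square summability bounds a squared coefficient of the box sum only by a
    constant times n^2, by Cauchy-Schwarz, so the sum of squares must exceed n^2 by a power: a cone
    of directions gives n^(6 - 2 beta) up to small powers, and beta < 2 is just enough. A ray gives
    only n^(4 - 2 beta), but there beta > 1 makes [a] absolutely summable, hence the coefficients of
    the box sum bounded, and any positive power suffices. Only moments of order 2 + dl are at hand,
    with dl possibly small, so the remainder in Stein's method is interpolated between its Lipschitz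
    bound and its trivial bound. *)

Section real_calculus.
Context (R : realType).
Implicit Types (f g F : R -> R) (s t : R).

Lemma is_derive_continuous F dF t : is_derive t 1 F dF -> {for t, continuous F}.
Proof. by move=> [dFt _]; apply/differentiable_continuous/derivable1_diffP. Qed.

Lemma mean_value F dF s t : s <= t ->
  (forall x, s <= x <= t -> is_derive x 1 F (dF x)) ->
  exists2 x, s <= x <= t & F t - F s = dF x * (t - s).
Proof.
move=> st dFE.
have [| |x xst ->] := @MVT_segment R F dF s t st.
- by move=> x; rewrite in_itv/= => /andP[sx xt]; apply: dFE; rewrite !ltW.
- apply: continuous_in_subspaceT => x /set_mem/=; rewrite in_itv/= => xst.
  exact: is_derive_continuous (dFE _ xst).
- by exists x => //; rewrite in_itv/= in xst.
Qed.

Lemma noninc_of_derive F dF s t : s <= t ->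
  (forall x, s <= x <= t -> is_derive x 1 F (dF x)) ->
  (forall x, s <= x <= t -> dF x <= 0) -> F t <= F s.
Proof.
move=> st dFE dF0; have [x xst FE] := mean_value st dFE.
by rewrite -subr_le0 FE mulr_le0_ge0 ?subr_ge0// dF0.
Qed.

(** The differentiation rules are restated for functions in explicit [fun] form: the derivative of a
    compound expression is assembled by nesting these lemmas, and [is_derive_eq] then adjusts its
    value. *)
Lemma is_derive_funD f g s a b : is_derive s 1 f a -> is_derive s 1 g b ->
  is_derive s 1 (fun t => f t + g t) (a + b).
Proof. exact: is_deriveD. Qed.

Lemma is_derive_funB f g s a b : is_derive s 1 f a -> is_derive s 1 g b ->
  is_derive s 1 (fun t => f t - g t) (a - b).
Proof. exact: is_deriveB. Qed.

Lemma is_derive_fun_cst s (c : R) : is_derive s 1 (fun=> c) 0.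
Proof. exact: is_derive_cst. Qed.

Lemma is_derive_fun_id s : is_derive s 1 (fun t => t) 1.
Proof. exact: is_derive_id. Qed.

Lemma is_derive_funN f s a : is_derive s 1 f a ->
  is_derive s 1 (fun t => - f t) (- a).
Proof. exact: is_deriveN. Qed.

Lemma is_derive_funM f g s a b : is_derive s 1 f a -> is_derive s 1 g b ->
  is_derive s 1 (fun t => f t * g t) (a * g s + f s * b).
Proof.
move=> fa gb; apply: is_derive_eq (is_deriveM fa gb) _.
by rewrite addrC mulrC.
Qed.

Lemma is_derive_fun_comp f g s a b : is_derive (g s) 1 f a ->
  is_derive s 1 g b -> is_derive s 1 (fun t => f (g t)) (a * b).
Proof. exact: is_derive1_comp. Qed.

Lemma is_derive_funV f s a : f s != 0 -> is_derive s 1 f a ->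
  is_derive s 1 (fun t => (f t)^-1) (- a / f s ^+ 2).
Proof.
move=> fs0 fa; have [fd <-] := fa.
split; first exact: derivableV.
by rewrite deriveV// mulNr -mulrN mulrC.
Qed.

Lemma primitive_exists f : continuous f ->
  (@lebesgue_measure R).-integrable setT (EFin \o f) ->
  exists F : R -> R, forall t, is_derive t 1 F (f t).
Proof.
move=> cf intf.
exists (fun x => \int[@lebesgue_measure R]_(t in `]-oo, x]) f t) => t.
have tt1 : t < t + 1 by rewrite ltrDl.
have [||dF dFE] := @continuous_FTC1 R f -oo%O t (t + 1) tt1 _ _ (cf t).
- exact: integrableS intf.
- exact: ltNyr.
- by apply: DeriveDef; [exact: dF|rewrite -derive1E; exact: dFE].
Qed.

(** A negative value at [a] could only decrease further, against the behaviour at infinity.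
    Comparisons of Gaussian tails with explicit functions thus reduce to the sign of a
    derivative. *)
Lemma ge0_of_noninc F (dF : R -> R) (a : R) :
  (forall x : R, a <= x -> is_derive x 1 F (dF x)) ->
  (forall x : R, a <= x -> dF x <= 0) ->
  (forall e, 0 < e -> exists A, forall t, A <= t -> - e <= F t) ->
  0 <= F a.
Proof.
move=> dFE dF0 limF; rewrite leNgt; apply/negP => Fa0.
have [|A hA] := limF (- F a / 2); first by rewrite divr_gt0 ?oppr_gt0.
pose t := Num.max A a.
have at_ : a <= t by rewrite le_max lexx orbT.
have := hA t; rewrite le_max lexx => /(_ isT).
have : F t <= F a.
  by apply: (noninc_of_derive at_) => x /andP[ax _]; [exact: dFE|exact: dF0].
lra.
Qed.

Definition gauss (t : R) := expR (- (t ^+ 2 / 2)).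

Lemma gauss_gt0 t : 0 < gauss t. Proof. exact: expR_gt0. Qed.

Lemma gaussN t : gauss (- t) = gauss t. Proof. by rewrite /gauss sqrrN. Qed.

Lemma gauss_le1 t : gauss t <= 1.
Proof. by rewrite -expR0 ler_expR oppr_le0 divr_ge0 ?sqr_ge0. Qed.

Lemma is_derive_gauss t : is_derive t 1 gauss (- t * gauss t).
Proof.
apply: is_derive_eq (is_derive_fun_comp (is_derive_expR _) (is_derive_funN
  (is_derive_funM (is_derive_funM (is_derive_fun_id _) (is_derive_fun_id _))
     (is_derive_fun_cst _ _)))) _.
by rewrite /gauss expr2; field.
Qed.

Lemma continuous_gauss : continuous gauss.
Proof. by move=> t; exact: is_derive_continuous (is_derive_gauss t). Qed.

Lemma integrable_gauss :
  (@lebesgue_measure R).-integrable setT (EFin \o gauss).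
Proof.
have := @integrable_normal_pdf R 0 1.
move=> /(integrableZl measurableT (normal_peak 1)^-1).
apply: eq_integrable => // t _ /=.
rewrite normal_pdfE ?oner_eq0//= -EFinM mulrA mulVf ?mul1r; last first.
  by rewrite gt_eqF// normal_peak_gt0 ?oner_eq0.
by rewrite /normal_fun /gauss subr0 expr1n mulNr.
Qed.

End real_calculus.

(* The unnormalised Gaussian tail: only its derivative and its limits are
   needed, the value [I] of the Gaussian integral never is. *)
Definition gauss_tail (R : realType) (G : R -> R) (I : R) : Prop :=
  [/\ forall t : R, is_derive t 1 G (- gauss t),
      forall t, 0 <= G t,
      forall t, G (- t) = I - G t &
      forall e, 0 < e -> exists A, forall t, A <= t -> G t <= e].

Section gauss_tail.
Context (R : realType).
Implicit Types (f g F G N H : R -> R) (s t e : R).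

(** The tail is the gap between a primitive [N] of the Gaussian and the supremum of [N]. For the
    reflection, [G (- x) + G x] has derivative 0, which identifies the total mass as twice [G 0]. *)
Lemma gauss_tail_exists : exists G I, @gauss_tail R G I.
Proof.
have [N dN] := primitive_exists (@continuous_gauss R) (@integrable_gauss R).
have ndN s t : s <= t -> N s <= N t.
  move=> st; rewrite -lerN2.
  apply: (@noninc_of_derive R (fun x => - N x) (fun x => - gauss x)) => //.
  by move=> x _; rewrite oppr_le0 ltW ?gauss_gt0.
(* [exp (1/2 - t)] dominates the Gaussian *)
have Nexp s t : s <= t -> N t + expR (2^-1 - t) <= N s + expR (2^-1 - s).
  move=> st.
  apply: (@noninc_of_derive R (fun x => N x + expR (2^-1 - x))
            (fun x => gauss x - expR (2^-1 - x))) => //.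
  - move=> x _; apply: is_derive_eq (is_derive_funD (dN x) (is_derive_fun_comp
      (is_derive_expR _) (is_derive_funB (is_derive_fun_cst _ _) (is_derive_fun_id _)))) _.
    by ring.
  - move=> x _; rewrite subr_le0 ler_expR.
    have := sqr_ge0 (x - 1); rewrite expr2 => h; rewrite expr2; lra.
have ubN : has_ubound (range N).
  exists (N 0 + expR 2^-1) => _ [t _ <-].
  have [t0|t0] := leP 0 t.
    have := Nexp _ _ t0; rewrite subr0.
    by apply: le_trans; rewrite lerDl expR_ge0.
  by rewrite (le_trans (ndN _ _ (ltW t0)))// lerDl expR_ge0.
pose S := sup (range N).
have supN : has_sup (range N) by split => //; exists (N 0); exists 0.
have NS t : N t <= S by apply: sup_upper_bound => //; exists t.
have limS e : 0 < e -> exists A, forall t, A <= t -> S - N t <= e.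
  move=> e0; have [_ [A _ <-] h] := sup_adherent e0 supN.
  exists A => t At; rewrite lerBlDr -lerBlDl; apply: (le_trans (ltW h)).
  exact: ndN.
pose G t := S - N t.
have dG t : is_derive t 1 G (- gauss t).
  by apply: is_derive_eq (is_derive_funB (is_derive_fun_cst _ _) (dN t)) _; rewrite sub0r.
exists G, (G 0 + G 0); split=> //.
- by move=> t; rewrite subr_ge0.
- move=> t; apply/eqP; rewrite eq_sym subr_eq eq_sym; apply/eqP.
  have dsum (x : R) : is_derive x 1 (fun x => G (- x) + G x) 0.
    apply: is_derive_eq (is_derive_funD (is_derive_fun_comp (dG _)
      (is_derive_funN (is_derive_fun_id _))) (dG x)) _.
    by rewrite gaussN; ring.
  have cst x y : x <= y -> G (- x) + G x = G (- y) + G y.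
    move=> xy; have [z _ /eqP] := mean_value xy (fun z _ => dsum z).
    by rewrite mul0r subr_eq0 => /eqP.
  have [t0|t0] := leP 0 t; first by rewrite -(cst _ _ t0) oppr0.
  by rewrite (cst _ _ (ltW t0)) oppr0.
Qed.

Context (G : R -> R) (I : R) (GI : gauss_tail G I).

Let dG t : is_derive t 1 G (- gauss t). Proof. by case: GI. Qed.
Let G0 t : 0 <= G t. Proof. by case: GI. Qed.
Let GN t : G (- t) = I - G t. Proof. by case: GI. Qed.
Let Glim e : 0 < e -> exists A, forall t, A <= t -> G t <= e.
Proof. by case: GI => _ _ _ h /h. Qed.

Lemma gauss_tail_diff s t : s <= t -> G s - G t <= t - s.
Proof.
move=> st; have [x _ h] := mean_value st (fun x _ => dG x).
rewrite -opprB h mulNr opprK -[leRHS]mul1r ler_wpM2r ?subr_ge0// gauss_le1 //.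
Qed.

Lemma gauss_tail_gt0 t : 0 < G t.
Proof.
rewrite lt_neqAle G0 andbT eq_sym; apply/eqP => Gt0.
have tt1 : t <= t + 1 by rewrite lerDl.
have [x _ h] := mean_value tt1 (fun x _ => dG x).
have := G0 (t + 1); have := gauss_gt0 x.
by move: h; rewrite Gt0 => h; nra.
Qed.

Lemma gauss_tail_le_total t : G t <= I.
Proof. by have := G0 (- t); rewrite GN subr_ge0. Qed.

Lemma gauss_total_gt0 : 0 < I.
Proof. exact: lt_le_trans (gauss_tail_gt0 0) (gauss_tail_le_total 0). Qed.

Lemma mills_upper t : 0 < t -> t * G t <= gauss t.
Proof.
move=> t0.
suff : 0 <= gauss t / t - G t.
  by rewrite subr_ge0 ler_pdivlMr// mulrC.
apply: (@ge0_of_noninc R (fun x => gauss x / x - G x) (fun x => - gauss x / x ^+ 2)).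
- move=> x tx; have x0 : x != 0 by rewrite gt_eqF// (lt_le_trans t0).
  apply: is_derive_eq (is_derive_funB (is_derive_funM (is_derive_gauss x)
    (is_derive_funV x0 (is_derive_fun_id x))) (dG x)) _.
  by field.
- by move=> x _; rewrite mulNr oppr_le0 divr_ge0 ?sqr_ge0// ltW ?gauss_gt0.
- move=> e /Glim[A hA]; exists (Num.max A t) => x.
  rewrite ge_max => /andP[/hA hx tx].
  have : 0 <= gauss x / x by rewrite divr_ge0 ?(ltW (gauss_gt0 x))// ltW// (lt_le_trans t0).
  lra.
Qed.

(** The function [(x^-1 - x^-3) gauss x] has derivative [(3 x^-4 - 1) gauss x], so it falls more
    slowly than [G], and both vanish at infinity. *)
Lemma mills_lower t : 0 < t -> (t^-1 - t^-1 ^+ 3) * gauss t <= G t.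
Proof.
move=> t0; rewrite -subr_ge0.
apply: (@ge0_of_noninc R (fun x => G x - (x^-1 - x^-1 ^+ 3) * gauss x)
          (fun x => - (3 * gauss x / x ^+ 4))).
- move=> x tx; have x0 : x != 0 by rewrite gt_eqF// (lt_le_trans t0).
  have dV := is_derive_funV x0 (is_derive_fun_id x).
  have dV3 := is_derive_funM (is_derive_funM dV dV) dV.
  have -> : (fun x => G x - (x^-1 - x^-1 ^+ 3) * gauss x) =
            (fun x => G x - (x^-1 - x^-1 * x^-1 * x^-1) * gauss x).
    by apply/funext => y; rewrite !exprS expr0 mulr1 !mulrA.
  apply: is_derive_eq (is_derive_funB (dG x) (is_derive_funM
     (is_derive_funB dV dV3) (is_derive_gauss x))) _.
  by field.
- move=> x tx; rewrite oppr_le0 divr_ge0 ?exprn_ge0 ?mulr_ge0 ?(ltW (gauss_gt0 x))//.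
  by rewrite ltW// (lt_le_trans t0).
- move=> e e0; exists (Num.max (e^-1 + 1) t) => x.
  rewrite ge_max => /andP[ex tx]; have x0 : 0 < x by rewrite (lt_le_trans t0).
  rewrite lerBrDr addrC -lerBrDr opprK.
  apply: (@le_trans _ _ x^-1).
    have x3 : 0 <= x^-1 ^+ 3 by rewrite exprn_ge0 ?invr_ge0 ?ltW.
    have x1 : 0 <= x^-1 by rewrite invr_ge0 ltW.
    have := gauss_le1 x; have := gauss_gt0 x; nra.
  apply: (@le_trans _ _ e); last by rewrite lerDr.
  rewrite invf_ple ?posrE//; lra.
Qed.

(** The ratio [G x / gauss x] is nonincreasing on the positive half-line, by [mills_upper], and at 0
    it is at most [I]. *)
Lemma mills_bound t : 0 <= t -> G t <= I * gauss t.
Proof.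
move=> t0; rewrite -ler_pdivrMr ?gauss_gt0//.
apply: (@le_trans _ _ (G 0 / gauss 0)).
  apply: (@noninc_of_derive R (fun x => G x / gauss x)
            (fun x => (x * G x - gauss x) / gauss x)) => //.
  - move=> x _; have g0 : gauss x != 0 by rewrite gt_eqF ?gauss_gt0.
    apply: is_derive_eq (is_derive_funM (dG x) (is_derive_funV g0 (is_derive_gauss x))) _.
    by field.
  - move=> x /andP[x0 _]; rewrite mulr_le0_ge0 ?invr_ge0 ?(ltW (gauss_gt0 x))//.
    rewrite subr_le0; move: x0; rewrite le_eqVlt => /predU1P[<-|]; last exact: mills_upper.
    by rewrite mul0r ltW ?gauss_gt0.
by rewrite /gauss expr0n/= mul0r oppr0 expR0 divr1 gauss_tail_le_total.
Qed.

Lemma gauss_le_small e : 0 < e -> exists A, forall t, A <= t -> gauss t <= e.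
Proof.
move=> e0; exists (2 / e + 2) => t et.
have e20 : 0 < 2 / e by rewrite divr_gt0.
have t0 : 0 < t by lra.
have h := expR_ge1Dx (t ^+ 2 / 2).
rewrite /gauss expRN invf_ple ?posrE ?expR_gt0//.
apply: le_trans h; have -> : e^-1 = 2 / e / 2 by field; rewrite gt_eqF.
rewrite expr2; set u := 2 / e in et e20 *; nra.
Qed.

(** This integrates the bound on [dF] from [t] to infinity without an integral: [D G - F] and
    [D G + F] are nonincreasing and nonnegative in the limit. *)
Lemma gauss_tail_dominates F (dF : R -> R) D :
  (forall t : R, is_derive t 1 F (dF t)) ->
  (forall t, `|dF t| <= D * gauss t) ->
  (forall e, 0 < e -> exists A, forall t, A <= t -> `|F t| <= e) ->
  forall t, `|F t| <= D * G t.
Proof.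
move=> dFE dFD Flim t.
have D0 : 0 <= D.
  by rewrite -(pmulr_lge0 _ (gauss_gt0 0)) (le_trans _ (dFD 0)).
have half F' (dF' : R -> R) : (forall t : R, is_derive t 1 F' (dF' t)) ->
    (forall t, `|dF' t| <= D * gauss t) ->
    (forall e, 0 < e -> exists A, forall t, A <= t -> `|F' t| <= e) ->
    F' t <= D * G t.
  move=> d1 d2 d3; rewrite -subr_ge0.
  apply: (@ge0_of_noninc R (fun x => D * G x - F' x) (fun x => - (D * gauss x) - dF' x)).
  - move=> x _; apply: is_derive_eq (is_derive_funB (is_derive_funM
      (is_derive_fun_cst _ _) (dG x)) (d1 x)) _.
    by ring.
  - by move=> x _; have := d2 x; rewrite ler_norml => /andP[+ _]; lra.
  - move=> e /d3[A hA]; exists A => x /hA; rewrite ler_norml => /andP[_ h].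
    have : 0 <= D * G x by rewrite mulr_ge0.
    by lra.
rewrite ler_norml (half F dF)// andbT lerNl.
apply: (half (fun x => - F x) (fun x => - dF x)) => //.
- by move=> x; rewrite normrN.
- by move=> e /Flim[A hA]; exists A => x; rewrite normrN; exact: hA.
Qed.

(** Integrating towards the infinity on the side of [t] gives the tail at the absolute value of [t],
    small on both sides; for this [F] must vanish at both ends. *)
Lemma gauss_tail_dominates_both F (dF : R -> R) D :
  (forall t : R, is_derive t 1 F (dF t)) ->
  (forall t, `|dF t| <= D * gauss t) ->
  (forall e, 0 < e -> exists A, forall t, A <= `|t| -> `|F t| <= e) ->
  forall t, `|F t| <= D * G `|t|.
Proof.
move=> d1 d2 d3 t.
have d3p e : 0 < e -> exists A, forall t, A <= t -> `|F t| <= e.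
  by move=> /d3[A hA]; exists A => x Ax; apply: hA; rewrite (le_trans Ax)// ler_norm.
have d3n e : 0 < e -> exists A, forall t, A <= t -> `|F (- t)| <= e.
  move=> /d3[A hA]; exists A => x Ax; apply: hA.
  by rewrite (le_trans Ax)// normrN ler_norm.
have [t0|t0] := leP 0 t.
  by rewrite (ger0_norm t0); exact: (gauss_tail_dominates d1).
rewrite (ltr0_norm t0) -{1}(opprK t).
apply: (@gauss_tail_dominates (fun x => F (- x)) (fun x => - dF (- x))) => //.
- move=> x; apply: is_derive_eq (is_derive_fun_comp (d1 _)
    (is_derive_funN (is_derive_fun_id _))) _.
  by rewrite mulrN1.
- by move=> x; rewrite normrN -gaussN.
Qed.

Lemma norm_mills t : `|t| * G `|t| <= gauss t.
Proof.
have -> : gauss t = gauss `|t| by rewrite /gauss real_normK ?num_real.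
have := normr_ge0 t; rewrite le_eqVlt => /predU1P[<-|]; last exact: mills_upper.
by rewrite mul0r ltW ?gauss_gt0.
Qed.

End gauss_tail.

(** * A continuously differentiable step function *)

Section smooth_step.
Context (R : realType).
Implicit Types (s t u : R).

(** Needed at the kink of [u |u|]: one factor is not differentiable at 0, so the product rule does
    not apply there. *)
Lemma is_derive_of_quadratic_remainder (f : R -> R) t d :
  (forall u, `|f (t + u) - f t - d * u| <= u ^+ 2) -> is_derive t 1 f d.
Proof.
move=> fq.
have cf : h^-1 *: (f (h *: 1 + t) - f t) @[h --> 0^'] --> (d : R).
  apply/cvgrPdist_le => e e0; near=> h.
  have h0 : h != 0 by near: h; exact: nbhs_dnbhs_neq.
  have he : `|h| <= e.
    by near: h; exact: dnbhs0_le.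
  have -> : d - h^-1 *: (f (h *: 1 + t) - f t) = - h^-1 * (f (t + h) - f t - d * h).
    rewrite /GRing.scale/= mulr1 [h + t]addrC; by field.
  rewrite normrM normrN normfV ler_pdivrMl ?normr_gt0//.
  apply: (le_trans (fq h)); rewrite -real_normK ?num_real// expr2.
  by rewrite ler_wpM2l.
by split; [apply/cvg_ex; exists d|apply/cvg_lim].
Unshelve. all: by end_near. Qed.

Lemma is_derive_signed_square t : is_derive t 1 (fun u => u * `|u|) (2 * `|t|).
Proof.
apply: is_derive_of_quadratic_remainder => u; rewrite ler_norml expr2.
case: (ger0P (t + u)) => h1; case: (ger0P t) => h2; apply/andP; split; nra.
Qed.

(* The second difference of [u |-> u |u|] is constant away from the two
   kinks, which makes this a C^1 step from 0 to 1 across [0, 1]. *)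
Definition smooth_step (u : R) :=
  2^-1 + u * `|u| - 2 * ((u - 2^-1) * `|u - 2^-1|) + (u - 1) * `|u - 1|.

(** A piecewise linear tent supported on [0, 1], with peak value 2 at the midpoint. *)
Definition smooth_step' (u : R) := 2 * `|u| - 4 * `|u - 2^-1| + 2 * `|u - 1|.

Lemma is_derive_smooth_step u : is_derive u 1 smooth_step (smooth_step' u).
Proof.
have dS (a : R) : is_derive u 1 (fun v => (v - a) * `|v - a|) (2 * `|u - a|).
  have := @is_derive_fun_comp R (fun v => v * `|v|) (fun v => v - a) u _ _
    (is_derive_signed_square (u - a))
    (is_derive_funB (is_derive_fun_id u) (is_derive_fun_cst u a)).
  by rewrite subr0 mulr1.
apply: is_derive_eq (is_derive_funD (is_derive_funB (is_derive_funD
  (is_derive_fun_cst u 2^-1) (is_derive_signed_square u))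
  (is_derive_funM (is_derive_fun_cst u 2) (dS 2^-1))) (dS 1)) _.
by rewrite /smooth_step'; ring.
Qed.

Lemma smooth_step_itv u : 0 <= smooth_step u <= 1.
Proof.
rewrite /smooth_step.
case: (ger0P u) => h1; case: (ger0P (u - 2^-1)) => h2;
  case: (ger0P (u - 1)) => h3; apply/andP; split; nra.
Qed.

Lemma smooth_step'_itv u : 0 <= smooth_step' u <= 2.
Proof.
rewrite /smooth_step'.
case: (ger0P u) => h1; case: (ger0P (u - 2^-1)) => h2;
  case: (ger0P (u - 1)) => h3; apply/andP; split; nra.
Qed.

Lemma smooth_step0 u : u <= 0 -> smooth_step u = 0.
Proof.
move=> u0; rewrite /smooth_step !ler0_norm; [by field|lra|lra|lra].
Qed.

Lemma smooth_step1 u : 1 <= u -> smooth_step u = 1.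
Proof.
move=> u0; rewrite /smooth_step !ger0_norm; [by field|lra|lra|lra].
Qed.

End smooth_step.

(** * Stein's equation for a smoothed indicator *)

Section stein.
Context (R : realType) (G : R -> R) (I : R) (GI : gauss_tail G I).
Context (al eta : R) (eta_gt0 : 0 < eta).

Let dG (t : R) : is_derive t 1 G (- gauss t). Proof. by case: GI. Qed.
Let G0 t : 0 <= G t. Proof. by case: GI. Qed.
Let Glim e : 0 < e -> exists A, forall t, A <= t -> G t <= e.
Proof. by case: GI => _ _ _ h /h. Qed.

Let h t := smooth_step ((t - al) / eta).
Let h' t := smooth_step' ((t - al) / eta) / eta.

Let dh (t : R) : is_derive t 1 h (h' t).
Proof.
apply: is_derive_eq (is_derive_fun_comp (is_derive_smooth_step _) (is_derive_funM
  (is_derive_funB (is_derive_fun_id _) (is_derive_fun_cst _ _))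
  (is_derive_fun_cst _ _))) _.
by rewrite /h'; ring.
Qed.

Let h_itv t : 0 <= h t <= 1. Proof. exact: smooth_step_itv. Qed.

Let h'_itv t : 0 <= h' t <= 2 / eta.
Proof.
have /andP[h0 h2] := smooth_step'_itv ((t - al) / eta).
by rewrite /h' divr_ge0 ?(ltW eta_gt0)//= ler_pM2r ?invr_gt0.
Qed.

Let h0 t : t <= al -> h t = 0.
Proof.
move=> tal; apply: smooth_step0.
by rewrite pmulr_lle0 ?invr_gt0// subr_le0.
Qed.

Let h1 t : al + eta <= t -> h t = 1.
Proof. by move=> tal; apply: smooth_step1; rewrite ler_pdivlMr// mul1r; lra. Qed.

Let Hprim : exists H : R -> R, forall t : R, is_derive t 1 H (h t * gauss t).
Proof.
apply: primitive_exists.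
  move=> t; exact: is_derive_continuous (is_derive_funM (dh t) (is_derive_gauss t)).
apply: (le_integrable _ _ _ (integrable_gauss R)) => //.
  apply/measurable_EFinP; apply: continuous_measurable_fun => t.
  exact: is_derive_continuous (is_derive_funM (dh t) (is_derive_gauss t)).
move=> t _ /=; rewrite lee_fin normrM !ger0_norm ?(ltW (gauss_gt0 t))//.
  by have /andP[_ ?] := h_itv t; rewrite ler_piMl ?(ltW (gauss_gt0 t)).
by have /andP[] := h_itv t.
Qed.

(** The function [f] solves f' - t f = h - c, where [c] is the Gaussian mean of the step [h]. It is
    the primitive [Q] of (h - c) gauss, divided by gauss. Centring by [c] makes [Q] vanish at both
    infinities, so [Q] is dominated by the Gaussian tail and Mills' bounds control f and t f. The
    Lipschitz bound on f' is a bound on its derivative f + t f' + h'. *)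
Lemma stein_smooth_indicator : exists (h f f' : R -> R) (c : R),
  [/\ [/\ continuous h, forall t, 0 <= h t <= 1, forall t, t <= al -> h t = 0,
          forall t, al + eta <= t -> h t = 1 &
          forall s t, `|h t - h s| <= 2 / eta * `|t - s|],
      [/\ forall t : R, is_derive t 1 f (f' t),
          forall t, f' t = t * f t + h t - c, forall t, `|f t| <= I,
          forall t, `|f' t| <= 2 &
          forall s t, `|f' t - f' s| <= (2 * I + 4 / eta) * `|t - s|] &
      G (al + eta) <= c * I <= G al].
Proof.
have I0 := gauss_total_gt0 GI.
have [H1 dH1] := Hprim.
pose H t := H1 t - H1 al.
have dH (t : R) : is_derive t 1 H (h t * gauss t).
  by apply: is_derive_eq (is_derive_funB (dH1 t) (is_derive_fun_cst _ _)) _; rewrite subr0.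
pose x1 := al + eta.
have alx1 : al <= x1 by rewrite lerDl ltW.
have g0 t := ltW (@gauss_gt0 R t).
have H_al : H al = 0 by rewrite /H subrr.
have H_le t : t <= al -> H t = 0.
  move=> tal; have [z /andP[_ zal]] := mean_value tal (fun x _ => dH x).
  by rewrite h0// mul0r mul0r H_al sub0r => /eqP; rewrite oppr_eq0 => /eqP.
have H_ge t : x1 <= t -> H t = H x1 + G x1 - G t.
  move=> tx1.
  have [z /andP[xz _]] := mean_value tx1 (fun x _ => is_derive_funD (dH x) (dG x)).
  by rewrite h1//; lra.
have H_x1_ge0 : 0 <= H x1.
  have [z _] := mean_value alx1 (fun x _ => dH x).
  rewrite H_al subr0 => ->; rewrite !mulr_ge0 ?subr_ge0//.
  by have /andP[] := h_itv z.
have H_x1_le : H x1 + G x1 <= G al.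
  have [z _] := mean_value alx1 (fun x _ => is_derive_funD (dH x) (dG x)).
  rewrite H_al add0r => hz; rewrite -subr_le0 hz mulr_le0_ge0 ?subr_ge0//.
  by have /andP[_ ?] := h_itv z; have := g0 z; nra.
(* [H x1 + G x1] is the integral of h gauss over the whole line, because [h] is 1 beyond [x1]. *)
pose c := (H x1 + G x1) / I.
have cI : c * I = H x1 + G x1 by rewrite /c divfK// gt_eqF.
have c0 : 0 <= c by rewrite /c; apply: mulr_ge0; [exact: addr_ge0 H_x1_ge0 (G0 _)|rewrite invr_ge0; exact: ltW].
have c1 : c <= 1.
  rewrite /c ler_pdivrMr// mul1r (le_trans H_x1_le)//.
  exact: gauss_tail_le_total.
pose Q t := H t - c * (I - G t).
have dQ (t : R) : is_derive t 1 Q ((h t - c) * gauss t).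
  apply: is_derive_eq (is_derive_funB (dH t) (is_derive_funM (is_derive_fun_cst _ c)
    (is_derive_funB (is_derive_fun_cst _ I) (dG t)))) _.
  by ring.
have hc t : `|h t - c| <= 1.
  by have /andP[? ?] := h_itv t; rewrite ler_norml; lra.
have GN t : G (- t) = I - G t by case: GI.
have Qlim e : 0 < e -> exists A, forall t, A <= `|t| -> `|Q t| <= e.
  move=> /Glim[A hA]; exists (Num.max A (Num.max x1 (- al))) => t.
  rewrite !ge_max => /and3P[At x1t alt].
  case: (ger0P t) At x1t alt => t0 At x1t alt.
    rewrite /Q H_ge// mulrBr cI.
    have -> : H x1 + G x1 - G t - (H x1 + G x1 - c * G t) = - ((1 - c) * G t) by ring.
    rewrite normrN ger0_norm ?mulr_ge0// ?subr_ge0//.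
    by have := hA _ At; have := G0 t; nra.
  rewrite /Q H_le; last by lra.
  rewrite -GN sub0r normrN ger0_norm; last exact: mulr_ge0 c0 (G0 _).
  by have := hA _ At; have := G0 (- t); nra.
have QG t : `|Q t| <= G `|t|.
  rewrite -[leRHS]mul1r.
  apply: (gauss_tail_dominates_both GI dQ) => // s.
  by rewrite normrM (ger0_norm (g0 s)) ler_wpM2r.
have gn0 (t : R) : gauss t != 0 by rewrite gt_eqF ?gauss_gt0.
pose f t := Q t / gauss t.
pose f' t := t * f t + h t - c.
have df (t : R) : is_derive t 1 f (f' t).
  apply: is_derive_eq (is_derive_funM (dQ t) (is_derive_funV (gn0 t) (is_derive_gauss t))) _.
  by rewrite /f' /f; field.
have gN (t : R) : gauss `|t| = gauss t by rewrite /gauss real_normK ?num_real.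
have fI t : `|f t| <= I.
  rewrite /f normrM normfV (ger0_norm (g0 t)) ler_pdivrMr ?gauss_gt0//.
  by rewrite (le_trans (QG t))// -gN; exact: mills_bound.
have tf t : `|t * f t| <= 1.
  rewrite /f mulrA normrM normfV (ger0_norm (g0 t)) ler_pdivrMr ?gauss_gt0// mul1r.
  rewrite normrM (le_trans _ (norm_mills GI t))//.
  by rewrite ler_wpM2l.
have f'2 t : `|f' t| <= 2.
  rewrite /f' -addrA (le_trans (ler_normD _ _))//.
  by have := tf t; have := hc t; lra.
pose D := I + 2 / eta.
(* [f' * gauss] again has a derivative dominated by the Gaussian, which is
   why [t * f' t] stays bounded. *)
pose W t := t * Q t + (h t - c) * gauss t.
have WE t : W t = f' t * gauss t by rewrite /W /f' /f; field.
have dW (t : R) : is_derive t 1 W (Q t + h' t * gauss t).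
  apply: is_derive_eq (is_derive_funD (is_derive_funM (is_derive_fun_id t) (dQ t))
    (is_derive_funM (is_derive_funB (dh t) (is_derive_fun_cst t c)) (is_derive_gauss t))) _.
  by ring.
have h'n t : `|h' t| <= 2 / eta by have /andP[? ?] := h'_itv t; rewrite ger0_norm.
have WD t : `|W t| <= D * G `|t|.
  apply: (gauss_tail_dominates_both GI dW) => [s|e e0].
    rewrite (le_trans (ler_normD _ _))// mulrDl lerD//.
      by rewrite (le_trans (QG s))// -gN; exact: mills_bound.
    by rewrite normrM (ger0_norm (g0 s)) ler_wpM2r.
  have e20 : 0 < e / 2 by rewrite divr_gt0.
  have [A hA] := @gauss_le_small R _ e20; exists A => s /hA.
  rewrite gN WE normrM (ger0_norm (g0 s)) => gs.
  by have := f'2 s; have := g0 s; nra.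
have D0 : 0 <= D by rewrite addr_ge0 ?(ltW I0)// divr_ge0 ?ltW.
have tf' t : `|t * f' t| <= D.
  rewrite -(ler_pM2r (gauss_gt0 t)) -{1}(ger0_norm (g0 t)) -normrM -mulrA -WE normrM.
  rewrite (le_trans (ler_wpM2l (normr_ge0 _) (WD t)))// mulrCA ler_wpM2l//.
  exact: norm_mills GI t.
have lip (F F' : R -> R) K : (forall t : R, is_derive t 1 F (F' t)) ->
    (forall t, `|F' t| <= K) -> forall s t, `|F t - F s| <= K * `|t - s|.
  move=> dF FK s t; wlog st : s t / s <= t.
    move=> wl; have [/wl//|/ltW/wl] := leP s t.
    by rewrite distrC (distrC s t).
  have [z _ ->] := mean_value st (fun x _ => dF x).
  by rewrite normrM ler_wpM2r.
have df' (t : R) : is_derive t 1 f' (f t + t * f' t + h' t).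
  apply: is_derive_eq (is_derive_funB (is_derive_funD (is_derive_funM
    (is_derive_fun_id t) (df t)) (dh t)) (is_derive_fun_cst t c)) _.
  by ring.
exists h, f, f', c; split.
- split=> //; first by move=> t; exact: is_derive_continuous (dh t).
  exact: lip dh h'n.
- split=> //; apply: lip df' _ => t.
  rewrite (le_trans (ler_normD _ _))//; have := ler_normD (f t) (t * f' t).
  have := fI t; have := tf' t; have := h'n t; rewrite /D.
  have -> : 4 / eta = 2 / eta + 2 / eta by field; rewrite gt_eqF.
  by lra.
- by rewrite cI H_x1_le andbT lerDr.
Qed.

End stein.

(** * Normal approximation of sums of independent variables *)

Section joint_law.
Context d1 d2 (T1 : measurableType d1) (T2 : measurableType d2) (R : realType).
Local Open Scope ereal_scope.

(** Rectangles form a pi-system that generates the product sigma-algebra and contains the whole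
    space. The measures need not be probabilities: below, one of them is a law restricted to an
    event. *)
Lemma finite_measure_rectangle_ext
    (m1 m2 : {measure set (T1 * T2) -> \bar R}) :
  m1 setT < +oo ->
  (forall A B, measurable A -> measurable B -> m1 (A `*` B) = m2 (A `*` B)) ->
  forall X, measurable X -> m1 X = m2 X.
Proof.
move=> m1oo m12 X mX.
pose C : set (set (T1 * T2)) :=
  [set C | exists A, measurable A /\ exists B, measurable B /\ C = A `*` B].
apply: (measure_unique C (fun=> setT)) => //.
- rewrite measurable_prod_measurableType //; congr (<<s _ >>).
  rewrite predeqE; split => [[A mA [B mB <-]]|[A [mA [B [mB ->]]]]].
    by exists A; split => //; exists B.
  by exists A => //; exists B.
- move=> /= _ _ [X1 [mX1 [X2 [mX2 ->]]]] [Y1 [mY1 [Y2 [mY2 ->]]]].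
  rewrite -setXI; exists (X1 `&` Y1); split; first exact: measurableI.
  by exists (X2 `&` Y2); split => //; exact: measurableI.
- by move=> _; exists setT; split => //; exists setT; split => //; rewrite setXTT.
- by rewrite bigcup_const//; exists 0%N.
- by move=> _ [A [mA [B [mB ->]]]]; exact: m12.
Qed.

End joint_law.

(** * Independence of a coordinate from a linear combination of the others *)

Section independence.
Context d (T : measurableType d) (R : realType) (P : probability T R).

Definition rv_of d' (T' : measurableType d') (f : T -> T')
  (mf : measurable_fun setT f) : {RV P >-> T'} := mfun_Sub (mem_set mf).

Definition indep_rv (X Y : T -> R) := forall A B : set R,
  measurable A -> measurable B ->
  P (X @^-1` A `&` Y @^-1` B) = (P (X @^-1` A) * P (Y @^-1` B))%E.

(** The joint law is the product of the marginals, so Fubini factorises the expectation;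
    integrability under the product is first obtained from an iterated integral of absolute
    values. *)
Lemma integral_indep (X Y : T -> R) (u v : R -> R) :
  measurable_fun setT X -> measurable_fun setT Y -> indep_rv X Y ->
  measurable_fun setT u -> measurable_fun setT v ->
  P.-integrable setT (EFin \o (u \o X)) ->
  P.-integrable setT (EFin \o (v \o Y)) ->
  P.-integrable setT (EFin \o (fun w => u (X w) * v (Y w))) /\
  \int[P]_w (u (X w) * v (Y w)) = \int[P]_w u (X w) * \int[P]_w v (Y w).
Proof.
move=> mX mY XY mu mv iu iv.
pose X' := rv_of mX; pose Y' := rv_of mY.
have mZ : measurable_fun setT (fun w => (X w, Y w)) by exact: measurable_fun_pair.
pose Z' := rv_of mZ.
pose g (p : R * R) : \bar R := (u p.1 * v p.2)%:E.
have mg : measurable_fun setT g.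
  apply/measurable_EFinP; apply: measurable_funM.
    by apply: measurableT_comp => //.
  by apply: measurableT_comp => //.
have pE : forall S, measurable S -> (distribution P X' \x distribution P Y')%E S = distribution P Z' S.
  by apply: product_measure_unique => A B mA mB; rewrite /distribution/= /pushforward -XY.
have /integrableP[_ iuy] := iu; have /integrableP[_ ivy] := iv.
have ig : (distribution P X' \x distribution P Y')%E.-integrable setT g.
  apply/(integrable12ltyP _ _ mg).
  pose c := fine (\int[P]_w `|(v (Y w))%:E|)%E.
  have cE : (\int[P]_w `|(v (Y w))%:E| = c%:E)%E.
    by rewrite /c fineK// ge0_fin_numE// integral_ge0.
  have c0 : 0 <= c by rewrite fine_ge0// integral_ge0.
  rewrite (eq_integral (fun x => c%:E * `|(u x)%:E|)%E); last first.
    move=> x _; rewrite /g/=.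
    under eq_integral do rewrite normrM EFinM.
    rewrite ge0_integralZl//; last first.
      by apply: measurableT_comp => //; apply: measurableT_comp.
    rewrite ge0_integral_distribution//; last first.
      by apply: measurableT_comp => //; apply: measurableT_comp.
    by rewrite [X in (_ * X)%E]cE muleC.
  rewrite ge0_integralZl//; last first.
    by apply: measurableT_comp => //; apply: measurableT_comp.
  rewrite ge0_integral_distribution//; last first.
    by apply: measurableT_comp => //; apply: measurableT_comp.
  by rewrite lte_mul_pinfty// lee_fin.
have iuv : P.-integrable setT (g \o Z').
  apply/integrableP; split; first exact: measurableT_comp.
  move/integrableP : ig => [_].
  rewrite (eq_measure_integral (distribution P Z')); last by move=> A mA _; exact: pE.
  by rewrite ge0_integral_distribution//; exact: measurableT_comp.
split=> //.
have : (\int[P]_w (u (X w) * v (Y w))%:E = (\int[P]_w (u (X w))%:E) * (\int[P]_w (v (Y w))%:E))%E.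
  transitivity (\int[distribution P Z']_p g p)%E; first by rewrite integral_distribution.
  transitivity (\int[(distribution P X' \x distribution P Y')%E]_p g p)%E.
    by apply: eq_measure_integral => A mA _; exact: esym (pE _ mA).
  rewrite -integral12_prod_meas1// /fubini_F.
  have [r rE] : exists r, (\int[P]_w (v (Y w))%:E = r%:E)%E.
    exists (\int[P]_w v (Y w)); rewrite fineK//; exact: integrable_fin_num.
  have iv' : (distribution P Y').-integrable setT (EFin \o v).
    apply/integrableP; split; first exact/measurable_EFinP.
    by rewrite ge0_integral_distribution//; apply: measurableT_comp => //; exact/measurable_EFinP.
  transitivity (\int[distribution P X']_x ((u x)%:E * r%:E))%E.
    apply: eq_integral => x _; rewrite /g/=.
    under eq_integral do rewrite EFinM.
    rewrite (integralZl measurableT iv') -rE.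
    by rewrite integral_distribution//; exact/measurable_EFinP.
  rewrite rE integral_distribution//; first last.
  - exact: (integrableZr measurableT r iu).
  - by apply: emeasurable_funM => //; exact/measurable_EFinP.
  by rewrite -(integralZr measurableT iu).
move=> h; rewrite /Rintegral h fineM//; exact: integrable_fin_num.
Qed.

(* One event at a time, the joint law of [sum + b X_i] with the remaining
   coordinates is again a product, by uniqueness of measures on rectangles. *)
Section sums.
Context (I : choiceType) (X : I -> {RV P >-> R}) (indX : mutually_independent X).

(** The finite intersections of [mutually_independent], indexed by a list so that coordinates can be
    peeled off by induction. *)
Definition cylinder (J : seq I) (B : I -> set R) : set T :=
  [set w | forall j, j \in J -> B j (X j w)].

Lemma cylinder_cons i J B : cylinder (i :: J) B = X i @^-1` B i `&` cylinder J B.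
Proof.
apply/seteqP; split=> w /=.
  by move=> h; split; [apply: h; rewrite mem_head|move=> j jJ; apply: h; rewrite inE jJ orbT].
by move=> [hi hJ] j; rewrite inE => /predU1P[->//|/hJ].
Qed.

Lemma measurable_cylinder J B : (forall i, measurable (B i)) -> measurable (cylinder J B).
Proof.
move=> mB; elim: J => [|i J IH].
  rewrite (_ : cylinder _ _ = setT)//; by apply/seteqP; split=> // w _ /= j.
rewrite cylinder_cons; apply: measurableI => //.
by rewrite -[X in measurable X]setTI; exact: measurable_funP.
Qed.

Lemma cylinder_prob J B : uniq J -> (forall i, measurable (B i)) ->
  P (cylinder J B) = (\prod_(j <- J) fine (P (X j @^-1` B j)))%:E.
Proof.
move=> uJ mB; rewrite -[LHS]fineK; last exact: fin_num_measure (measurable_cylinder _ mB).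
congr EFin; have := indX [fset j in J]%fset mB.
rewrite (_ : \bigcap_(i in _) _ = cylinder J B); last first.
  apply/seteqP; split=> w /= h j; first by move=> jJ; apply: h; rewrite /= !inE.
  by rewrite /= !inE => /h.
move=> ->; apply: perm_big; apply: uniq_perm => //.
by move=> j; rewrite !inE.
Qed.

Lemma cylinder_prob_cons i J B : uniq (i :: J) -> (forall i, measurable (B i)) ->
  P (cylinder (i :: J) B) = (P (X i @^-1` B i) * P (cylinder J B))%E.
Proof.
move=> /[dup] uiJ /andP[_ uJ] mB; rewrite !cylinder_prob// big_cons EFinM fineK//.
by apply: fin_num_measure; rewrite -[X in measurable X]setTI; exact: measurable_funP.
Qed.

Definition lin_comb (b : I -> R) (s : seq I) (w : T) := \sum_(i <- s) b i * X i w.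

Lemma measurable_lin_comb b s : measurable_fun setT (lin_comb b s).
Proof.
by apply: measurable_sum => i; apply: measurable_funM => //; exact: measurable_funP.
Qed.

Lemma lin_comb_cylinder b s J B C : uniq (s ++ J) -> (forall i, measurable (B i)) ->
  measurable C ->
  P (lin_comb b s @^-1` C `&` cylinder J B) =
  (P (lin_comb b s @^-1` C) * P (cylinder J B))%E.
Proof.
elim: s J B C => [|i s IH] J B C.
  move=> uJ mB mC; have [C0|C0] := pselect (C 0).
    rewrite (_ : _ @^-1` _ = setT); last first.
      by apply/seteqP; split => // w _; rewrite /= /lin_comb big_nil.
    by rewrite setTI probability_setT mul1e.
  rewrite (_ : _ @^-1` _ = set0); last first.
    by apply/seteqP; split => // w; rewrite /= /lin_comb big_nil.
  by rewrite set0I measure0 mul0e.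
move=> /= /andP[isJ usJ] mB mC.
have mcJ := measurable_cylinder J mB.
have mV := measurable_lin_comb b s.
have mXi : measurable_fun setT (X i) by exact: measurable_funP.
pose Z w := (lin_comb b s w, X i w).
have mZ : measurable_fun setT Z by exact: measurable_fun_pair.
pose f (p : R * R) := b i * p.2 + p.1.
have mf : measurable_fun setT f.
  by apply: measurable_funD => //; apply: measurable_funM.
have PJ : P (cylinder J B) \is a fin_num by exact: fin_num_measure.
have uisJ : uniq (s ++ i :: J).
  by rewrite uniq_catC /= mem_cat uniq_catC usJ andbT orbC -mem_cat.
have uis : uniq (s ++ [:: i]).
  by move: uisJ; rewrite -cat1s catA cat_uniq => /andP[].
(* On rectangles the claim is the induction hypothesis with [X i] moved from the sum to the list of
   free coordinates. *)
have rect (K : seq I) A D : uniq (s ++ i :: K) -> measurable A -> measurable D ->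
    P (Z @^-1` (A `*` D) `&` cylinder K B) =
    (P (lin_comb b s @^-1` A) * P (X i @^-1` D) * P (cylinder K B))%E.
  move=> uK mA mD; pose B' j := if j == i then D else B j.
  have mB' j : measurable (B' j) by rewrite /B'; case: ifP.
  have iK : i \notin K.
    by move: uK; rewrite cat_uniq => /and3P[_ _ /andP[]].
  have KE : cylinder K B' = cylinder K B.
    apply/seteqP; split=> w h j jK; have := h j jK; rewrite /B';
      by case: eqP => // ji; move: iK; rewrite -ji jK.
  have := IH _ B' A uK mB' mA.
  rewrite cylinder_prob_cons//; last first.
    by move: uK; rewrite cat_uniq => /and3P[].
  rewrite cylinder_cons KE {1 2}/B' eqxx muleA => <-.
  by congr (P _); rewrite setIA.
pose c := NngNum (fine_ge0 (measure_ge0 P (cylinder J B))).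
have mZC : measurable (f @^-1` C) by rewrite -[X in measurable X]setTI; exact: mf.
have lE : lin_comb b (i :: s) = f \o Z.
  by apply/funext => w; rewrite /lin_comb/= big_cons.
(* [m1] is the law of the pair [Z] restricted to the cylinder event, [m2] the law of [Z] scaled by
   the probability of that event. They agree on rectangles, hence on the preimage of [C] under the
   map [f] that forms the longer sum. *)
pose m1 : {measure set (R * R) -> \bar R} := pushforward (mrestr P mcJ) Z.
pose m2 : {measure set (R * R) -> \bar R} := mscale c (pushforward P Z).
have : m1 mZ (f @^-1` C) = m2 mZ (f @^-1` C).
  apply: finite_measure_rectangle_ext => //.
    rewrite /m1/= /pushforward/= /mrestr/=.
    apply: le_lt_trans (probability_le1 P _) (ltry _).
    by rewrite preimage_setT; exact: measurableI.
  move=> A D mA mD; rewrite /m1 /m2/= /mscale/= /pushforward/= /mrestr/=.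
  rewrite (rect J)// fineK// muleC; congr (_ * _)%E.
  have := rect [::] A D uis mA mD.
  rewrite (_ : cylinder [::] B = setT) ?setIT ?probability_setT ?mule1 => [->//|].
  by apply/seteqP; split=> // w _ /= j.
rewrite /m1 /m2/= /mscale/= /pushforward/= /mrestr/= fineK// lE muleC.
by [].
Qed.

Lemma indep_coord_lin_comb b s i : uniq (i :: s) -> indep_rv (X i) (lin_comb b s).
Proof.
move=> uis A B mA mB.
have := @lin_comb_cylinder b s [:: i] (fun=> A) B.
rewrite cylinder_cons (_ : cylinder [::] _ = setT) ?setIT; last first.
  by apply/seteqP; split=> // w _ /= j.
rewrite setIC muleC => -> //.
by rewrite uniq_catC.
Qed.

End sums.
End independence.

Section expectation_calculus.
Context d (T : measurableType d) (R : realType) (P : probability T R).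
Implicit Types f g : T -> R.

Definition intble f := P.-integrable setT (EFin \o f).

Lemma intbleD f g : intble f -> intble g -> intble (fun w => f w + g w).
Proof. exact: integrableD. Qed.

Lemma intbleB f g : intble f -> intble g -> intble (fun w => f w - g w).
Proof. exact: integrableB. Qed.

Lemma intbleZ r f : intble f -> intble (fun w => r * f w).
Proof. exact: integrableZl. Qed.

Lemma intble_cst r : intble (fun=> r).
Proof. exact: finite_measure_integrable_cst. Qed.

Lemma intble_dominated f g : measurable_fun setT f -> intble g ->
  (forall w, `|f w| <= g w) -> intble f.
Proof.
move=> mf ig fg; apply: le_integrable ig => //; first exact/measurable_EFinP.
by move=> w _ /=; rewrite lee_fin (le_trans (fg w))// ler_norm.
Qed.

Lemma intble_bounded f M : measurable_fun setT f -> (forall w, `|f w| <= M) -> intble f.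
Proof. by move=> mf fM; exact: intble_dominated mf (intble_cst M) fM. Qed.

Lemma intble_norm f : intble f -> intble (fun w => `|f w|).
Proof. by move=> fi; exact: integrable_norm. Qed.

Lemma intble_sum (I : Type) (s : seq I) (F : I -> T -> R) :
  (forall i, intble (F i)) -> intble (fun w => \sum_(i <- s) F i w).
Proof.
move=> iF; elim: s => [|i s IH].
  rewrite (_ : (fun _ => _) = fun=> 0); first exact: intble_cst.
  by apply/funext => w; rewrite big_nil.
rewrite (_ : (fun _ => _) = fun w => F i w + \sum_(j <- s) F j w); first exact: intbleD.
by apply/funext => w; rewrite big_cons.
Qed.

Lemma RintegralT_sum (I : Type) (s : seq I) (F : I -> T -> R) :
  (forall i, intble (F i)) ->
  \int[P]_w (\sum_(i <- s) F i w) = \sum_(i <- s) \int[P]_w F i w.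
Proof.
move=> iF; elim: s => [|i s IH].
  by under eq_Rintegral do rewrite big_nil; rewrite big_nil Rintegral_cst// mul0r.
under eq_Rintegral do rewrite big_cons.
by rewrite big_cons RintegralD//; [rewrite IH|exact: iF|exact: intble_sum].
Qed.

Lemma RintegralT_le f g : intble f -> intble g -> (forall w, f w <= g w) ->
  \int[P]_w f w <= \int[P]_w g w.
Proof. by move=> fi gi fg; exact: le_Rintegral. Qed.

Lemma RintegralT_cst r : \int[P]_w (fun=> r) w = r.
Proof. by rewrite Rintegral_cst// [X in fine X]probability_setT mulr1. Qed.

Lemma Rintegral_abs_le f g : intble f -> intble g -> (forall w, `|f w| <= g w) ->
  `|\int[P]_w f w| <= \int[P]_w g w.
Proof.
move=> fi gi fg; rewrite ler_norml -mulN1r -RintegralZl//; apply/andP; split.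
  apply: RintegralT_le => //; first exact: intbleZ.
  by move=> w; have := fg w; rewrite ler_norml mulN1r => /andP[].
by apply: RintegralT_le => // w; have := fg w; rewrite ler_norml => /andP[].
Qed.

End expectation_calculus.

(** * Stein's method for linear combinations of independent variables *)

Section stein_sums.
Context d (T : measurableType d) (R : realType) (P : probability T R).
Variables (f f' : R -> R) (K F : R).
Hypothesis df : forall t : R, is_derive t 1 f (f' t).
Hypothesis f_bd : forall t, `|f t| <= F.
Hypothesis f'_bd : forall t, `|f' t| <= 2.
Hypothesis f'_lip : forall s t, `|f' t - f' s| <= K * `|t - s|.

Let mf : measurable_fun setT f.
Proof.
by apply: continuous_measurable_fun => t; exact: is_derive_continuous (df t).
Qed.

Let K0 : 0 <= K.
Proof. by have := f'_lip 0 1; rewrite subr0 normr1 mulr1; exact: le_trans. Qed.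

Let mf' : measurable_fun setT f'.
Proof.
apply: continuous_measurable_fun => t; apply/cvgrPdist_le => e e0.
near=> u; rewrite (le_trans (f'_lip _ _))//.
have : `|t - u| <= e / (K + 1).
  near: u; apply: cvgr_dist_le; first exact: cvg_id.
  by rewrite divr_gt0// ltr_wpDl.
rewrite ler_pdivlMr ?ltr_wpDl// => h.
by have := normr_ge0 (t - u); lra.
Unshelve. all: by end_near. Qed.

(** The increment of f' is bounded both by s = K |y| and by 4, and min(s, 4) <= 4 s^dl. The
    remainder is then of order 1 + dl in y, so that after multiplication by the variable only a
    moment of order 2 + dl is required. *)
Lemma taylor_remainder (v y dl : R) : 0 < dl <= 1 ->
  `|f (v + y) - f v - y * f' v| <= `|y| * (4 * (K * `|y|) `^ dl).
Proof.
move=> /andP[dl0 dl1].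
pose g t := f (v + t) - t * f' v.
have dg (t : R) : is_derive t 1 g (f' (v + t) - f' v).
  have h1 := is_derive_fun_comp (df (v + t)) (is_derive_funD (is_derive_fun_cst t v) (is_derive_fun_id t)).
  apply: is_derive_eq (is_derive_funB h1 (is_derive_funM (is_derive_fun_id t) (is_derive_fun_cst t (f' v)))) _.
  by ring.
have mvt : exists2 z, `|z| <= `|y| & g y - g 0 = (f' (v + z) - f' v) * y.
  have [y0|y0] := leP 0 y.
    have [z /andP[z0 zy] h] := mean_value y0 (fun t _ => dg t).
    by exists z; [rewrite !ger0_norm|rewrite h subr0].
  have [z /andP[z0 zy] h] := mean_value (ltW y0) (fun t _ => dg t).
  exists z; first by rewrite (ler0_norm zy) (ltr0_norm y0) lerN2.
  by rewrite -opprB h sub0r mulrN opprK.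
have {mvt} [z zy gE] := mvt.
have -> : f (v + y) - f v - y * f' v = g y - g 0 by rewrite /g addr0; ring.
rewrite gE normrM mulrC ler_wpM2l//.
have h1 : `|f' (v + z) - f' v| <= K * `|y|.
  rewrite (le_trans (f'_lip _ _))// ler_wpM2l//.
  by rewrite [v + z]addrC addrK.
have h2 : `|f' (v + z) - f' v| <= 4.
  by rewrite (le_trans (ler_normB _ _))//; have := f'_bd (v + z); have := f'_bd v; lra.
have t0 : 0 <= K * `|y| by rewrite mulr_ge0.
have [t1|t1] := leP (K * `|y|) 1.
  apply: (le_trans h1); have [->|tn0] := eqVneq (K * `|y|) 0.
    by rewrite mulr_ge0 ?powR_ge0.
  have : K * `|y| <= (K * `|y|) `^ dl.
    by apply: ger1_powR; rewrite // t1 andbT lt_neqAle eq_sym tn0.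
  by have := powR_ge0 (K * `|y|) dl; lra.
apply: (le_trans h2); have : 1 <= (K * `|y|) `^ dl.
  by rewrite -(powRr0 (K * `|y|)) ler_powR// ltW.
lra.
Qed.

Section one_summand.
Variables (X V : T -> R) (b dl m : R).
Hypotheses (mX : measurable_fun setT X) (mV : measurable_fun setT V).
Hypothesis XV : indep_rv P X V.
Hypothesis iX2 : intble P (fun w => X w ^+ 2).
Hypothesis X_mean : \int[P]_w X w = 0.
Hypothesis X_var : \int[P]_w (X w ^+ 2) = 1.
Hypothesis dl01 : 0 < dl <= 1.
Hypothesis iXdl : intble P (fun w => X w ^+ 2 * `|X w| `^ dl).
Hypothesis X_dl : \int[P]_w (X w ^+ 2 * `|X w| `^ dl) <= m.

Let absX : forall w, `|X w| <= 2^-1 * (1 + X w ^+ 2).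
Proof.
move=> w; have := sqr_ge0 (`|X w| - 1).
rewrite sqrrB real_normK ?num_real// mulr1 expr1n => h.
rewrite -(ler_pM2l (ltr0n R 2 : 0 < 2)); move: h; set u := X w ^+ 2; set v := `|_|.
by rewrite -mulr_natr => h; lra.
Qed.

Lemma intble_of_sqr : intble P X.
Proof.
apply: (intble_dominated (g := fun w => 2^-1 * (1 + X w ^+ 2))) => //.
by apply: intbleZ; apply: intbleD => //; exact: intble_cst.
Qed.

Lemma first_moment_le1 : \int[P]_w `|X w| <= 1.
Proof.
apply: le_trans (_ : \int[P]_w (2^-1 * (1 + X w ^+ 2)) <= 1).
  apply: RintegralT_le => //; first exact: intble_norm intble_of_sqr.
  by apply: intbleZ; apply: intbleD => //; exact: intble_cst.
rewrite RintegralZl//; last by apply: intbleD => //; exact: intble_cst.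
rewrite RintegralD//; last exact: intble_cst.
by rewrite X_var RintegralT_cst; lra.
Qed.

(** Expand [f (W w)] around [V], which is independent of [X]. The zeroth-order term vanishes because
    [X] is centred, the first-order term is b^2 E f'(V) because [X] has variance 1, and replacing
    f'(V) by f'(W) costs at most K |b| E|X|. *)
Lemma stein_one (W := fun w => V w + b * X w) :
  `|b ^+ 2 * \int[P]_w f' (W w) - \int[P]_w (b * X w * f (W w))| <=
  b ^+ 2 * (4 * (K * `|b|) `^ dl * m + K * `|b|).
Proof.
have iX := intble_of_sqr.
have mW : measurable_fun setT W.
  by apply: measurable_funD => //; apply: measurable_funM.
have ifV : intble P (fun w => f (V w)).
  by apply: (@intble_bounded _ _ _ _ _ F) => //; exact: measurableT_comp.
have if'V : intble P (fun w => f' (V w)).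
  by apply: (@intble_bounded _ _ _ _ _ 2) => //; exact: measurableT_comp.
have if'W : intble P (fun w => f' (W w)).
  by apply: (@intble_bounded _ _ _ _ _ 2) => //; exact: measurableT_comp.
have [iXf EXf] := integral_indep mX mV XV (@measurable_id _ _ setT) mf iX ifV.
have msq : measurable_fun setT (fun x : R => x ^+ 2) by exact: measurable_funX.
have [iX2f EX2f] := integral_indep mX mV XV msq mf' iX2 if'V.
rewrite X_mean mul0r in EXf; rewrite X_var mul1r in EX2f.
pose r w := f (W w) - f (V w) - b * X w * f' (V w).
have mr : measurable_fun setT r.
  apply: measurable_funB.
    by apply: measurable_funB; apply: measurableT_comp.
  by apply: measurable_funM; [apply: measurable_funM|apply: measurableT_comp].
pose g w := b ^+ 2 * (4 * (K * `|b|) `^ dl) * (X w ^+ 2 * `|X w| `^ dl).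
have ig : intble P g by exact: intbleZ.
have rg w : `|b * X w * r w| <= g w.
  rewrite normrM (le_trans (ler_wpM2l _ (taylor_remainder _ _ dl01)))//.
  rewrite normrM mulrA -expr2 exprMn !real_normK ?num_real//.
  rewrite (mulrA K) powRM ?mulr_ge0// /g le_eqVlt; apply/orP; left; apply/eqP.
  by ring.
have ibXr : intble P (fun w => b * X w * r w).
  apply: intble_dominated ig rg; apply: measurable_funM => //.
  exact: measurable_funM.
have E1 : \int[P]_w (b * X w * f (W w)) =
   b ^+ 2 * \int[P]_w f' (V w) + \int[P]_w (b * X w * r w).
  transitivity (\int[P]_w (b * (X w * f (V w)) + (b ^+ 2 * (X w ^+ 2 * f' (V w)) + b * X w * r w))).
    by apply: eq_Rintegral => w _; rewrite /r; ring.
  rewrite RintegralD//; first last.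
  - by apply: intbleD => //; exact: intbleZ.
  - exact: intbleZ.
  rewrite RintegralD//; last exact: intbleZ.
  by rewrite !RintegralZl// EXf EX2f mulr0 add0r.
have E2 : `|\int[P]_w f' (W w) - \int[P]_w f' (V w)| <= K * `|b|.
  rewrite -RintegralB//.
  have iKX : intble P (fun w => K * `|b| * `|X w|) by apply: intbleZ; exact: intble_norm.
  apply: (le_trans (Rintegral_abs_le (intbleB if'W if'V) iKX _)).
    move=> w; rewrite (le_trans (f'_lip _ _))// /W [V w + _]addrC addrK normrM mulrA.
    by rewrite lexx.
  rewrite RintegralZl//; last exact: intble_norm.
  by rewrite ler_piMr ?mulr_ge0// first_moment_le1.
have E3 : `|\int[P]_w (b * X w * r w)| <= b ^+ 2 * (4 * (K * `|b|) `^ dl) * m.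
  rewrite (le_trans (Rintegral_abs_le ibXr ig rg))// RintegralZl//.
  by rewrite ler_wpM2l// mulr_ge0 ?sqr_ge0// mulr_ge0 ?powR_ge0.
rewrite E1 opprD addrA -mulrBr (le_trans (ler_normB _ _))//.
rewrite [leRHS]mulrDr addrC lerD//; first by rewrite -!mulrA in E3 *.
by rewrite normrM ger0_norm ?sqr_ge0// ler_wpM2l ?sqr_ge0.
Qed.

End one_summand.

Variables (I : choiceType) (X : I -> {RV P >-> R}) (dl m : R).
Hypothesis indX : mutually_independent X.
Hypothesis iX2 : forall i, intble P (fun w => X i w ^+ 2).
Hypothesis X_mean : forall i, \int[P]_w X i w = 0.
Hypothesis X_var : forall i, \int[P]_w (X i w ^+ 2) = 1.
Hypothesis dl01 : 0 < dl <= 1.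
Hypothesis iXdl : forall i, intble P (fun w => X i w ^+ 2 * `|X i w| `^ dl).
Hypothesis X_dl : forall i, \int[P]_w (X i w ^+ 2 * `|X i w| `^ dl) <= m.

Let mX i : measurable_fun setT (X i). Proof. exact: measurable_funP. Qed.

Let iX i : intble P (X i). Proof. exact: intble_of_sqr (mX i) (iX2 i). Qed.

Lemma lin_comb_moments b s : uniq s ->
  [/\ intble P (lin_comb X b s), intble P (fun w => lin_comb X b s w ^+ 2) &
      \int[P]_w (lin_comb X b s w ^+ 2) = \sum_(i <- s) b i ^+ 2].
Proof.
elim: s => [_|i s IH /[dup] uis /andP[_ /IH[i1 i2 E2]]].
  have E : lin_comb X b [::] = fun=> 0.
    by apply/funext => w; rewrite /lin_comb big_nil.
  rewrite E; split; first exact: intble_cst.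
    by apply: (@intble_bounded _ _ _ _ _ 0) => // w; rewrite expr0n normr0.
  rewrite big_nil; under eq_Rintegral do rewrite expr0n.
  by rewrite Rintegral_cst// mul0r.
have [iXV EXV] := integral_indep (mX i) (measurable_lin_comb X b s)
  (indep_coord_lin_comb indX b uis) (@measurable_id _ _ setT) (@measurable_id _ _ setT) (iX i) i1.
rewrite X_mean mul0r in EXV.
have E : lin_comb X b (i :: s) = fun w => b i * X i w + lin_comb X b s w.
  by apply/funext => w; rewrite /lin_comb big_cons.
have Esq : (fun w => lin_comb X b (i :: s) w ^+ 2) = fun w =>
    b i ^+ 2 * X i w ^+ 2 + (2 * b i * (X i w * lin_comb X b s w) + lin_comb X b s w ^+ 2).
  by apply/funext => w; rewrite E; ring.
have j1 : intble P (fun w => b i ^+ 2 * X i w ^+ 2) by exact: intbleZ.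
have j2 : intble P (fun w => 2 * b i * (X i w * lin_comb X b s w)) by exact: intbleZ.
split.
- by rewrite E; apply: intbleD => //; exact: intbleZ.
- by rewrite Esq; apply: intbleD => //; exact: intbleD.
- rewrite Esq RintegralD//; last exact: intbleD.
  rewrite RintegralD//.
  have := @RintegralZl _ _ _ P setT _ (b i ^+ 2) measurableT (iX2 i).
  have := @RintegralZl _ _ _ P setT _ (2 * b i) measurableT iXV.
  rewrite /= => -> ->.
  by rewrite EXV mulr0 add0r E2 X_var mulr1 big_cons.
Qed.

(** For each [i], the full sum is split as [b i * X i] plus the combination over [rem i s], which is
    independent of [X i]; the one-summand errors add up with weights [b i ^+ 2]. *)
Lemma stein_sum b s (B : R) : uniq s -> (forall i, `|b i| <= B) ->
  `|(\sum_(i <- s) b i ^+ 2) * \int[P]_w f' (lin_comb X b s w)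
    - \int[P]_w (lin_comb X b s w * f (lin_comb X b s w))| <=
  (\sum_(i <- s) b i ^+ 2) * (4 * (K * B) `^ dl * m + K * B).
Proof.
move=> us bB; set W := lin_comb X b s.
have mW : measurable_fun setT W by exact: measurable_lin_comb.
have iXf i : intble P (fun w => b i * X i w * f (W w)).
  apply: (@intble_dominated _ _ _ _ _ (fun w => `|b i * X i w| * F)).
  - apply: measurable_funM; first exact: measurable_funM.
    exact: measurableT_comp.
  - under eq_fun do rewrite mulrC.
    by apply: intbleZ; apply: intble_norm; exact: intbleZ.
  - by move=> w; rewrite normrM ler_wpM2l.
have -> : \int[P]_w (W w * f (W w)) = \sum_(i <- s) \int[P]_w (b i * X i w * f (W w)).
  rewrite -RintegralT_sum//; apply: eq_Rintegral => w _.
  by rewrite {1}/W /lin_comb mulr_suml.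
rewrite mulr_suml -sumrB (le_trans (ler_norm_sum _ _ _))// mulr_suml.
rewrite big_seq [leRHS]big_seq; apply: ler_sum => i si.
have uis : uniq (i :: rem i s) by rewrite /= mem_rem_uniqF// rem_uniq.
have -> : W = fun w => lin_comb X b (rem i s) w + b i * X i w.
  apply/funext => w; rewrite /W /lin_comb (perm_big _ (perm_to_rem si))/=.
  by rewrite big_cons addrC.
apply: (le_trans (stein_one (b i) (mX i) (measurable_lin_comb X b _)
  (indep_coord_lin_comb indX b uis) (iX2 i) (X_mean i) (X_var i) dl01 (iXdl i) (X_dl i))).
have m0 : 0 <= m.
  apply: le_trans (X_dl i); apply: Rintegral_ge0 => w _.
  by rewrite mulr_ge0 ?sqr_ge0 ?powR_ge0.
rewrite ler_wpM2l ?sqr_ge0// lerD//; last by rewrite ler_wpM2l.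
rewrite ler_wpM2r// ler_wpM2l//; case/andP: dl01 => dl0 _.
by apply: ge0_ler_powR; rewrite ?nnegrE ?mulr_ge0 ?(ltW dl0) ?ler_wpM2l// (le_trans _ (bB i)).
Qed.

End stein_sums.

(** * From Stein's bound to a uniform rate for tail probabilities *)

Section normal_approximation.
Context d (T : measurableType d) (R : realType) (P : probability T R).
Variables (I : choiceType) (X : I -> {RV P >-> R}) (dl m : R).
Hypothesis indX : mutually_independent X.
Hypothesis iX2 : forall i, intble P (fun w => X i w ^+ 2).
Hypothesis X_mean : forall i, \int[P]_w X i w = 0.
Hypothesis X_var : forall i, \int[P]_w (X i w ^+ 2) = 1.
Hypothesis dl01 : 0 < dl <= 1.
Hypothesis iXdl : forall i, intble P (fun w => X i w ^+ 2 * `|X i w| `^ dl).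
Hypothesis X_dl : forall i, \int[P]_w (X i w ^+ 2 * `|X i w| `^ dl) <= m.
Hypothesis m_ge0 : 0 <= m.
Variables (G : R -> R) (J : R).
Hypothesis GJ : gauss_tail G J.

Let J0 : 0 < J. Proof. exact: gauss_total_gt0 GJ. Qed.

Lemma first_moment_le (Z : T -> R) (B : R) : 0 < B -> measurable_fun setT Z ->
  intble P (fun w => Z w ^+ 2) -> \int[P]_w (Z w ^+ 2) <= B ^+ 2 ->
  intble P Z /\ \int[P]_w `|Z w| <= B.
Proof.
move=> B0 mZ iZ2 Z2.
have iq : intble P (fun w => (2 * B)^-1 * (B ^+ 2 + Z w ^+ 2)).
  by apply: intbleZ; apply: intbleD => //; exact: intble_cst.
have Zq w : `|Z w| <= (2 * B)^-1 * (B ^+ 2 + Z w ^+ 2).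
  rewrite ler_pdivlMl ?mulr_gt0//.
  have := sqr_ge0 (`|Z w| - B); rewrite sqrrB real_normK ?num_real//.
  by rewrite -mulr_natr; lra.
have iZ : intble P Z by exact: intble_dominated iq Zq.
split=> //; apply: le_trans (_ : \int[P]_w ((2 * B)^-1 * (B ^+ 2 + Z w ^+ 2)) <= B).
  by apply: RintegralT_le => //; exact: intble_norm.
rewrite RintegralZl//; last by apply: intbleD => //; exact: intble_cst.
rewrite RintegralD//; last exact: intble_cst.
rewrite RintegralT_cst ler_pdivrMl ?mulr_gt0//; move: Z2; rewrite !expr2; lra.
Qed.

Lemma Rintegral_indicator (A : set T) : measurable A ->
  intble P (\1_A) /\ \int[P]_w \1_A w = fine (P A).
Proof.
move=> mA; split; last by rewrite /Rintegral integral_indic// setIT.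
apply: (@intble_bounded _ _ _ _ _ 1) => // w.
by rewrite /indic; case: (_ \in _); rewrite ?normr1 ?normr0.
Qed.

(** The 4 collects the L^2 approximation error and the variance defect, 2 each. The next two terms
    are Stein's error with the variance bounded by 2. [J^-1] pays for the width of the smoothing
    window. *)
Definition rate_cst : R :=
  4 + 8 * (2 * J + 4) `^ dl * m + 2 * (2 * J + 4) + J^-1.

Section one_variable.
Variables (b : I -> R) (s : seq I) (Y : T -> R) (B : R).
Hypothesis us : uniq s.
Hypothesis B01 : 0 < B <= 1.
Hypothesis bB : forall i, `|b i| <= B.
Hypothesis s2B : `|1 - \sum_(i <- s) b i ^+ 2| <= B.
Hypothesis mY : measurable_fun setT Y.
Hypothesis iYW : intble P (fun w => (Y w - lin_comb X b s w) ^+ 2).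
Hypothesis YW : \int[P]_w ((Y w - lin_comb X b s w) ^+ 2) <= B ^+ 2.

(** The width of the smoothing window. The Lipschitz constant of f' is of order 1/r, so Stein's
    error involves B/r, while the window itself costs a multiple of r; this choice makes B/r equal
    to r. *)
Let r := Num.sqrt B.

(** Stein's equation turns E h(W) - c into E f'(W) - E W f(W). Three errors remain: replacing [Y] by
    [W], where the Lipschitz constant 2/r meets an L^1 distance at most [B]; the defect of the
    variance of [W] from 1; and the bound of [stein_sum]. *)
Lemma smooth_normal_approx (h f f' : R -> R) (c : R) :
  continuous h -> (forall t, 0 <= h t <= 1) ->
  (forall s t, `|h t - h s| <= 2 / r * `|t - s|) ->
  (forall t : R, is_derive t 1 f (f' t)) ->
  (forall t, f' t = t * f t + h t - c) -> (forall t, `|f t| <= J) ->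
  (forall t, `|f' t| <= 2) ->
  (forall s t, `|f' t - f' s| <= (2 * J + 4 / r) * `|t - s|) ->
  `|\int[P]_w h (Y w) - c| <= (rate_cst - J^-1) * r `^ dl.
Proof.
move=> ch h01 hlip df f'E fJ f'2 f'lip.
have [B0 B1] := andP B01; have [dl0 dl1] := andP dl01.
have r0 : 0 < r by rewrite sqrtr_gt0.
have rr : r ^+ 2 = B by rewrite sqr_sqrtr// ltW.
have r1 : r <= 1 by rewrite -sqrtr1 ler_sqrt.
have rq : r <= r `^ dl by apply: ger1_powR; rewrite ?r0.
pose W := lin_comb X b s; have s2B' := s2B.
have mW : measurable_fun setT W by exact: measurable_lin_comb.
have mh : measurable_fun setT h by exact: continuous_measurable_fun.
have [iW iW2 EW2] := lin_comb_moments indX iX2 X_mean X_var b us.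
have [iD ED] := first_moment_le B0 (measurable_funB mY mW) iYW YW.
have hn t : `|h t| <= 1 by have /andP[? ?] := h01 t; rewrite ger0_norm.
have ihY : intble P (fun w => h (Y w)).
  by apply: intble_bounded => //; exact: measurableT_comp.
have ihW : intble P (fun w => h (W w)).
  by apply: intble_bounded => //; exact: measurableT_comp.
have cf : continuous f by move=> t; exact: is_derive_continuous (df t).
have mf : measurable_fun setT f by exact: continuous_measurable_fun.
have iWf : intble P (fun w => W w * f (W w)).
  apply: (@intble_dominated _ _ _ _ _ (fun w => J * `|W w|)).
  - by apply: measurable_funM => //; exact: measurableT_comp.
  - by apply: intbleZ; exact: intble_norm.
  - by move=> w; rewrite normrM mulrC ler_wpM2r.
have f'h : (fun w => f' (W w)) = fun w => (W w * f (W w) + h (W w)) - c.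
  by apply/funext => w; rewrite f'E.
have if' : intble P (fun w => f' (W w)).
  by rewrite f'h; apply: intbleB; [exact: intbleD|exact: intble_cst].
have E1 : `|\int[P]_w h (Y w) - \int[P]_w h (W w)| <= 2 * r.
  rewrite -RintegralB//.
  have iq : intble P (fun w => 2 / r * `|Y w - W w|) by apply: intbleZ; exact: intble_norm.
  apply: (le_trans (Rintegral_abs_le (intbleB ihY ihW) iq _)).
    by move=> w; exact: hlip.
  rewrite RintegralZl//; last exact: intble_norm.
  apply: le_trans (ler_wpM2l _ ED) _; first by rewrite divr_ge0// ltW.
  by rewrite -rr; rewrite le_eqVlt; apply/orP; left; apply/eqP; field; rewrite gt_eqF.
have E2 : \int[P]_w h (W w) - c = \int[P]_w f' (W w) - \int[P]_w (W w * f (W w)).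
  rewrite f'h RintegralB//; [|exact: intbleD|exact: intble_cst].
  by rewrite RintegralD// RintegralT_cst; ring.
have E3 : `|\int[P]_w f' (W w)| <= 2.
  have := Rintegral_abs_le if' (intble_cst P 2) (fun w => f'2 (W w)).
  by rewrite RintegralT_cst.
have E4 := stein_sum df fJ f'2 f'lip indX iX2 X_mean X_var dl01 iXdl X_dl us bB.
rewrite -/W in E4; set s2 := \sum_(i <- s) _ in s2B' E4 EW2.
have s22 : 0 <= s2 <= 2.
  have s20 : 0 <= s2 by rewrite sumr_ge0// => i _; rewrite sqr_ge0.
  by rewrite s20/=; move: s2B'; rewrite ler_norml => /andP[? ?]; lra.
set K := 2 * J + 4 / r in E4.
have KB : K * B <= (2 * J + 4) * r.
  rewrite /K -rr mulrDl; have -> : 4 / r * r ^+ 2 = 4 * r by field; rewrite gt_eqF.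
  rewrite [leRHS]mulrDl lerD2r ler_wpM2l ?mulr_ge0 ?(ltW J0)//.
  by rewrite expr2 ler_piMr// ltW.
have K0 : 0 <= K by rewrite /K addr_ge0 ?divr_ge0 ?mulr_ge0 ?(ltW J0) ?(ltW r0).
have KBd : (K * B) `^ dl <= (2 * J + 4) `^ dl * r `^ dl.
  have C0 : 0 <= 2 * J + 4 by rewrite addr_ge0// mulr_ge0// ltW.
  rewrite -powRM ?(ltW r0)//; apply: ge0_ler_powR; rewrite ?nnegrE ?(ltW dl0)//.
    by rewrite mulr_ge0// ltW.
  by rewrite mulr_ge0// ltW.
have -> : \int[P]_w h (Y w) - c = (\int[P]_w h (Y w) - \int[P]_w h (W w)) +
   ((1 - s2) * \int[P]_w f' (W w) +
   (s2 * \int[P]_w f' (W w) - \int[P]_w (W w * f (W w)))).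
  by move: E2; set u := \int[P]_w h (W w); lra.
rewrite (le_trans (ler_normD _ _))//.
rewrite (le_trans (lerD E1 (ler_normD _ _)))//.
have E5 : `|(1 - s2) * \int[P]_w f' (W w)| <= 2 * r.
  rewrite normrM mulrC (le_trans (ler_pM _ _ E3 s2B'))// ler_wpM2l//.
  by rewrite -rr expr2 ler_piMr// ltW.
apply: le_trans (lerD (lexx _) (lerD E5 E4)) _.
set q := r `^ dl in rq KBd *.
have q0 : 0 <= q by rewrite powR_ge0.
have F1 : s2 * (K * B) <= 2 * ((2 * J + 4) * q).
  case/andP: s22 => s20 s22; apply: ler_pM => //.
    by rewrite mulr_ge0// ltW.
  by apply: (le_trans KB); rewrite ler_wpM2l// addr_ge0 ?mulr_ge0 ?(ltW J0).
have F2 : s2 * (m * (K * B) `^ dl) <= 2 * (m * ((2 * J + 4) `^ dl * q)).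
  case/andP: s22 => s20 s22; apply: ler_pM => //.
    by rewrite mulr_ge0// powR_ge0.
  by rewrite ler_wpM2l.
have -> : s2 * (4 * (K * B) `^ dl * m + K * B) =
          4 * (s2 * (m * (K * B) `^ dl)) + s2 * (K * B) by ring.
have -> : (rate_cst - J^-1) * q = 4 * q + 4 * (2 * (m * ((2 * J + 4) `^ dl * q))) +
    2 * ((2 * J + 4) * q) by rewrite /rate_cst; ring.
lra.
Qed.

(** The indicator of [x < Y] lies between a step rising on [x, x + r] and a step rising on
    [x - r, x]. Their Gaussian means differ from [G x / J] by at most [r / J]. *)
Lemma normal_tail_rate x :
  `|fine (P [set w | x < Y w]) - G x / J| <= rate_cst * r `^ dl.
Proof.
have [B0 B1] := andP B01; have [dl0 dl1] := andP dl01.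
have r0 : 0 < r by rewrite sqrtr_gt0.
have r1 : r <= 1 by rewrite -sqrtr1 ler_sqrt.
have rq : r <= r `^ dl by apply: ger1_powR; rewrite ?r0.
have mA : measurable [set w | x < Y w].
  rewrite (_ : [set w | _] = Y @^-1` `]x, +oo[); last first.
    by apply/seteqP; split => w; rewrite /= in_itv/= andbT.
  by rewrite -[X in measurable X]setTI; exact: mY.
have [iA EA] := Rintegral_indicator mA.
pose A : set T := [set w | x < Y w].
have indE w : (\1_A : T -> R) w = (x < Y w)%R%:R.
  by rewrite indicE; case: (boolP (x < Y w)) => h; [rewrite mem_set|rewrite memNset//; exact/negP].
have [h [f [f' [c [[ch h01 h0 h1 hlip] [df f'E fJ f'2 f'lip] /andP[cl cu]]]]]] :=
  stein_smooth_indicator GJ x r0.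
have [g [k [k' [c' [[cg g01 g0 g1 glip] [dk k'E kJ k'2 k'lip] /andP[cl' cu']]]]]] :=
  stein_smooth_indicator GJ (x - r) r0.
have /ler_normlP[H1 H2] := smooth_normal_approx ch h01 hlip df f'E fJ f'2 f'lip.
have /ler_normlP[H3 H4] := smooth_normal_approx cg g01 glip dk k'E kJ k'2 k'lip.
have int01 (e : R -> R) : continuous e -> (forall t, 0 <= e t <= 1) -> intble P (fun w => e (Y w)).
  move=> ce e01; have me : measurable_fun setT e by exact: continuous_measurable_fun.
  apply: (@intble_bounded _ _ _ _ _ 1); first exact: measurableT_comp.
  by move=> w; have /andP[? ?] := e01 (Y w); rewrite ger0_norm.
have L : \int[P]_w h (Y w) <= fine (P [set w | x < Y w]).
  rewrite -EA -/A; apply: RintegralT_le => //; first exact: int01.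
  move=> w; rewrite indE; case: ltP => xY; last by rewrite h0.
  by case/andP: (h01 (Y w)).
have U : fine (P [set w | x < Y w]) <= \int[P]_w g (Y w).
  rewrite -EA -/A; apply: RintegralT_le => //; first exact: int01.
  move=> w; rewrite indE; case: ltP => xY; last by case/andP: (g01 (Y w)).
  by rewrite g1// subrK ltW.
have D1 : G x - G (x + r) <= r.
  have xr : x <= x + r by rewrite lerDl ltW.
  by have := gauss_tail_diff GJ xr; lra.
have D2 : G (x - r) - G x <= r.
  have xr : x - r <= x by rewrite gerBl ltW.
  by have := gauss_tail_diff GJ xr; lra.
have rJ : r / J <= J^-1 * r `^ dl by rewrite mulrC ler_wpM2l// invr_ge0 ltW.
have C1 : G x / J - r / J <= c.
  by rewrite -mulrBl ler_pdivrMr//; lra.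
have C2 : c' <= G x / J + r / J.
  by rewrite -mulrDl ler_pdivlMr//; lra.
move: H1 H2 H3 H4; rewrite !mulrBl; set q := r `^ dl in rJ *.
move=> H1 H2 H3 H4; rewrite ler_norml; apply/andP; split; lra.
Qed.

End one_variable.

(* Apply the one-sided estimate to [Y] and [- Y]. *)
Lemma normal_two_sided_rate b s (Y : T -> R) (B x : R) :
  uniq s -> 0 < B <= 1 -> (forall i, `|b i| <= B) ->
  `|1 - \sum_(i <- s) b i ^+ 2| <= B ->
  measurable_fun setT Y ->
  intble P (fun w => (Y w - lin_comb X b s w) ^+ 2) ->
  \int[P]_w ((Y w - lin_comb X b s w) ^+ 2) <= B ^+ 2 ->
  0 <= x ->
  `|fine (P [set w | x < `|Y w|]) - 2 * G x / J| <= 2 * rate_cst * Num.sqrt B `^ dl.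
Proof.
move=> us B01 bB s2B mY iYW YW x0.
have mgt (Z : T -> R) : measurable_fun setT Z -> measurable [set w | x < Z w].
  move=> mZ; rewrite (_ : [set w | _] = Z @^-1` `]x, +oo[); last first.
    by apply/seteqP; split => w; rewrite /= in_itv/= andbT.
  by rewrite -[X in measurable X]setTI; exact: mZ.
have mNY : measurable_fun setT (fun w => - Y w) by exact: measurableT_comp.
have -> : fine (P [set w | x < `|Y w|]) =
    fine (P [set w | x < Y w]) + fine (P [set w | x < - Y w]).
  rewrite -fineD; [|exact: fin_num_measure (mgt _ mY)|exact: fin_num_measure (mgt _ mNY)].
  rewrite -measureU//; [|exact: mgt|exact: mgt|].
    congr (fine (P _)); apply/seteqP; split => w /=.
      by rewrite lter_normr => /orP.
    by move=> /orP; rewrite -lter_normr.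
  apply/seteqP; split => // w [/= h1 h2]; lra.
have E1 := normal_tail_rate us B01 bB s2B mY iYW YW x.
have NE w : - Y w - lin_comb X (fun i => - b i) s w = - (Y w - lin_comb X b s w).
  rewrite /lin_comb (eq_bigr (fun i => - (b i * X i w))) => [|i _]; last by rewrite mulNr.
  by rewrite sumrN; ring.
have NE2 : (fun w => (- Y w - lin_comb X (fun i => - b i) s w) ^+ 2) =
   fun w => (Y w - lin_comb X b s w) ^+ 2.
  by apply/funext => w; rewrite NE sqrrN.
have E2 : `|fine (P [set w | x < - Y w]) - G x / J| <= rate_cst * Num.sqrt B `^ dl.
  apply: (@normal_tail_rate (fun i => - b i) s _ B us B01) => //.
  - by move=> i; rewrite normrN.
  - by under eq_bigr do rewrite sqrrN.
  - by rewrite NE2.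
  - by rewrite NE2.
move: E1 E2; set q := Num.sqrt B `^ dl; set g := G x / J => E1 E2.
have -> : 2 * G x / J = g + g by rewrite /g; field; rewrite gt_eqF.
rewrite opprD addrACA (le_trans (ler_normD _ _))//; lra.
Qed.

End normal_approximation.

(** * Slowly varying functions *)

Section lebesgue_scaling.
Context (R : realType).
Notation mu := (@lebesgue_measure R).

(** The image of Lebesgue measure under multiplication by [c], rescaled by [c], gives every interval
    its length; uniqueness concludes. *)
Lemma lebesgue_measure_scale (c : R) (A : set R) : 0 < c -> measurable A ->
  mu ((fun x => c * x) @^-1` A) = ((c^-1)%:E * mu A)%E.
Proof.
move=> c0 mA.
pose f : measurableTypeR R -> measurableTypeR R := fun x => c * x.
have mf : measurable_fun setT f by exact: measurable_funM.
pose m (h : measurable_fun setT f) : {measure set (measurableTypeR R) -> \bar R} :=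
  mscale (NngNum (ltW c0)) (pushforward mu f).
have mE : mu A = m mf mf A.
  apply: lebesgue_measure_unique => // _ [[a b] _ <-] /=.
  rewrite /m /= /mscale /= /pushforward /f.
  have -> : (fun x => c * x) @^-1` `]a, b] = `](a / c), (b / c)]%classic.
    apply/seteqP; split => x /=; rewrite !in_itv/= ltr_pdivrMr// ler_pdivlMr//;
      by rewrite [x * c]mulrC.
  rewrite !lebesgue_measure_itv/= !lte_fin ltr_pM2r ?invr_gt0//.
  case: ifPn => _; last by rewrite mule0.
  by rewrite -!EFinB -EFinM; congr EFin; field; rewrite gt_eqF.
rewrite mE /m /= /mscale /= /pushforward /f muleA -EFinM mulVf ?gt_eqF//.
by rewrite mul1e.
Qed.

End lebesgue_scaling.

Section slowly_varying_integers.
Context (R : realType) (L : R -> R) (svL : slowly_varying L).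
Notation mu := (@lebesgue_measure R).

Let mL : measurable_fun (`]0, +oo[ : set R) L. Proof. by case: svL. Qed.
Let L0 x : 0 < x -> 0 < L x. Proof. by case: svL => _ + _; exact. Qed.

(** Multipliers for which the ratio of [L] is not yet within [e] of 1. The range [1, 6] contains
    both l and rho l whenever l is in [3, 6] and rho in [1/3, 1]; the successor keeps the argument
    of [L] positive. *)
Let bad (e : R) (k : nat) : set R :=
  [set l | 1 <= l <= 6 /\ e < `|L (l * k.+1%:R) / L k.+1%:R - 1|].

Let measurable_bad e k : measurable (bad e k).
Proof.
have k0 : 0 < k.+1%:R :> R by rewrite ltr0n.
have mI : measurable (`[1, 6] : set R) by [].
have mf : measurable_fun (`[1, 6] : set R) (fun l => `|L (l * k.+1%:R) / L k.+1%:R - 1|).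
  apply: measurableT_comp => //; apply: measurable_funB => //.
  apply: measurable_funM => //.
  apply: (@measurable_comp _ _ _ _ _ _ (`]0, +oo[%classic : set R) L _ (fun l : R => l * k.+1%:R)) => //.
    move=> _ [l + <-]; rewrite /= !in_itv/= => /andP[l1 _].
    by rewrite andbT mulr_gt0// (lt_le_trans _ l1).
  exact: measurable_funM.
have := mf mI _ (measurable_itv `]e, +oo[%R).
congr (measurable _); apply/seteqP; split => l /=; rewrite !in_itv/= andbT.
  by move=> [? ?].
by move=> [? ?].
Qed.

(* Pointwise convergence gives convergence in measure on [1, 6]. *)
Lemma bad_small (e : R) : 0 < e ->
  exists K : nat, forall k, (K <= k)%N -> (mu (bad e k) <= (2^-1)%:E)%E.
Proof.
move=> e0; pose B n := \bigcup_(k in [set k | (n <= k)%N]) bad e k.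
have mB n : measurable (B n) by apply: bigcup_measurable => k _; exact: measurable_bad.
pose S : set R := `[1, 6]%classic.
have mS : measurable S by exact: measurable_itv.
have B16 n : B n `<=` S by move=> l [k _ [+ _]]; rewrite /S /= in_itv.
have mu16 : (mu S < +oo)%E.
  by rewrite lebesgue_measure_itv/=; case: ifP => _; rewrite -?EFinB ltry.
have B0 : \bigcap_n B n = set0.
  apply/seteqP; split => // l Bl.
  have [k _ [/andP[l1 l6] _]] := Bl 0%N I.
  have l0 : 0 < l by exact: lt_le_trans l1.
  case: svL => _ _ /(_ l l0) /cvgrPdist_le /(_ e e0) [A [_ hA]].
  pose n := Num.trunc `|A|.
  have nA (i : nat) : (n <= i)%N -> A < i.+1%:R.
    move=> nk; apply: le_lt_trans (ler_norm A) _.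
    apply: (lt_le_trans (truncnS_gt `|A|)).
    by rewrite ler_nat ltnS.
  have [i nk [_]] := Bl n I.
  rewrite distrC ltNge => /negP; apply; exact: hA (nA i nk).
have : mu \o B @ \oo --> mu (\bigcap_n B n).
  apply: nonincreasing_cvg_mu => //.
  - by apply: le_lt_trans mu16; exact: (@le_measure _ _ _ mu _ S (mem_set (mB 0%N)) (mem_set mS) (B16 0%N)).
  - by rewrite B0.
  - move=> n p np; apply/subsetPset => l [k /= pk bl]; exists k => //=.
    exact: leq_trans np pk.
rewrite B0 measure0 => /fine_cvgP[Bfin /cvgrPdist_le].
move=> /(_ 2^-1); rewrite invr_gt0 ltr0n => /(_ isT) Bsmall.
have [N _ HN] := filterI Bfin Bsmall.
exists N => k Nk; apply: (@le_trans _ _ (mu (B N))).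
  apply: (@le_measure _ _ _ mu _ _ (mem_set (measurable_bad e k)) (mem_set (mB N))).
  by move=> l bl; exists k.
have [/= f1 f2] := HN N (leqnn N).
rewrite -(fineK f1) lee_fin; move: f2; rewrite sub0r normrN.
exact: le_trans (ler_norm _).
Qed.

(* For indices [k <= k' <= 3 k] the scaled good sets meet in [3 k, 6 k]. *)
Lemma slowly_varying_compare (th : R) : 1 < th ->
  exists K : nat, (0 < K)%N /\ forall k k' : nat, (K <= k)%N -> (k <= k' <= 3 * k)%N ->
    L k'%:R <= th * L k%:R /\ L k%:R <= th * L k'%:R.
Proof.
(* Chosen so that (1 + e) / (1 - e) = th: two values of [L] within relative error [e] of a common
   third one differ by a factor at most [th]. *)
move=> th1; pose e := (th - 1) / (th + 1).
have th10 : 0 < th + 1 by lra.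
have e0 : 0 < e by rewrite divr_gt0//; lra.
have eE : 1 + e = th * (1 - e) by rewrite /e; field; rewrite gt_eqF.
have [K HK] := bad_small e0.
exists K.+1; split => // -[//|k] [|k'] Kk /andP[kk' k'3]; first by [].
have k0 : 0 < k.+1%:R :> R by rewrite ltr0n.
have k'0 : 0 < k'.+1%:R :> R by rewrite ltr0n.
pose rho : R := k.+1%:R / k'.+1%:R.
have rho0 : 0 < rho by rewrite divr_gt0.
have rho1 : rho <= 1 by rewrite ler_pdivrMr// mul1r ler_nat.
have rho3 : 3^-1 <= rho.
  rewrite ler_pdivlMr// ler_pdivrMl//.
  by have := k'3; rewrite -(ler_nat R) natrM.
(* The interval [3, 6] has length 3, the first bad set has measure at most 1/2, and the rescaled
   second one at most 3/2, so some [l] avoids both. *)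
have [l [l3 l6 good1 good2]] : exists l, [/\ 3 <= l, l <= 6, ~ bad e k l & ~ bad e k' (rho * l)].
  apply: contrapT => nex.
  pose S : set R := `[3, 6]%classic.
  have mS : measurable S by exact: measurable_itv.
  have sub : S `<=` bad e k `|` (fun x => rho * x) @^-1` bad e k'.
    move=> l; rewrite /S /= in_itv/= => /andP[l3 l6].
    apply: contrapT => /not_orP[h1 h2]; apply: nex; exists l; split => //.
  have mpre : measurable ((fun x => rho * x) @^-1` bad e k').
    rewrite -[X in measurable X]setTI.
    by apply: (@measurable_funM _ _ R setT (cst rho) id) => //; exact: measurable_bad.
  have : (mu S <= mu (bad e k) + mu ((fun x : R => (rho * x)%R) @^-1` bad e k'))%E.
    apply: le_trans (@measureU2 _ _ _ mu _ _ (measurable_bad e k) mpre).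
    have mU := measurableU _ _ (measurable_bad e k) mpre.
    exact: (@le_measure _ _ _ mu _ _ (mem_set mS) (mem_set mU) sub).
  rewrite (lebesgue_measure_scale rho0 (measurable_bad e k')).
  rewrite lebesgue_measure_itv/= lte_fin ltr_nat/= -EFinB.
  move=> /le_trans /(_ (leeD (HK k Kk) (lee_wpmul2l _ (HK k' _)))).
  have -> : (0 <= (rho^-1)%:E)%E by rewrite lee_fin invr_ge0 ltW.
  have -> : (K <= k')%N by exact: leq_trans Kk kk'.
  move=> /(_ isT isT); rewrite -EFinM -EFinD lee_fin.
  have : rho^-1 <= 3 by rewrite invf_ple ?posrE.
  lra.
have lk' : rho * l * k'.+1%:R = l * k.+1%:R.
  by rewrite /rho; field; rewrite gt_eqF.
have near1 : `|L (l * k.+1%:R) / L k.+1%:R - 1| <= e.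
  by rewrite leNgt; apply/negP => h; apply: good1; split => //; lra.
have near2 : `|L (l * k.+1%:R) / L k'.+1%:R - 1| <= e.
  rewrite leNgt; apply/negP => h; apply: good2; split; last by rewrite lk'.
  by apply/andP; split; nra.
have Lk := L0 k0; have Lk' := L0 k'0.
move: near1 near2; rewrite !ler_norml => /andP[a1 a2] /andP[b1 b2].
move: a1 a2 b1 b2; rewrite !lerBrDr !lerBlDr.
rewrite !(ler_pdivlMr _ _ Lk, ler_pdivrMr _ _ Lk, ler_pdivlMr _ _ Lk', ler_pdivrMr _ _ Lk').
set Y := L (l * _); set u := L k.+1%:R in Lk *; set v := L k'.+1%:R in Lk' *.
move=> a1 a2 b1 b2.
have e1 : 0 < 1 - e by rewrite -(pmulr_rgt0 _ (_ : 0 < th)) -?eE; lra.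
split; rewrite -(ler_pM2r e1).
  have -> : th * u * (1 - e) = u * (1 + e) by rewrite eE; ring.
  by move: a2 b1; lra.
have -> : th * v * (1 - e) = v * (1 + e) by rewrite eE; ring.
by move: b2 a1; lra.
Qed.

(** A Potter-type bound, by strong induction on halving: comparison with factor 2^e loses exactly
    what k^e gains when k doubles. Since an odd k exceeds twice its half, the comparison is needed
    up to ratio 3. *)
Lemma slowly_varying_growth (e : R) : 0 < e ->
  exists (K : nat) (c M : R), [/\ (0 < K)%N, 0 < c, 0 < M &
    forall k : nat, (K <= k)%N -> c * k%:R `^ (- e) <= L k%:R <= M * k%:R `^ e].
Proof.
move=> e0; have th1 : 1 < 2 `^ e :> R by have := gt0_ltr_powR e0 (_ : 1 \in Num.nneg) (_ : 2 \in Num.nneg) (ltr1n R 2); rewrite powR1 !nnegrE; apply.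
have [K [K0 HK]] := slowly_varying_compare th1.
have th0 : 0 < 2 `^ e :> R by lra.
have LK : 0 < L K%:R by apply: L0; rewrite ltr0n.
exists K, (L K%:R / 2 `^ e), (2 `^ e * L K%:R); split => //.
- by rewrite divr_gt0.
- by rewrite mulr_gt0.
elim/ltn_ind => k IH Kk.
have k0 : 0 < k%:R :> R by rewrite ltr0n (leq_trans K0).
have k1 : 1 <= k%:R :> R by rewrite ler1n (leq_trans K0).
have ke : 1 <= k%:R `^ e :> R by have := ler_powR k1 (ltW e0); rewrite powRr0.
rewrite powRN ler_pdivrMr ?powR_gt0//.
rewrite ler_pdivrMr//.
have [k2|k2] := ltnP k K.*2.
  have [|U1 U2] := HK K k (leqnn K); first by apply/andP; split => //; lia.
  have Lk := L0 k0.
  apply/andP; split; nra.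
pose j := k./2.
have jk : (j < k)%N by rewrite /j; lia.
have Kj : (K <= j)%N by rewrite /j; lia.
have j0 : 0 < j%:R :> R by rewrite ltr0n (leq_trans K0).
have [|U1 U2] := HK j k Kj; first by rewrite /j; apply/andP; split; lia.
have /andP[] := IH j jk Kj.
rewrite powRN ler_pdivrMr ?powR_gt0// ler_pdivrMr// => V1 V2.
have je : 2 `^ e * j%:R `^ e <= k%:R `^ e :> R.
  rewrite -powRM// ge0_ler_powR ?nnegrE ?(ltW e0)//.
  by rewrite -natrM ler_nat mul2n -[leqRHS]odd_double_half leq_addl.
have Lk := L0 k0; have Lj := L0 j0; have je0 : 0 < j%:R `^ e :> R by rewrite powR_gt0.
apply/andP; split.
  apply: (le_trans V1); set u := j%:R `^ e in je je0 *; set v := k%:R `^ e in je ke *.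
  set t := 2 `^ e in th0 th1 U1 U2 je *; nra.
apply: (le_trans U1); set u := j%:R `^ e in je je0 V2 *; set v := k%:R `^ e in je ke *.
set t := 2 `^ e in th0 th1 U1 U2 je V2 *; nra.
Qed.

End slowly_varying_integers.

(** * Negligibility of single coefficients *)

#[local] Existing Instance summability.totally_filter.

Section lattice_sums.
Context (R : realType) (a : int * int -> R).
Implicit Types (u v w : int * int) (A B : {fset int * int}) (s t : seq (int * int)).

Definition lattice_box (n : nat) : seq (int * int) :=
  [seq (j%:Z, k%:Z) | j <- index_iota 1 n.+1, k <- index_iota 1 n.+1].

Lemma lattice_box_uniq n : uniq (lattice_box n).
Proof.
apply: allpairs_uniq; rewrite ?iota_uniq//.
by move=> [j k] [j' k'] _ _ /= [-> ->].
Qed.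

Lemma size_lattice_box n : size (lattice_box n) = (n * n)%N.
Proof. by rewrite size_allpairs !size_iota subn1. Qed.

Lemma mem_lattice_box n v :
  (v \in lattice_box n) = [&& 1 <= v.1, v.1 <= n%:Z, 1 <= v.2 & v.2 <= n%:Z].
Proof.
case: v => x y /=; apply/allpairsP/idP.
  move=> [[j k] [/= + + [-> ->]]]; rewrite !mem_index_iota; lia.
move=> h; exists (`|x|%N, `|y|%N); rewrite !mem_index_iota/=; split; [lia|lia|].
by congr pair; lia.
Qed.

(** The coefficient of the innovation at [u] in the sum over the box when [a] is replaced by 0
    outside [A]. *)
Definition lattice_coef A (n : nat) u : R :=
  \sum_(v <- lattice_box n | v - u \in A) a (v - u).

Definition abs_bounded (f : int * int -> R) (M : R) :=
  forall s, uniq s -> \sum_(v <- s) `|f v| <= M.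

Lemma summable_abs_bounded (f : int * int -> R) :
  esum.summable [set: int * int] (fun v => (f v)%:E) -> exists M, abs_bounded f M.
Proof.
rewrite /summable => h; exists (fine (\esum_(v in [set: int * int]) `|(f v)%:E|)%E).
move=> s us; rewrite -lee_fin fineK; last first.
  by rewrite ge0_fin_numE//; apply: esum_ge0.
apply: esum_ge; exists [set` s].
  by split=> //; exact: finite_seq.
by rewrite -fsbig_seq// sumEFin.
Qed.

Lemma uniq_subr s u : uniq s -> uniq [seq v - u | v <- s].
Proof. by move=> us; rewrite map_inj_uniq//; exact: subIr. Qed.

Lemma lattice_coef_abs M A n u : abs_bounded a M -> `|lattice_coef A n u| <= M.
Proof.
move=> aM; rewrite /lattice_coef (le_trans (ler_norm_sum _ _ _))//.
apply: le_trans (aM _ (uniq_subr u (lattice_box_uniq n))).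
rewrite big_map [leRHS](bigID (fun v => v - u \in A))/= lerDl.
by rewrite sumr_ge0.
Qed.

Lemma sqr_sum_le (I : Type) (s : seq I) (f : I -> R) :
  (\sum_(i <- s) f i) ^+ 2 <= (size s)%:R * \sum_(i <- s) f i ^+ 2.
Proof.
elim: s => [|i s IH]; first by rewrite !big_nil expr0n mul0r.
rewrite !big_cons /= -natr1.
have Q0 : 0 <= \sum_(j <- s) f j ^+ 2 by rewrite sumr_ge0// => j _; rewrite sqr_ge0.
have [s0|s0] := posnP (size s).
  by move: IH; rewrite (size0nil s0) !big_nil /= expr2; lra.
have n0 : 0 < (size s)%:R :> R by rewrite ltr0n.
set S := \sum_(j <- s) f j in IH *; set Q := \sum_(j <- s) _ in IH Q0 *.
set n := (size s)%:R in IH n0 *; set x := f i.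
have h := sqr_ge0 (n * x - S).
have : 2 * x * S <= n * x ^+ 2 + Q.
  rewrite -(ler_pM2l n0); have : S ^+ 2 <= n * Q by [].
  move: h; rewrite !expr2; nra.
move: IH; rewrite !expr2; nra.
Qed.

(** Cauchy-Schwarz over the n^2 points of the box. *)
Lemma lattice_coef_sqr M A n u : abs_bounded (fun v => a v ^+ 2) M ->
  lattice_coef A n u ^+ 2 <= (n * n)%:R * M.
Proof.
move=> aM; rewrite /lattice_coef big_mkcond/= (le_trans (sqr_sum_le _ _))//.
rewrite size_lattice_box ler_wpM2l//.
apply: le_trans (aM _ (uniq_subr u (lattice_box_uniq n))).
rewrite big_map; apply: ler_sum => v _.
by case: ifP => _; rewrite ?expr0n/= ?normr_ge0// ler_norm.
Qed.

(** The finite set [V] is chosen before [A]: the lower bound comes from innovations that do not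
    depend on how far the truncation extends. *)
Definition mass_grows (lam : R) := exists (c : R) (n0 : nat), 0 < c /\
  forall n, (n0 <= n)%N -> exists A0 V, uniq V /\
    forall A, (A0 `<=` A)%fset -> c * n%:R `^ lam <= \sum_(u <- V) lattice_coef A n u ^+ 2.

(** A quantitative Lindeberg-type condition: each innovation contributes at most a fraction n^(-kap)
    of the variance, up to a constant and uniformly over sufficiently large truncations. *)
Definition coef_dominated := exists (kap C : R) (n0 : nat), [/\ 0 < kap, 0 < C &
  forall n, (n0 <= n)%N -> exists A0 V, uniq V /\
    forall A, (A0 `<=` A)%fset -> forall u,
      lattice_coef A n u ^+ 2 <= C * n%:R `^ (- kap) * \sum_(v <- V) lattice_coef A n v ^+ 2].

Lemma coef_dominated_of_mass (lam mu M : R) : mu < lam ->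
  (forall A n u, lattice_coef A n u ^+ 2 <= M * n%:R `^ mu) ->
  mass_grows lam -> coef_dominated.
Proof.
move=> mulam ub [c [n0 [c0 lb]]].
exists (lam - mu), ((`|M| + 1) / c), (maxn n0 1).
split; [by rewrite subr_gt0|by rewrite divr_gt0// ltr_wpDl|].
move=> n; rewrite geq_max => /andP[/lb[A0 [V [uV lbV]]] n1].
exists A0, V; split => // A /lbV h u.
have n0' : 0 < n%:R :> R by rewrite ltr0n.
have np : n%:R != 0 :> R by rewrite gt_eqF.
apply: (le_trans (ub A n u)).
apply: (@le_trans _ _ ((`|M| + 1) / c * n%:R `^ (- (lam - mu)) * (c * n%:R `^ lam))); last first.
  by rewrite ler_wpM2l// mulr_ge0 ?powR_ge0// divr_ge0 ?(ltW c0)// addr_ge0.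
have -> : (`|M| + 1) / c * n%:R `^ (- (lam - mu)) * (c * n%:R `^ lam) =
    (`|M| + 1) * (n%:R `^ (- (lam - mu)) * n%:R `^ lam) by field; rewrite gt_eqF.
rewrite -powRD ?np ?implybT// opprB subrK ler_wpM2r ?powR_ge0//.
by rewrite (le_trans (ler_norm M))// lerDl.
Qed.

Lemma sum_ge_count (I : eqType) (s : seq I) (p : pred I) (f : I -> R) (y : R) :
  (forall i, i \in s -> 0 <= f i) -> (forall i, i \in s -> p i -> y <= f i) ->
  (count p s)%:R * y <= \sum_(i <- s) f i.
Proof.
elim: s => [|i s IH] f0 fp; first by rewrite big_nil mul0r.
rewrite big_cons /= natrD mulrDl lerD//.
  case: (boolP (p i)) => pi; first by rewrite mul1r fp ?mem_head.
  by rewrite mul0r f0 ?mem_head.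
apply: IH => j js; first by apply: f0; rewrite inE js orbT.
by apply: fp; rewrite inE js orbT.
Qed.

Lemma sum_sqr_ge (V : seq (int * int)) (f : int * int -> R) (Y : R) : 0 <= Y ->
  (forall u, u \in V -> Y <= `|f u|) ->
  (size V)%:R * Y ^+ 2 <= \sum_(u <- V) f u ^+ 2.
Proof.
move=> Y0 fY; rewrite -(count_predT V); apply: sum_ge_count => u uV.
  by rewrite sqr_ge0.
by move=> _; rewrite -(real_normK (num_real (f u))) ler_sqr ?nnegrE// fY.
Qed.

Lemma fset_sub_box (A : {fset int * int}) : exists r : nat,
  forall v, v \in A -> (`|v.1| <= r%:Z) && (`|v.2| <= r%:Z).
Proof.
exists (\max_(v <- A) (`|v.1|%N + `|v.2|%N)) => v vA.
have := @leq_bigmax_seq _ (enum_fset A) xpredT (fun v => `|v.1|%N + `|v.2|%N)%N v vA isT.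
set r := (\max_(_ <- _) _)%N; lia.
Qed.

(** For a site [u] at distance more than [r] from the boundary, the translate of [A1] by [u] fits
    into the box, so the coefficient is a sum of [a] over a set between [A1] and [A]. A single line
    of at least n/2 such sites already gives exponent 1. *)
Lemma mass_grows_of_sums (s0 : R) (A1 : {fset int * int}) : 0 < s0 ->
  (forall A, (A1 `<=` A)%fset -> s0 <= `|\sum_(v <- A) a v|) -> mass_grows 1.
Proof.
move=> s00 hA; have [r hr] := fset_sub_box A1.
exists (s0 ^+ 2 / 2), (4 * r).+1; split; first by rewrite divr_gt0// exprn_gt0.
move=> n nr; pose V := [seq (r.+1%:Z, k%:Z) | k <- iota r.+1 (n - 2 * r)].
exists A1, V; split.
  by rewrite map_inj_uniq ?iota_uniq// => j k [->].
move=> A A1A.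
have coefE u : u \in V -> s0 <= `|lattice_coef A n u|.
  move=> /mapP[k]; rewrite mem_iota => kr ->{u}; set u := (_, _).
  pose B := [fset v in A | (v + u)%R \in lattice_box n]%fset.
  have -> : lattice_coef A n u = \sum_(v <- B) a v.
    rewrite /lattice_coef -big_filter.
    rewrite -(big_map (fun v => v - u) xpredT a); apply: perm_big.
    apply: uniq_perm; last 2 first.
    - exact: fset_uniq.
    - move=> v; rewrite !inE/=; apply/mapP/andP.
        by move=> [w + ->]; rewrite mem_filter subrK => /andP[].
      move=> [vA vu]; exists (v + u); last by rewrite addrK.
      by rewrite mem_filter addrK vA.
    by apply: uniq_subr; rewrite filter_uniq// lattice_box_uniq.
  apply: hA; apply/fsubsetP => v vA1; rewrite !inE/=.
  apply/andP; split; first exact: (fsubsetP A1A).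
  have /andP[h1 h2] := hr v vA1.
  by rewrite mem_lattice_box/=; move: h1 h2 kr nr; case: v {vA1} => x y /=; lia.
apply: le_trans (sum_sqr_ge (ltW s00) coefE).
rewrite size_map size_iota powRr1//.
have -> : s0 ^+ 2 / 2 * n%:R = n%:R / 2 * s0 ^+ 2 by field.
rewrite ler_pM2r ?exprn_gt0//.
rewrite ler_pdivrMr// -natrM ler_nat; lia.
Qed.

(** Absolute summability makes the finite sums Cauchy along inclusion. If arbitrarily small ones
    occurred beyond every finite set, the sums would converge to 0, against the nonzero total. *)
Lemma short_memory_sums : short_memory a ->
  exists (s0 : R) A1, 0 < s0 /\ forall A, (A1 `<=` A)%fset -> s0 <= `|\sum_(v <- A) a v|.
Proof.
move=> [/summable_abs_bounded[M aM] sum0].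
apply: contrapT => nex; move/eqP: sum0; apply.
have psE A : partial_sum a A = \sum_(v <- A) a v by rewrite /partial_sum big_seq_fsetE.
have small e : 0 < e -> forall A1, exists2 A, (A1 `<=` A)%fset & `|\sum_(v <- A) a v| < e.
  move=> e0 A1; apply: contrapT => h; apply: nex; exists e, A1; split=> // A A1A.
  by rewrite leNgt; apply/negP => ?; apply: h; exists A.
pose S := [set x : R | exists A : {fset int * int}, x = \sum_(v <- A) `|a v|].
have supS : has_sup S.
  split; first by exists (\sum_(v <- fset0) `|a v|), fset0.
  by exists M => _ [A ->]; apply: aM; exact: fset_uniq.
have split_sum (f : int * int -> R) A B : (A `<=` B)%fset ->
    \sum_(v <- B) f v = \sum_(v <- A) f v + \sum_(v <- (B `\` A)%fset) f v.
  move=> AB; rewrite (big_fsetID _ (mem A))/=; congr (_ + _).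
    apply: perm_big; apply: uniq_perm; rewrite ?fset_uniq// => v; rewrite !inE/= andbC.
    by case: (boolP (v \in A)) => //= /(fsubsetP AB) ->.
  by apply: perm_big; apply: uniq_perm; rewrite ?fset_uniq// => v; rewrite !inE/= andbC.
apply: cvg_lim => //; apply/cvgrPdist_le => e e0.
have e30 : 0 < e / 3 by rewrite divr_gt0.
have [_ [A1 ->] hA1] := sup_adherent e30 supS.
have near A : (A1 `<=` A)%fset -> `|\sum_(v <- A) a v - \sum_(v <- A1) a v| <= e / 3.
  move=> A1A; rewrite (split_sum a _ _ A1A) addrC addrA addNr add0r.
  rewrite (le_trans (ler_norm_sum _ _ _))//.
  have : \sum_(v <- A) `|a v| <= sup S by apply: sup_upper_bound => //; exists A.
  rewrite (split_sum (fun v => `|a v|) _ _ A1A); lra.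
have [A2 A12 hA2] := small _ e30 A1.
exists A1 => // A A1A /=; rewrite sub0r normrN psE.
have := near _ A1A; have := near _ A12; move: hA2.
by rewrite !(ler_norml, ltr_norml) => /andP[? ?] /andP[? ?] /andP[? ?]; lra.
Qed.

Lemma short_memory_dominated M : abs_bounded a M ->
  forall lam, 0 < lam -> mass_grows lam -> coef_dominated.
Proof.
move=> aM lam lam0; apply: (@coef_dominated_of_mass lam 0 (M ^+ 2)) => // A n u.
rewrite powRr0 mulr1 -(real_normK (num_real (lattice_coef A n u))).
have := lattice_coef_abs A n u aM => h.
by rewrite ler_sqr ?nnegrE// (le_trans _ h).
Qed.

(** The threshold 2 is the exponent in the Cauchy-Schwarz bound [lattice_coef_sqr]. *)
Lemma square_summable_dominated : square_summable a ->
  forall lam, 2 < lam -> mass_grows lam -> coef_dominated.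
Proof.
move=> /summable_abs_bounded[M aM] lam lam2.
apply: (@coef_dominated_of_mass lam 2 M) => // A n u.
rewrite powR_mulrn// -natrX -mulnn mulrC; exact: lattice_coef_sqr aM.
Qed.

End lattice_sums.

Section power_sums.
Context (R : realType).
Implicit Types (q x y s : R).

(** Comparison of y^(-q) with the integral of t^(-q) over [x, y], through the mean value theorem. It
    serves both sums of powers of integers and the increments of Psi. *)
Lemma powR_telescope q x y : 1 < q -> 0 < x -> x <= y ->
  y `^ (- q) * (y - x) <= (x `^ (1 - q) - y `^ (1 - q)) / (q - 1).
Proof.
move=> q1 x0 xy.
have [z /andP[xz zy] h] := mean_value xy (fun t xt => is_derive1_powR (1 - q) (lt_le_trans x0 (proj1 (andP xt)))).
have z0 : 0 < z := lt_le_trans x0 xz.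
rewrite ler_pdivlMr ?subr_gt0//.
have -> : x `^ (1 - q) - y `^ (1 - q) = (q - 1) * z `^ (- q) * (y - x).
  rewrite -opprB h; have -> : 1 - q - 1 = - q by ring.
  by ring.
have zy' : y `^ (- q) <= z `^ (- q).
  rewrite !powRN lef_pV2 ?posrE ?powR_gt0 ?(lt_le_trans z0)//.
  have y0 := lt_le_trans z0 zy; have q0 : 0 <= q by lra.
  by apply: ge0_ler_powR; rewrite ?nnegrE ?(ltW z0) ?(ltW y0).
have : 0 <= (z `^ (- q) - y `^ (- q)) * ((y - x) * (q - 1)).
  by rewrite !mulr_ge0 ?subr_ge0// ltW.
lra.
Qed.

Lemma riemann_sum_le s (N : nat) : 1 < s ->
  \sum_(l < N) l.+1%:R `^ (- s) <= 1 + (s - 1)^-1.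
Proof.
move=> s1; have s10 : 0 < s - 1 by lra.
suff H : \sum_(l < N.+1) l.+1%:R `^ (- s) <= 1 + (1 - (N.+1%:R : R) `^ (1 - s)) / (s - 1).
  apply: (@le_trans _ _ (\sum_(l < N.+1) l.+1%:R `^ (- s))).
    by rewrite big_ord_recr/= lerDl powR_ge0.
  apply: (le_trans H); rewrite lerD2l -[leRHS]mul1r ler_wpM2r ?invr_ge0 ?(ltW s10)//.
elim: N => [|N IH].
  by rewrite big_ord_recr big_ord0/= !powR1 add0r subrr mul0r addr0.
rewrite big_ord_recr/=.
have NN : N.+1%:R <= N.+2%:R :> R by rewrite ler_nat.
have := powR_telescope s1 (ltr0Sn R N) NN.
have -> : N.+2%:R - N.+1%:R = 1 :> R by rewrite -natrB// subSnn.
rewrite mulr1 => h; apply: le_trans (lerD IH h) _.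
by rewrite -addrA -mulrDl; apply: lerD => //; rewrite ler_pM2r ?invr_gt0//; lra.
Qed.

End power_sums.

(** * Directions towards a distant box *)

Section cone_geometry.
Context (R : realType).
Implicit Types (x y T n dl : R).

(* A lattice point within [2 n] of [T p] has norm at least [T - 8 n], hence
   direction within [10 n / (T - 8 n)] of [p]. *)
Lemma cone_direction (p1 p2 : R) dl n T x y : 0 < dl -> 1 <= n ->
  p1 ^+ 2 + p2 ^+ 2 = 1 -> (10 + 10 / dl) * n <= T ->
  `|x - T * p1| <= 2 * n -> `|y - T * p2| <= 2 * n ->
  let r := Num.sqrt (x ^+ 2 + y ^+ 2) in
  [/\ 2 * n <= r, `|x / r - p1| < dl, `|y / r - p2| < dl &
      n <= `|x| + `|y| <= 2 * T + 4 * n].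
Proof.
move=> dl0 n1 p12 CT hx hy r.
have n0 : 0 < n by lra.
have Cn : 0 < 10 / dl * n by rewrite mulr_gt0 ?divr_gt0.
have T10 : 10 * n + 10 / dl * n <= T by rewrite -mulrDl.
have p1le : `|p1| <= 1.
  rewrite -(expr_le1 (n := 2))// ?real_normK ?num_real//.
  by have := sqr_ge0 p2; lra.
have p2le : `|p2| <= 1.
  rewrite -(expr_le1 (n := 2))// ?real_normK ?num_real//.
  by have := sqr_ge0 p1; lra.
set d1 := x - T * p1 in hx; set d2 := y - T * p2 in hy.
have r0 : 0 <= r by rewrite sqrtr_ge0.
have r2 : r ^+ 2 = T ^+ 2 + 2 * T * (p1 * d1 + p2 * d2) + (d1 ^+ 2 + d2 ^+ 2).
  rewrite sqr_sqrtr ?addr_ge0 ?sqr_ge0//.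
  have -> : x = T * p1 + d1 by rewrite /d1; ring.
  have -> : y = T * p2 + d2 by rewrite /d2; ring.
  have -> : T ^+ 2 = T ^+ 2 * (p1 ^+ 2 + p2 ^+ 2) by rewrite p12 mulr1.
  by ring.
have pd : `|p1 * d1 + p2 * d2| <= 4 * n.
  rewrite (le_trans (ler_normD _ _))// !normrM.
  have := normr_ge0 d1; have := normr_ge0 d2; nra.
have dd : 0 <= d1 ^+ 2 + d2 ^+ 2 <= 8 * n ^+ 2.
  rewrite addr_ge0 ?sqr_ge0//= -(real_normK (num_real d1)) -(real_normK (num_real d2)).
  have := normr_ge0 d1; have := normr_ge0 d2; rewrite !expr2; nra.
move: pd; rewrite ler_norml => /andP[pd1 pd2]; case/andP: dd => dd1 dd2.
set e := p1 * d1 + p2 * d2 in r2 pd1 pd2; set q := d1 ^+ 2 + d2 ^+ 2 in r2 dd1 dd2.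
have rU : r <= T + 4 * n.
  rewrite -ler_sqr ?nnegrE//; last by lra.
  rewrite r2 !expr2 in dd2 *; nra.
have rL : T - 8 * n <= r.
  rewrite -ler_sqr ?nnegrE//; last by lra.
  rewrite r2 !expr2; nra.
have r2n : 2 * n <= r by lra.
have rp : 0 < r by lra.
have coord z pz dz : `|pz| <= 1 -> z = T * pz + dz -> `|dz| <= 2 * n -> `|z / r - pz| < dl.
  move=> pz1 -> hd.
  have -> : (T * pz + dz) / r - pz = (dz + (T - r) * pz) / r by field; rewrite gt_eqF.
  rewrite normrM normfV (gtr0_norm rp) ltr_pdivrMr//.
  apply: (@le_lt_trans _ _ (2 * n + 8 * n * 1)).
    rewrite (le_trans (ler_normD _ _))// lerD// normrM ler_pM//.
    by rewrite ler_norml; lra.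
  apply: (@lt_le_trans _ _ (dl * (10 / dl * n + 2 * n))); last first.
    by rewrite ler_pM2l//; lra.
  have -> : dl * (10 / dl * n + 2 * n) = 10 * n + dl * (2 * n) by field; rewrite gt_eqF.
  have : 0 < dl * (2 * n) by rewrite !mulr_gt0.
  lra.
split => //.
- by apply: coord hx => //; rewrite /d1; ring.
- by apply: coord hy => //; rewrite /d2; ring.
apply/andP; split.
  have : r <= `|x| + `|y|.
    rewrite -ler_sqr ?nnegrE ?addr_ge0// sqr_sqrtr ?addr_ge0 ?sqr_ge0//.
    rewrite -(real_normK (num_real x)) -(real_normK (num_real y)) sqrrD.
    have : 0 <= `|x| * `|y| by rewrite mulr_ge0.
    by rewrite -mulr_natr; lra.
  by lra.
have Tp z pz : `|pz| <= 1 -> `|z - T * pz| <= 2 * n -> `|z| <= T + 2 * n.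
  move=> pz1 hz; have -> : z = (z - T * pz) + T * pz by ring.
  rewrite (le_trans (ler_normD _ _))// addrC lerD// normrM.
  have T0 : 0 <= T by lra.
  by rewrite (ger0_norm T0) ler_piMr.
have := Tp x p1 p1le hx; have := Tp y p2 p2le hy; lra.
Qed.

Lemma isolated_point (s : seq (R * R)) (p : R * R) : exists2 dl : R, 0 < dl &
  forall q, q \in s -> `|q.1 - p.1| < dl -> `|q.2 - p.2| < dl -> q = p.
Proof.
elim: s => [|q s [dl dl0 IH]]; first by exists 1.
have [->|qp] := eqVneq q p.
  exists dl => // t; rewrite inE => /predU1P[->//|]; exact: IH.
pose m := Num.max `|q.1 - p.1| `|q.2 - p.2|.
have m0 : 0 < m.
  rewrite lt_max !normr_gt0 !subr_eq0 -negb_and.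
  by apply: contra qp; rewrite -pair_eqE.
exists (Num.min dl m); first by rewrite lt_min dl0.
move=> t; rewrite inE !lt_min => /predU1P[->|ts] /andP[h1 h1'] /andP[h2 h2'].
  have : m < m by rewrite {1}/m gt_max h1' h2'.
  by rewrite ltxx.
exact: IH.
Qed.

End cone_geometry.

Lemma int_dist_lt (n : nat) (i j : int) : 1 <= i -> i <= n%:Z -> 1 <= j -> j <= n%:Z ->
  `|i - j| <= n%:Z - 1.
Proof. lia. Qed.

(** * Growth of the sum of squared coefficients under long memory *)

Section long_memory.
Context (R : realType) (a : int * int -> R) (beta : R) (L : R -> R) (g : R * R -> R).
Implicit Types (u v w m : int * int).

Definition l2norm v : R := Num.sqrt ((v.1 ^+ 2 + v.2 ^+ 2)%:~R).
Definition direction v : R * R := (v.1%:~R / l2norm v, v.2%:~R / l2norm v).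
Definition l1norm v : nat := (`|v.1| + `|v.2|)%N.

Hypothesis beta12 : 1 < beta < 2.
Hypothesis svL : slowly_varying L.
Hypothesis aE : forall v, v != 0 ->
  a v = (l1norm v)%:R `^ (- beta) * L (l1norm v)%:R * g (direction v).

Lemma l1norm_gt0 v : v != 0 -> (0 < l1norm v)%N.
Proof.
case: v => x y v0; rewrite /l1norm /= lt0n; apply: contra v0 => h.
by rewrite -pair_eqE /=; lia.
Qed.

Lemma l1norm_real v : (l1norm v)%:R = `|v.1%:~R| + `|v.2%:~R| :> R.
Proof. by rewrite /l1norm natrD !pmulrn !abszE !intr_norm. Qed.

Lemma l2norm_real v : l2norm v = Num.sqrt (v.1%:~R ^+ 2 + v.2%:~R ^+ 2).
Proof. by rewrite /l2norm intrD !rmorphXn. Qed.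

Lemma l2norm_gt0 v : v != 0 -> 0 < l2norm v.
Proof.
case: v => x y v0; rewrite sqrtr_gt0 ltr0z /=.
rewrite lt_neqAle addr_ge0 ?sqr_ge0// andbT eq_sym paddr_eq0 ?sqr_ge0//.
by rewrite !sqrf_eq0; move: v0; rewrite -pair_eqE.
Qed.

Lemma direction_circle v : v != 0 -> unit_circle (direction v).
Proof.
move=> v0; have r0 := l2norm_gt0 v0.
rewrite /unit_circle /direction /= !expr_div_n -mulrDl.
have q0 : 0 <= v.1%:~R ^+ 2 + v.2%:~R ^+ 2 :> R by rewrite addr_ge0 ?sqr_ge0.
have qE : l2norm v ^+ 2 = v.1%:~R ^+ 2 + v.2%:~R ^+ 2 by rewrite l2norm_real sqr_sqrtr.
by rewrite -qE divff// sqrf_eq0 gt_eqF.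
Qed.

(* Slow variation costs an arbitrarily small power: this choice keeps
   [beta - e > 1] and [beta + e < 2]. *)
Let e : R := Num.min ((2 - beta) / 2) ((beta - 1) / 2).

Let e_gt0 : 0 < e.
Proof. by have /andP[? ?] := beta12; rewrite lt_min !divr_gt0//; lra. Qed.

Let e_lt : beta + e < 2 /\ 1 < beta - e.
Proof.
have /andP[? ?] := beta12.
have : e <= (2 - beta) / 2 by rewrite ge_min lexx.
have : e <= (beta - 1) / 2 by rewrite ge_min lexx orbT.
by split; lra.
Qed.

Let weight_lower : exists (K : nat) (c : R), [/\ (0 < K)%N, 0 < c &
  forall k, (K <= k)%N -> c * k%:R `^ (- (beta + e)) <= k%:R `^ (- beta) * L k%:R].
Proof.
have [K [c [M [K0 c0 M0 h]]]] := slowly_varying_growth svL e_gt0.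
exists K, c; split=> // k Kk; have /andP[h1 _] := h k Kk.
have k0 : k%:R != 0 :> R by rewrite pnatr_eq0 -lt0n (leq_trans K0).
by rewrite opprD powRD ?k0 ?implybT// mulrCA ler_wpM2l ?powR_ge0.
Qed.

Let weight_upper : exists2 M : R, 0 < M &
  forall k, (0 < k)%N -> k%:R `^ (- beta) * L k%:R <= M * k%:R `^ (- (beta - e)).
Proof.
have [K [c [M [K0 c0 M0 h]]]] := slowly_varying_growth svL e_gt0.
pose N := \sum_(k < K) `|L k%:R|.
have N0 : 0 <= N by exact: sumr_ge0.
exists (M + N); first by rewrite ltr_wpDr.
move=> k k0; have k0' : k%:R != 0 :> R by rewrite pnatr_eq0 -lt0n.
have -> : - (beta - e) = - beta + e by ring.
rewrite powRD ?k0' ?implybT// mulrCA ler_wpM2l ?powR_ge0//.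
have [Kk|kK] := leqP K k.
  have /andP[_ h2] := h k Kk; apply: (le_trans h2).
  by rewrite ler_wpM2r ?powR_ge0// lerDl.
have k1 : 1 <= k%:R :> R by rewrite ler1n.
have := ler_powR k1 (ltW e_gt0); rewrite powRr0 => ke.
apply: (@le_trans _ _ N); last first.
  have : 0 <= M + N by rewrite addr_ge0// ltW.
  by have := M0; nra.
apply: (le_trans (ler_norm _)).
by rewrite /N (bigD1 (Ordinal kK))//= lerDl sumr_ge0.
Qed.

(** The difference [x] equals [m + (v - w)]: [m] is [T p] up to rounding, and two points of the box
    differ by at most n - 1 in each coordinate, so [cone_direction] applies. *)
Lemma far_box_geometry (p : R * R) (dl : R) (n : nat) m (T : R) v w :
  unit_circle p -> 0 < dl -> (0 < n)%N -> (10 + 10 / dl) * n%:R <= T ->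
  `|m.1%:~R - T * p.1| <= 1 -> `|m.2%:~R - T * p.2| <= 1 ->
  v \in lattice_box n -> w \in lattice_box n ->
  let x := v - (w - m) in
  [/\ x != 0, (n <= l1norm x)%N, (l1norm x)%:R <= 2 * T + 4 * n%:R,
      `|(direction x).1 - p.1| < dl & `|(direction x).2 - p.2| < dl].
Proof.
move=> p_circle dl_gt0 n0 CT m1 m2 vG wG x.
have n1 : 1 <= n%:R :> R by rewrite ler1n.
have near (i j l : int) (t : R) : 1 <= i -> i <= n%:Z -> 1 <= j -> j <= n%:Z ->
    `|l%:~R - t| <= 1 -> `|(i - (j - l))%:~R - t| <= 2 * n%:R.
  move=> i1 i2 j1 j2 lt.
  have -> : (i - (j - l))%:~R - t = (i - j)%:~R + (l%:~R - t) :> R.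
    by rewrite !rmorphB/=; ring.
  have : `|(i - j)%:~R| <= n%:R - 1 :> R.
    by have := int_dist_lt i1 i2 j1 j2; rewrite -(ler_int R) intr_norm => /le_trans; apply; rewrite [leLHS]intrB.
  by have := ler_normD ((i - j)%:~R : R) (l%:~R - t); lra.
move: vG wG; rewrite !mem_lattice_box => /and4P[v1 v2 v3 v4] /and4P[w1 w2 w3 w4].
have h1 : `|x.1%:~R - T * p.1| <= 2 * n%:R by exact: near.
have h2 : `|x.2%:~R - T * p.2| <= 2 * n%:R by exact: near.
have [] := cone_direction dl_gt0 n1 p_circle CT h1 h2.
rewrite -l2norm_real -l1norm_real => r2n d1 d2 /andP[l1 l2].
have x0 : x != 0.
  apply/eqP => x0; move: r2n; rewrite x0 /l2norm /= expr0n addr0 sqrtr0; lra.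
by split=> //; rewrite -(ler_nat R).
Qed.

Section cone.
Variables (p : R * R) (dl sg gam : R).
Hypothesis p_circle : unit_circle p.
Hypothesis dl_gt0 : 0 < dl.
Hypothesis sg1 : `|sg| = 1.
Hypothesis gam_gt0 : 0 < gam.
Hypothesis g_sign : forall q, unit_circle q -> `|q.1 - p.1| < dl -> `|q.2 - p.2| < dl ->
  0 <= sg * g q.

(* Inside the far box all coefficients have the sign [sg], so every shifted
   box sum is at least the number of large coefficients times their size. *)
Lemma cone_mass (n : nat) m (T C' : R) (W : seq (int * int)) (N y : R) : (0 < n)%N ->
  (10 + 10 / dl) * n%:R <= T -> 2 * T + 4 * n%:R <= C' ->
  `|m.1%:~R - T * p.1| <= 1 -> `|m.2%:~R - T * p.2| <= 1 ->
  uniq W -> {subset W <= lattice_box n} -> 0 <= N -> 0 <= y ->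
  (forall k, (n <= k)%N -> k%:R <= C' -> y <= k%:R `^ (- beta) * L k%:R) ->
  (forall w, w \in W ->
     N <= (count (fun v => gam <= sg * g (direction (v - (w - m)))) (lattice_box n))%:R) ->
  exists A0 V, uniq V /\ forall A, (A0 `<=` A)%fset ->
    (size W)%:R * (N * (gam * y)) ^+ 2 <= \sum_(u <- V) lattice_coef a A n u ^+ 2.
Proof.
move=> n0 CT TC' m1 m2 uW WG N0 y0 hy hN.
(* This set contains every difference that occurs, so truncation beyond it removes no term. *)
exists [fset (v - (w - m))%R | v in lattice_box n, w in lattice_box n]%fset.
exists [seq w - m | w <- W]; split; first exact: uniq_subr.
move=> A A0A; rewrite -(size_map (fun w => w - m) W).
apply: sum_sqr_ge; first by rewrite !mulr_ge0// ltW.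
move=> _ /mapP[w wW ->]; have wG := WG w wW.
have n1 : 1 <= n%:R :> R by rewrite ler1n.
have L0 x : 0 < x -> 0 < L x by case: svL => _ + _; exact.
have geo v : v \in lattice_box n -> [/\ v - (w - m) != 0,
    (n <= l1norm (v - (w - m))%R)%N, (l1norm (v - (w - m)))%:R <= C' &
    0 <= sg * g (direction (v - (w - m)))].
  move=> vG; have [x0 l1 l2 d1 d2] := far_box_geometry p_circle dl_gt0 n0 CT m1 m2 vG wG.
  split=> //; first exact: le_trans l2 TC'.
  by apply: g_sign => //; exact: direction_circle.
have coefE : sg * lattice_coef a A n (w - m) =
    \sum_(v <- lattice_box n) sg * a (v - (w - m)).
  rewrite /lattice_coef mulr_sumr big_seq_cond [RHS]big_seq; apply: eq_bigl => v.
  case: (boolP (v \in lattice_box n)) => //= vG.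
  by apply: (fsubsetP A0A); apply/imfset2P; exists v => //; exists w.
have -> : `|lattice_coef a A n (w - m)| = `|sg * lattice_coef a A n (w - m)|.
  by rewrite normrM sg1 mul1r.
apply: le_trans (ler_norm _); rewrite coefE.
have gy0 : 0 <= gam * y by rewrite mulr_ge0// ltW.
apply: le_trans (ler_wpM2r gy0 (hN w wW)) _.
apply: sum_ge_count => v vG; have [x0 nx xC gx] := geo v vG.
  rewrite aE// mulrCA mulr_ge0// mulr_ge0 ?powR_ge0// ltW// L0// ltr0n.
  exact: leq_trans nx.
move=> gamx; rewrite aE// mulrCA mulrC; apply: ler_pM => //; first exact: ltW.
exact: hy.
Qed.

End cone.

Lemma weight_ge (K : nat) (c D : R) (n k : nat) : 0 < c -> 0 < D -> (0 < n)%N ->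
  (forall k, (K <= k)%N -> c * k%:R `^ (- (beta + e)) <= k%:R `^ (- beta) * L k%:R) ->
  (K <= n)%N -> (n <= k)%N -> k%:R <= D * n%:R ->
  c * (D * n%:R) `^ (- (beta + e)) <= k%:R `^ (- beta) * L k%:R.
Proof.
move=> c0 D0 n0 h Kn nk kD; apply: le_trans (h k (leq_trans Kn nk)).
have k0 : 0 < k%:R :> R by rewrite ltr0n (leq_trans n0).
have n0' : 0 < n%:R :> R by rewrite ltr0n.
have b0 : 0 <= beta + e by have /andP[? ?] := beta12; have := e_gt0; lra.
rewrite ler_wpM2l ?(ltW c0)// !powRN lef_pV2 ?posrE ?powR_gt0 ?mulr_gt0//.
by apply: ge0_ler_powR; rewrite ?nnegrE ?(ltW k0)// ltW// mulr_gt0.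
Qed.

Lemma powR_mass (D x s : R) (j : nat) : 0 < D -> 0 < x ->
  x ^+ j * ((D * x) `^ (- s)) ^+ 2 = (D `^ (- s)) ^+ 2 * x `^ (j%:R - 2 * s).
Proof.
move=> D0 x0; have xn : x != 0 by rewrite gt_eqF.
rewrite powRM ?(ltW D0) ?(ltW x0)// exprMn mulrCA; congr (_ * _).
rewrite -(powR_mulrn j (ltW x0)) -(powR_mulrn 2 (powR_ge0 x (- s))) -powRrM -powRD ?xn ?implybT//.
by congr (x `^ _); ring.
Qed.

(** There are n^2 sites, and each sees the whole box inside the cone: n^2 summands of one sign and
    of size at least n^(-(beta + e)), up to constants. Squaring and adding gives the exponent 2 + 4
    - 2 (beta + e), which exceeds 2 because beta + e < 2. *)
Lemma mass_of_continuity_point (p : R * R) : unit_circle p -> g p != 0 ->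
  g q @[q --> within (@unit_circle R) (nbhs p)] --> g p ->
  exists2 lam, 2 < lam & mass_grows a lam.
Proof.
move=> pc gp0 gcont.
have gam0 : 0 < `|g p| / 2 by rewrite divr_gt0// normr_gt0.
have [dl dl0 hdl] : exists2 dl : R, 0 < dl & forall q, unit_circle q ->
    `|q.1 - p.1| < dl -> `|q.2 - p.2| < dl -> `|g p| / 2 <= Num.sg (g p) * g q.
  move/cvgrPdist_lt : gcont => /(_ _ gam0) /= /nbhs_ballP[dl dl0 h].
  exists dl => // q qc q1 q2.
  have /h/(_ qc) : ball p dl q by split; rewrite /ball/= distrC.
  rewrite ltr_norml; case: (sgrP (g p)) gp0 => [_|g0|g0] //= _ /andP[h1 h2]; lra.
exists (6 - 2 * (beta + e)); first by have [] := e_lt; lra.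
have [K [c [K0 c0 hK]]] := weight_lower.
(* In units of [n], [C] is the distance required by [cone_direction] and [D] a bound for the l^1
   norms that then occur. *)
pose C := 10 + 10 / dl; pose D := 2 * C + 4.
have C0 : 0 < C by rewrite addr_gt0 ?divr_gt0.
have D0 : 0 < D by rewrite addr_gt0// mulr_gt0.
exists ((`|g p| / 2 * c * D `^ (- (beta + e))) ^+ 2), K; split.
  by apply: exprn_gt0; apply: mulr_gt0; [exact: mulr_gt0|exact: powR_gt0].
move=> n Kn; have n0 : (0 < n)%N by rewrite (leq_trans K0).
have n0' : 0 < n%:R :> R by rewrite ltr0n.
pose T := C * n%:R; pose m := (Num.floor (T * p.1), Num.floor (T * p.2)).
have floor1 (x : R) : `|(Num.floor x)%:~R - x| <= 1.
  have := floor_itv x; rewrite ler_norml intrD1 => /andP[h1 h2].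
  by apply/andP; split; lra.
pose y := c * (D * n%:R) `^ (- (beta + e)).
have y0 : 0 <= y by rewrite mulr_ge0 ?powR_ge0// ltW.
have sg1 : `|Num.sg (g p)| = 1 by rewrite normr_sg gp0.
have g_sign q : unit_circle q -> `|q.1 - p.1| < dl -> `|q.2 - p.2| < dl ->
    0 <= Num.sg (g p) * g q.
  by move=> qc q1 q2; rewrite (le_trans (ltW gam0))// hdl.
have hcount w : w \in lattice_box n -> (n * n)%:R <=
    (count (fun v => `|g p| / 2 <= Num.sg (g p) * g (direction (v - (w - m)))) (lattice_box n))%:R :> R.
  move=> wG; rewrite -size_lattice_box -count_predT ler_nat.
  rewrite leq_eqVlt; apply/orP; left; apply/eqP; apply: eq_in_count => v vG.
  have [x0 _ _ d1 d2] := @far_box_geometry p dl n m T v w pc dl0 n0 (lexx _) (floor1 _) (floor1 _) vG wG.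
  by rewrite /= hdl//; exact: direction_circle.
have TD : 2 * T + 4 * n%:R <= D * n%:R by rewrite /T /D; lra.
have [A0 [V [uV hV]]] := @cone_mass p dl (Num.sg (g p)) (`|g p| / 2) pc dl0 sg1 gam0 g_sign n m T
  (D * n%:R) (lattice_box n) (n * n)%:R y n0 (lexx _)
  TD (floor1 _) (floor1 _) (lattice_box_uniq n) (fun w h => h)
  (ler0n _ _) y0 (fun k => weight_ge c0 D0 n0 hK Kn) hcount.
exists A0, V; split=> // A /hV; apply: le_trans.
rewrite size_lattice_box /y natrM.
have -> : n%:R * n%:R * (n%:R * n%:R * (`|g p| / 2 * (c * (D * n%:R) `^ (- (beta + e))))) ^+ 2 =
    (`|g p| / 2 * c) ^+ 2 * (n%:R ^+ 6 * ((D * n%:R) `^ (- (beta + e))) ^+ 2) by ring.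
by rewrite powR_mass// mulrA -exprMn.
Qed.

Section degenerate.
Variable D : seq (R * R).
Hypothesis g_off : forall q, unit_circle q -> q \notin D -> g q = 0.

Definition ray (v : int * int) (k : nat) : int * int := (k%:Z * v.1, k%:Z * v.2).

Lemma l2norm_ray v k : l2norm (ray v k) = k%:R * l2norm v.
Proof.
rewrite !l2norm_real /= !rmorphM/= !exprMn -mulrDr sqrtrM ?sqr_ge0//.
by rewrite sqrtr_sqr ger0_norm.
Qed.

Lemma direction_ray v k : v != 0 -> (0 < k)%N -> direction (ray v k) = direction v.
Proof.
move=> v0 k0; have r0 := l2norm_gt0 v0.
have k0' : k%:R != 0 :> R by rewrite pnatr_eq0 -lt0n.
by rewrite /direction l2norm_ray /= !rmorphM/=; congr pair; field; rewrite k0' gt_eqF.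
Qed.

Lemma ray_inj v : v != 0 -> injective (ray v).
Proof.
case: v => x y; rewrite -pair_eqE /= negb_and => v0 j k [e1 e2].
by case/orP: v0 => z0; [move: e1|move: e2] => /(mulIf z0) [].
Qed.

Lemma l2norm_ge1 v : v != 0 -> 1 <= l2norm v.
Proof.
move=> v0; have := l2norm_gt0 v0; rewrite sqrtr_gt0 ltr0z => h.
by rewrite -[leLHS]sqrtr1 ler_wsqrtr// ler1z.
Qed.

(** The cone is taken so narrow that [p] is the only direction in it where [g] may be nonzero; hence
    the summands keep one sign. Each of about n^2 sites now sees only of the order of n points,
    those on the ray, which gives the exponent 2 + 2 - 2 (beta + e). *)
Lemma mass_of_ray v0 : v0 != 0 -> g (direction v0) != 0 ->
  exists2 lam, 0 < lam & mass_grows a lam.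
Proof.
move=> v00 gp0; set p := direction v0 in gp0.
have pc : unit_circle p := direction_circle v00.
have gam0 : 0 < `|g p| by rewrite normr_gt0.
have [dl dl0 hdl] := isolated_point D p.
exists (4 - 2 * (beta + e)); first by have [] := e_lt; lra.
have [K [c [K0 c0 hK]]] := weight_lower.
pose C := 10 + 10 / dl.
have C0 : 0 < C by rewrite addr_gt0 ?divr_gt0.
pose N0 := (Num.trunc C).+1; have CN0 : C <= N0%:R by rewrite ltW// truncnS_gt.
have r1 := l2norm_ge1 v00; set rho := l2norm v0 in r1.
have rho0 : 0 < rho by lra.
pose E := 2 * (N0%:R * rho) + 4.
have E0 : 0 < E by rewrite addr_gt0// !mulr_gt0// ltr0n.
pose mu := l1norm v0; have mu0 : (0 < mu)%N := l1norm_gt0 v00.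
have mu0' : 0 < mu%:R :> R by rewrite ltr0n.
exists ((6^-1 * ((6 * mu%:R)^-1 * (`|g p| * (c * E `^ (- (beta + e)))))) ^+ 2), (maxn K 4); split.
  by rewrite exprn_gt0// !mulr_gt0 ?invr_gt0 ?mulr_gt0 ?powR_gt0.
move=> n; rewrite geq_max => /andP[Kn n4]; have n0 : (0 < n)%N by rewrite (leq_trans K0).
have n0' : 0 < n%:R :> R by rewrite ltr0n.
(* The shift [m] lies exactly on the ray, so [w + ray v0 k] is seen from the site [w - m] in
   direction [p]. *)
pose T := N0%:R * rho * n%:R; pose m := ray v0 (N0 * n).
have natz : ((N0 * n)%:Z)%:~R = N0%:R * n%:R :> R by rewrite -natrM.
have mT1 : m.1%:~R = T * p.1.
  rewrite /m /= rmorphM/= natz /T /p /direction /= -/rho; field.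
  by rewrite gt_eqF.
have mT2 : m.2%:~R = T * p.2.
  rewrite /m /= rmorphM/= natz /T /p /direction /= -/rho; field.
  by rewrite gt_eqF.
have m1 : `|m.1%:~R - T * p.1| <= 1 by rewrite mT1 subrr normr0.
have m2 : `|m.2%:~R - T * p.2| <= 1 by rewrite mT2 subrr normr0.
have CT : C * n%:R <= T by rewrite ler_pM2r// (le_trans CN0)// ler_peMr.
pose y := c * (E * n%:R) `^ (- (beta + e)).
have y0 : 0 <= y by rewrite mulr_ge0 ?powR_ge0// ltW.
have sg1 : `|Num.sg (g p)| = 1 by rewrite normr_sg gp0.
have sgg : Num.sg (g p) * g p = `|g p| by rewrite -normrEsg.
have g_sign q : unit_circle q -> `|q.1 - p.1| < dl -> `|q.2 - p.2| < dl ->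
    0 <= Num.sg (g p) * g q.
  move=> qc q1 q2; case: (boolP (q \in D)) => [qD|/(g_off qc) ->]; last by rewrite mulr0.
  by rewrite (hdl q qD q1 q2) sgg.
pose q := (n %/ 3)%N.
(* Points [w] are kept in a middle part of the box so that [w + ray v0 k] stays inside for all k up
   to [q %/ mu], whatever the signs of the coordinates of [v0]. *)
pose W : seq (int * int) := [seq (j%:Z, k%:Z) | j <- iota q.+1 q, k <- iota q.+1 q].
have uW : uniq W.
  apply: allpairs_uniq; rewrite ?iota_uniq//.
  by move=> [j k] [j' k'] _ _ /= [-> ->].
have WE w : w \in W -> [/\ q%:Z < w.1, w.1 <= (2 * q)%:Z, q%:Z < w.2 & w.2 <= (2 * q)%:Z].
  case: w => w1 w2 /allpairsP[[j k] [/=]]; rewrite !mem_iota => h1 h2 [-> ->].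
  by clear -h1 h2; split; lia.
have q3 : (3 * q <= n)%N by rewrite mulnC leq_trunc_div.
have WG : {subset W <= lattice_box n}.
  move=> w /WE[h1 h2 h3 h4]; rewrite mem_lattice_box.
  by clear -h1 h2 h3 h4 q3; lia.
have hcount w : w \in W -> ((q %/ mu).+1)%:R <=
    (count (fun v => `|g p| <= Num.sg (g p) * g (direction (v - (w - m)))) (lattice_box n))%:R :> R.
  move=> /WE[h1 h2 h3 h4]; rewrite ler_nat -size_filter.
  pose s := [seq w + ray v0 k | k <- iota 0 (q %/ mu).+1].
  have -> : (q %/ mu).+1 = size s by rewrite size_map size_iota.
  apply: uniq_leq_size.
    by rewrite map_inj_uniq ?iota_uniq// => j k /addrI /(ray_inj v00).
  move=> _ /mapP[k + ->]; rewrite mem_iota add0n ltnS => /andP[_ kq].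
  rewrite mem_filter; apply/andP; split.
    have -> : w + ray v0 k - (w - m) = ray v0 (N0 * n + k).
      rewrite opprB addrC addrA subrK /m /ray.
      by congr pair; rewrite /= PoszD mulrDl.
    rewrite direction_ray//; last by rewrite addn_gt0 muln_gt0 n0.
    by rewrite -/p sgg.
  have kmu : (k * mu <= q)%N by rewrite (leq_trans _ (leq_trunc_div q mu))// leq_mul2r kq orbT.
  have k1 : (k * `|v0.1| <= q)%N by rewrite (leq_trans _ kmu)// leq_mul2l leq_addr orbT.
  have k2 : (k * `|v0.2| <= q)%N by rewrite (leq_trans _ kmu)// leq_mul2l leq_addl orbT.
  have kz1 : `|k%:Z * v0.1| <= q%:Z by rewrite normrM; move: k1; clear; lia.
  have kz2 : `|k%:Z * v0.2| <= q%:Z by rewrite normrM; move: k2; clear; lia.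
  rewrite mem_lattice_box /=; clear -kz1 kz2 h1 h2 h3 h4 q3; lia.
have Tn : 2 * T + 4 * n%:R <= E * n%:R by rewrite /T /E; lra.
have [A0 [V [uV hV]]] := @cone_mass p dl (Num.sg (g p)) `|g p| pc dl0 sg1 gam0 g_sign n m T
  (E * n%:R) W ((q %/ mu).+1)%:R y n0 CT Tn m1 m2 uW WG
  (ler0n _ _) y0 (fun k => weight_ge c0 E0 n0 hK Kn) hcount.
exists A0, V; split=> // A /hV; apply: le_trans.
have q6 : n%:R / 6 <= q%:R :> R.
  by rewrite ler_pdivrMr// -natrM ler_nat /q; clear -n4; lia.
have qmu : n%:R / (6 * mu%:R) <= ((q %/ mu).+1)%:R :> R.
  rewrite invfM mulrA ler_pdivrMr// (le_trans q6)// -natrM ler_nat.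
  by rewrite ltnW// ltn_ceil.
rewrite size_allpairs !size_iota natrM -expr2 -exprMn.
have -> : (6^-1 * ((6 * mu%:R)^-1 * (`|g p| * (c * E `^ (- (beta + e)))))) ^+ 2 *
    n%:R `^ (4 - 2 * (beta + e)) = (n%:R / 6 * (n%:R / (6 * mu%:R) * (`|g p| * y))) ^+ 2.
  have -> : (6^-1 * ((6 * mu%:R)^-1 * (`|g p| * (c * E `^ (- (beta + e)))))) ^+ 2 *
    n%:R `^ (4 - 2 * (beta + e)) = (6^-1 * ((6 * mu%:R)^-1 * (`|g p| * c))) ^+ 2 *
    ((E `^ (- (beta + e))) ^+ 2 * n%:R `^ (4 - 2 * (beta + e))) by ring.
  rewrite -(@powR_mass E n%:R (beta + e) 4)// /y; ring.
have gy0 : 0 <= `|g p| * y by rewrite mulr_ge0.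
have nm0 : 0 <= n%:R / (6 * mu%:R) :> R by rewrite divr_ge0 ?mulr_ge0.
have n60 : 0 <= n%:R / 6 :> R by rewrite divr_ge0.
set z := `|g p| * y in gy0 *.
have za := mulr_ge0 n60 (mulr_ge0 nm0 gy0).
have zb := mulr_ge0 (ler0n R q) (mulr_ge0 (ler0n R (q %/ mu).+1) gy0).
rewrite ler_sqr ?nnegrE//.
exact: ler_pM n60 (mulr_ge0 nm0 gy0) q6 (ler_wpM2r gy0 qmu).
Qed.

Lemma l1norm_direction v : v != 0 ->
  `|(direction v).1| + `|(direction v).2| = (l1norm v)%:R / l2norm v.
Proof.
move=> v0; have r0 := l2norm_gt0 v0.
by rewrite /direction /= !normrM !normfV (gtr0_norm r0) -mulrDl -l1norm_real.
Qed.

Lemma direction_l1norm_inj v w : v != 0 -> w != 0 ->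
  direction v = direction w -> l1norm v = l1norm w -> v = w.
Proof.
move=> v0 w0 dvw lvw; have rv := l2norm_gt0 v0; have rw := l2norm_gt0 w0.
have l0 : (l1norm w)%:R != 0 :> R by rewrite pnatr_eq0 -lt0n l1norm_gt0.
have := l1norm_direction v0; rewrite dvw l1norm_direction// lvw => /(mulfI l0) /invr_inj rE.
case: dvw; rewrite rE => e1 e2.
have rvn : (l2norm v)^-1 != 0 by rewrite invr_eq0 gt_eqF.
move: e1 e2 => /(mulIf rvn) /eqP; rewrite eqr_int => /eqP e1 /(mulIf rvn) /eqP.
by rewrite eqr_int => /eqP e2; case: v w e1 e2 {v0 w0 lvw rv rw l0 rE rvn} => [? ?] [? ?] /= -> ->.
Qed.

Lemma sum_uniq_nat_le (t : seq nat) (f : nat -> R) (N : nat) :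
  uniq t -> (forall k, k \in t -> (0 < k <= N)%N) -> (forall k, 0 <= f k) ->
  \sum_(k <- t) f k <= \sum_(l < N) f l.+1.
Proof.
move=> ut tN f0.
have -> : \sum_(l < N) f l.+1 = \sum_(k <- index_iota 1 N.+1) f k.
  by rewrite big_add1 big_mkord.
rewrite [leRHS](bigID (fun k => k \in t)) /= -[leLHS]addr0 lerD ?sumr_ge0//.
rewrite -[leRHS]big_filter le_eqVlt; apply/orP; left; apply/eqP; apply: perm_big.
apply: uniq_perm => //; first by rewrite filter_uniq// iota_uniq.
move=> k; rewrite mem_filter mem_index_iota ltnS.
by case: (boolP (k \in t)) => //= /tN ->.
Qed.

(* Nonzero coefficients lie on finitely many rays, each of which meets every
   l^1 sphere at most once. *)
Lemma degenerate_abs_bounded : bounded_on_circle g -> exists M, abs_bounded a M.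
Proof.
move=> [Mg hMg]; have [M M0 hM] := weight_upper; have [_ s1] := e_lt.
pose F (k : nat) := `|Mg| * (M * k%:R `^ (- (beta - e))).
have F0 k : 0 <= F k by rewrite mulr_ge0// mulr_ge0 ?powR_ge0// ltW.
have L0 x : 0 < x -> 0 < L x by case: svL => _ + _; exact.
have aF v : v != 0 -> `|a v| <= \sum_(d <- D) (direction v == d)%:R * F (l1norm v).
  move=> v0; have vc := direction_circle v0; have l0 := l1norm_gt0 v0.
  case: (boolP (direction v \in D)) => [dD|/(g_off vc) g0]; last first.
    rewrite aE// g0 mulr0 normr0; apply: sumr_ge0 => d _.
    by rewrite mulr_ge0.
  have aFv : `|a v| <= F (l1norm v).
    rewrite aE// normrM mulrC ler_pM//.
      by rewrite (le_trans (hMg _ vc))// ler_norm.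
    by rewrite ger0_norm ?hM// mulr_ge0 ?powR_ge0// ltW// L0 ?ltr0n.
  apply: (le_trans aFv); rewrite (big_rem _ dD)/= eqxx mul1r lerDl.
  by apply: sumr_ge0 => d _; rewrite mulr_ge0.
pose Z := `|Mg| * M * (1 + (beta - e - 1)^-1).
exists (`|a 0| + \sum_(d <- D) Z) => s us.
rewrite (bigID (fun v => v == 0))/=; apply: lerD.
  rewrite -big_filter; case: (boolP (0 \in s)) => s0.
    rewrite (perm_big [:: 0]) ?big_seq1//; apply: uniq_perm; rewrite ?filter_uniq//.
    by move=> v; rewrite mem_filter inE; case: eqP => // ->.
  rewrite (eq_in_filter (a2 := pred0)) ?filter_pred0 ?big_nil// => v vs.
  by apply: contraNF s0 => /eqP <-.
apply: le_trans (ler_sum _ aF) _; rewrite exchange_big/=; apply: ler_sum => d _.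
have -> : \sum_(v <- s | v != 0) (direction v == d)%:R * F (l1norm v) =
    \sum_(k <- [seq l1norm v | v <- s & (v != 0) && (direction v == d)]) F k.
  rewrite big_map big_filter [RHS]big_mkcondr/=; apply: eq_bigr => v _.
  by case: eqP; rewrite ?mul1r ?mul0r.
pose N := \max_(v <- s) l1norm v.
apply: le_trans (@sum_uniq_nat_le _ F N _ _ F0) _.
- rewrite map_inj_in_uniq ?filter_uniq// => v w.
  rewrite !mem_filter => /andP[/andP[v0 /eqP dv] _] /andP[/andP[w0 /eqP dw] _].
  by apply: direction_l1norm_inj => //; rewrite dv dw.
- move=> _ /mapP[v + ->]; rewrite mem_filter => /andP[/andP[v0 _] vs].
  by rewrite l1norm_gt0//= /N (@leq_bigmax_seq _ s xpredT l1norm v vs isT).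
rewrite /F /Z -mulr_sumr -mulr_sumr mulrA ler_wpM2l ?mulr_ge0 ?(ltW M0)//.
exact: riemann_sum_le.
Qed.

End degenerate.

End long_memory.

(** Three cases: [g] is nonzero at a continuity point on the circle; otherwise [g] vanishes there
    off a finite set, and either some lattice direction carries a nonzero value of [g] or none
    does. *)
Lemma long_memory_dominated (R : realType) (a : int * int -> R) :
  square_summable a -> long_memory a -> (exists v, a v != 0) -> coef_dominated a.
Proof.
move=> a2 [beta [L [g [beta12 svL gb [D finD gcont] aE']]]] [v av].
have aE w : w != 0 -> a w = (l1norm w)%:R `^ (- beta) * L (l1norm w)%:R * g (direction R w).
  case: w => x y w0; rewrite aE'.
    by rewrite /direction /l2norm /l1norm /= -!abszE -PoszD.
  by move: w0; rewrite -pair_eqE /= negb_and => /orP.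
have [[p [pc pD gp]]|reg] := pselect (exists p, [/\ unit_circle p, ~ D p & g p != 0]).
  have [lam lam2 ma] := mass_of_continuity_point beta12 svL aE pc gp (gcont p (conj pc pD)).
  exact: square_summable_dominated lam2 ma.
have [s sE] : exists s : seq (R * R), D = [set` s] by exact/finite_seqP.
have g_off q : unit_circle q -> q \notin s -> g q = 0.
  move=> qc qs; apply: contrapT => /eqP gq; apply: reg; exists q; split=> //.
  by rewrite sE /=; exact/negP.
have [M aM] := degenerate_abs_bounded beta12 svL aE g_off gb.
have [[w [w0 gw]]|nog] := pselect (exists w, w != 0 /\ g (direction R w) != 0).
  have [lam lam0 ma] := mass_of_ray beta12 svL aE g_off w0 gw.
  exact: short_memory_dominated aM _ lam0 ma.
(* In this last case only [a 0] is left, a value that the long-memory formula does not prescribe;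
   the finite sums of [a] over sets containing 0 are then constant. *)
have a0 w : w != 0 -> a w = 0.
  move=> w0; rewrite aE//; case: (eqVneq (g (direction R w)) 0) => [->|gw].
    by rewrite mulr0.
  by exfalso; apply: nog; exists w.
have v0 : v = 0 by apply: contraNeq av => /a0 ->.
apply: (short_memory_dominated aM ltr01); apply: (@mass_grows_of_sums _ _ `|a 0| [fset 0]%fset).
  by rewrite normr_gt0 -v0.
move=> A; rewrite fsub1set => A0; rewrite (big_rem _ A0)/= big1_seq ?addr0// => w /andP[_].
by rewrite mem_rem_uniq ?fset_uniq// inE => /andP[/a0].
Qed.

(** * The function Psi and the weighted series *)

(** Write [ln y - ln x] as a difference of squares of square roots and bound the sum of the two
    roots below by the smaller one. *)
Lemma sqrt_ln_telescope (R : realType) (x y : R) : 2 <= x -> x <= y ->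
  Num.sqrt (ln y) - Num.sqrt (ln x) <= (y - x) / (x * Num.sqrt (ln x)).
Proof.
move=> x2 xy; have x0 : 0 < x by lra.
have y0 : 0 < y by lra.
have lx : 0 < ln x by apply: ln_gt0; lra.
have lxy : ln x <= ln y by rewrite ler_ln ?posrE.
have Vx : 0 < Num.sqrt (ln x) by rewrite sqrtr_gt0.
have Vxy : Num.sqrt (ln x) <= Num.sqrt (ln y) by rewrite ler_wsqrtr.
have lnd : ln y - ln x <= (y - x) / x.
  rewrite -ln_div ?posrE//.
  have -> : y / x = 1 + (y - x) / x by field; rewrite gt_eqF.
  apply: le_ln1Dx; apply: lt_le_trans (_ : 0 <= _); first by rewrite ltrN10.
  by rewrite divr_ge0 ?subr_ge0// ltW.
rewrite invfM mulrA ler_pdivlMr//; apply: le_trans lnd.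
have -> : ln y - ln x = (Num.sqrt (ln y) - Num.sqrt (ln x)) * (Num.sqrt (ln y) + Num.sqrt (ln x)).
  by rewrite -subr_sqr !sqr_sqrtr ?(ltW lx) ?(le_trans (ltW lx) lxy).
by rewrite ler_wpM2l ?subr_ge0// lerDr (le_trans (ltW Vx) Vxy).
Qed.

(** * Growth of Psi and the weighted series *)

Section psi.
Context (R : realType) (c : R) (h : R -> R).
Hypothesis c_ge1 : 1 <= c.
Hypothesis h_gt0 : forall t : R, c <= t -> 0 < h t.
Hypothesis h_nd : forall s t : R, c <= s -> s <= t -> h s <= h t.
Notation mu := (@lebesgue_measure R).
Implicit Types (x y t : R).

Let phi (x : R) := (x * h x)^-1.

Lemma phi_gt0 x : c <= x -> 0 < phi x.
Proof.
move=> cx; rewrite invr_gt0 mulr_gt0 ?h_gt0//.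
exact: lt_le_trans ltr01 (le_trans c_ge1 cx).
Qed.

Lemma phi_noninc x y : c <= x -> x <= y -> phi y <= phi x.
Proof.
move=> cx xy; have cy := le_trans cx xy.
have x0 : 0 < x := lt_le_trans ltr01 (le_trans c_ge1 cx).
rewrite lef_pV2 ?posrE ?mulr_gt0 ?h_gt0//; last exact: lt_le_trans x0 xy.
by apply: ler_pM; rewrite ?(ltW x0) ?(ltW (h_gt0 cx))// h_nd.
Qed.

Lemma phi_measurable (b : itv_bound R) : measurable_fun [set` Interval (BLeft c) b] phi.
Proof.
(* [phi] is monotone only from [c] on; freezing it to the left of [c] gives a function monotone on
   the whole line. *)
pose psi x := phi (Num.max c x).
have mpsi : measurable_fun [set` Interval (BLeft c) b] psi.
  apply: nonincreasing_measurable => // x y xy.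
  apply: phi_noninc; first by rewrite le_max lexx.
  by rewrite ge_max !le_max lexx/= xy orbT.
apply: eq_measurable_fun mpsi => x /set_mem/=.
by rewrite itv_boundlr => /andP[cx _]; rewrite /psi max_r.
Qed.

Lemma phi_integrable t : mu.-integrable `[c, t] (EFin \o phi).
Proof.
apply: measurable_bounded_integrable => //.
- have fin : (mu (`[c, t]%classic : set R) < +oo)%E.
    by rewrite lebesgue_measure_itv/=; case: ifP => _; rewrite -?EFinB ltry.
  exact: fin.
- exact: phi_measurable.
exists (phi c); split; first exact: num_real.
move=> y cy x /=; rewrite in_itv/= => /andP[cx _].
by rewrite ger0_norm ?ltW ?phi_gt0// (le_lt_trans _ cy)// phi_noninc.
Qed.

Lemma Psi_diff x y : c <= x -> x <= y ->
  phi y * (y - x) <= Psi c h y - Psi c h x <= phi x * (y - x).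
Proof.
move=> cx xy; rewrite /Psi (Rintegral_itvB (phi_integrable y)) ?bnd_simp//.
have mI : measurable (`]x, y] : set R) by [].
have muI : fine (mu `]x, y]%classic) = y - x.
  rewrite lebesgue_measure_itv/= lte_fin; case: ltP => [_ //|yx].
  by apply/eqP; rewrite eq_sym subr_eq0 eq_le yx xy.
have muIoo : (mu (`]x, y]%classic : set R) < +oo)%E.
  by rewrite lebesgue_measure_itv/=; case: ifP => _; rewrite -?EFinB ltry.
have iphi : mu.-integrable `]x, y] (EFin \o phi).
  apply: integrableS (phi_integrable y) => //.
  by apply: subset_itvr; rewrite bnd_simp.
have icst (r : R) : mu.-integrable `]x, y] (EFin \o (fun=> r)).
  apply: measurable_bounded_integrable => //; exact: bounded_cst.
rewrite -muI -!(Rintegral_cst mu mI); apply/andP; split; apply: le_Rintegral => // t /=;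
  rewrite in_itv/= => /andP[xt ty]; apply: phi_noninc => //; lra.
Qed.

Lemma Psi_nd x y : c <= x -> x <= y -> Psi c h x <= Psi c h y.
Proof.
move=> cx xy; have /andP[d _] := Psi_diff cx xy; rewrite -subr_ge0; apply: le_trans d.
by rewrite mulr_ge0 ?subr_ge0// ltW// phi_gt0// (le_trans cx).
Qed.

(** Since [h] is at least [h c], Psi grows at most like a multiple of ln, which is below every
    power. *)
Lemma Psi_subpolynomial (e : R) : 0 < e ->
  exists (C : R) (n0 : nat), 0 < C /\ forall n, (n0 <= n)%N -> Psi c h n%:R <= C * n%:R `^ e.
Proof.
move=> e0; pose n0 := (Num.trunc c).+1.
have cn0 : c <= n0%:R by rewrite ltW// truncnS_gt.
(* The 2 comes from 1/j <= 2/(j + 1), used before bounding 1/(j + 1) by ln (j + 1) - ln j. *)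
have hc := h_gt0 (lexx c); pose b := 2 / h c.
have b0 : 0 < b by rewrite divr_gt0.
have logb k : Psi c h (n0 + k)%:R <= Psi c h n0%:R + b * (ln (n0 + k)%:R - ln n0%:R).
  elim: k => [|k IH]; first by rewrite addn0 subrr mulr0 addr0.
  rewrite addnS; set j := (n0 + k)%N in IH *.
  have cj : c <= j%:R by rewrite (le_trans cn0)// ler_nat leq_addr.
  have j1 : 1 <= j%:R :> R := le_trans c_ge1 cj.
  have jj : j%:R <= j.+1%:R :> R by rewrite ler_nat.
  have /andP[_] := Psi_diff cj jj; rewrite -[j.+1%:R]natr1 [j%:R + 1 - _]addrC addKr mulr1.
  have phij : phi j%:R <= b * (ln (j%:R + 1) - ln j%:R).
    have lnj : (j%:R + 1)^-1 <= ln (j%:R + 1) - ln j%:R :> R.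
      have -> : ln (j%:R + 1) - ln j%:R = - ln (1 + - (j%:R + 1)^-1) :> R.
        have -> : 1 + - (j%:R + 1)^-1 = j%:R / (j%:R + 1) :> R by field; lra.
        by rewrite ln_div ?posrE//; lra.
      rewrite lerNr; apply: le_ln1Dx; rewrite ltrN2 invf_lt1; lra.
    apply: le_trans (ler_wpM2l (ltW b0) lnj).
    have -> : b * (j%:R + 1)^-1 = ((j%:R + 1) / 2 * h c)^-1 by rewrite /b; field; lra.
    have hj := h_gt0 cj; have hcj := h_nd (lexx c) cj.
    have j2 : 0 < (j%:R + 1) / 2 :> R by lra.
    have j0 : 0 < j%:R :> R by lra.
    rewrite lef_pV2 ?posrE ?mulr_gt0//.
    by apply: ler_pM; rewrite ?(ltW j2) ?(ltW hc)//; lra.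
  by move: IH phij; lra.
exists (`|Psi c h n0%:R| + b / e), n0; split; first by rewrite ltr_wpDl// divr_gt0.
move=> n nn0; have := logb (n - n0)%N; rewrite subnKC//.
have n1 : 1 <= n%:R :> R by rewrite ler1n (leq_trans _ nn0).
have n0' : 0 < n%:R :> R by lra.
have ln0 : 0 <= ln n0%:R :> R by apply: ln_ge0; rewrite ler1n.
have ne := ler_powR n1 (ltW e0); rewrite powRr0 in ne.
have lnn : ln n%:R <= n%:R `^ e / e.
  rewrite ler_pdivlMr// mulrC -ln_powR; apply/ltW/ln_sublinear.
  by rewrite powR_gt0.
move=> /le_trans; apply; rewrite mulrDl lerD//.
  by rewrite (le_trans (ler_norm _))// ler_peMr.
have := ler_wpM2l (ltW b0) lnn; rewrite mulrA -[b / e * _]mulrAC => h1.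
have : 0 <= b * ln n0%:R by rewrite mulr_ge0// ltW.
by rewrite mulrBr; lra.
Qed.

Hypothesis h_int : (\int[mu]_(t in `[c, +oo[) ((t * h t)^-1)%:E = +oo)%E.

Lemma Psi_unbounded M : exists N : nat, forall n, (N <= n)%N -> M <= Psi c h n%:R.
Proof.
pose F (i : nat) : set R := `[c, i%:R]%classic.
have FE : \bigcup_i F i = `[c, +oo[%classic.
  apply/seteqP; split => x.
    by move=> [i _]; rewrite /F /= !in_itv/= => /andP[-> _].
  rewrite /= in_itv/= andbT => cx; exists (Num.trunc x).+1 => //.
  by rewrite /F /= in_itv/= cx ltW// truncnS_gt.
have cvgF : (\int[mu]_(x in F i) (phi x)%:E)%E @[i --> \oo] --> (\int[mu]_(x in \bigcup_i F i) (phi x)%:E)%E.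
  apply: ge0_nondecreasing_set_cvg_integral.
  - move=> i j ij; apply/subsetPset; apply: subset_itvl.
    by rewrite bnd_simp ler_nat.
  - by move=> i; exact: measurable_itv.
  - by move=> i; apply/measurable_EFinP; exact: phi_measurable.
  - by move=> i x; rewrite /F /= in_itv/= lee_fin => /andP[/phi_gt0/ltW].
move: cvgF; rewrite FE h_int => /cvgeyPge/(_ M)[N _ HN].
exists N => n Nn; rewrite -lee_fin; apply: le_trans (HN n Nn) _.
rewrite /Psi /Rintegral fineK//; apply: integrable_fin_num => //.
exact: phi_integrable.
Qed.

Section series.
Variables (m : nat) (pr : nat -> R).
Hypothesis cm : c <= m%:R.
Hypothesis pr_ge0 : forall n, 0 <= pr n.

Let term n := (((n%:R * h n%:R)^-1)%:E * (pr n)%:E)%E.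

Let term_ge0 n : (m <= n)%N -> (0 <= term n)%E.
Proof.
move=> mn; rewrite /term -EFinM lee_fin mulr_ge0// ltW// phi_gt0//.
by rewrite (le_trans cm)// ler_nat.
Qed.

(** Monotonicity bounds the weight at j + 1 by the increment of Psi over [j, j + 1]. With the power
    also taken at j + 1, this is the pairing required by [powR_telescope]; the tail therefore starts
    at N + 1. *)
Lemma weighted_series_finite (q C : R) (n0 : nat) : 1 < q ->
  (forall n, (n0 <= n)%N -> pr n <= C * Psi c h n%:R `^ (- q)) ->
  (\sum_(m <= n <oo) term n < +oo)%E.
Proof.
move=> q1 hpr; have [N1 hN1] := Psi_unbounded 1.
pose N := maxn m (maxn n0 N1).
have [mN [n0N N1N]] : (m <= N)%N /\ (n0 <= N)%N /\ (N1 <= N)%N.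
  by rewrite /N !leq_max !leqnn !orbT.
rewrite (@nneseries_split _ term m (N.+1 - m)%N term_ge0) subnKC ?(leq_trans mN)//.
apply: lte_add_pinfty.
  by apply: lte_sum_pinfty => i _; rewrite /term -EFinM ltry.
have q10 : 0 < q - 1 by lra.
have alg (x t u v w : R) : x * (t - u) / w + x * ((u - v) / w) = x * (t - v) / w by ring.
pose U n := Psi c h n%:R `^ (1 - q).
apply: (@le_lt_trans _ _ (`|C| * U N / (q - 1))%:E); last exact: ltry.
have tge0 n : (N.+1 <= n)%N -> true -> (0 <= term n)%E.
  by move=> Nn _; apply: term_ge0; rewrite (leq_trans _ Nn)// (leq_trans mN).
apply: lime_le (is_cvg_nneseries tge0) _; apply: nearW => k.
have [kN|Nk] := leqP k N.+1; first by rewrite big_geq// lee_fin !mulr_ge0 ?powR_ge0// invr_ge0 ltW.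
have tele k' : (\sum_(N.+1 <= n < (N + k').+1) term n <= (`|C| * (U N - U (N + k')%N) / (q - 1))%:E)%E.
  elim: k' => [|k' IH]; first by rewrite addn0 big_geq// subrr mulr0 mul0r.
  rewrite addnS; set j := (N + k')%N in IH *.
  rewrite (@big_nat_recr _ _ _ j.+1 N.+1) /=; last by rewrite ltnS leq_addr.
  have Nj : (N <= j)%N by rewrite leq_addr.
  have cj : c <= j%:R by rewrite (le_trans cm)// ler_nat (leq_trans mN).
  have jj : j%:R <= j.+1%:R :> R by rewrite ler_nat.
  have Psij : 1 <= Psi c h j%:R by apply: hN1; rewrite (leq_trans N1N).
  have /andP[d1 _] := Psi_diff cj jj.
  rewrite -[X in _ * (X - _)]natr1 [_ + 1 - _]addrC addKr mulr1 in d1.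
  have tel := powR_telescope q1 (lt_le_trans ltr01 Psij) (Psi_nd cj jj).
  apply: le_trans (leeD IH (lexx _)) _; rewrite /term -EFinM -EFinD lee_fin.
  have prj : pr j.+1 <= `|C| * Psi c h j.+1%:R `^ (- q).
    apply: le_trans (hpr _ _) _; first by rewrite (leq_trans n0N)// (leq_trans Nj).
    by rewrite ler_wpM2r ?powR_ge0// ler_norm.
  have phij : 0 <= phi j.+1%:R by rewrite ltW// phi_gt0// (le_trans cj).
  have h1 : phi j.+1%:R * pr j.+1 <= `|C| * ((U j - U j.+1) / (q - 1)).
    apply: le_trans (ler_wpM2l phij prj) _; rewrite mulrCA ler_wpM2l//.
    apply: le_trans tel; rewrite mulrC ler_wpM2l ?powR_ge0//.
  rewrite -/(phi j.+1%:R); apply: le_trans (lerD (lexx _) h1) _.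
  by rewrite alg.
have -> : k = (N + (k - N.+1)).+1 by rewrite -addSn subnKC// ltnW.
apply: le_trans (tele _) _; rewrite lee_fin.
rewrite ler_pM2r ?invr_gt0// ler_wpM2l//.
by rewrite lerBlDr lerDl powR_ge0.
Qed.

(** Here the weight at j is bounded below by the increment of Psi over the following interval
    [j, j + 1], and the other factor is also taken at the left end, as in [sqrt_ln_telescope]. *)
Lemma weighted_series_infinite (C0 : R) (n0 : nat) : 0 < C0 ->
  (forall n, (n0 <= n)%N -> C0 * (Psi c h n%:R * Num.sqrt (ln (Psi c h n%:R)))^-1 <= pr n) ->
  (\sum_(m <= n <oo) term n = +oo)%E.
Proof.
move=> C00 hpr; have [N1 hN1] := Psi_unbounded 2.
pose N := maxn m (maxn n0 N1).
have [mN [n0N N1N]] : (m <= N)%N /\ (n0 <= N)%N /\ (N1 <= N)%N.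
  by rewrite /N !leq_max !leqnn !orbT.
have alg (x t u v : R) : x * (v - t) = x * (u - t) + x * (v - u) by ring.
pose V n := Num.sqrt (ln (Psi c h n%:R)).
have tele k : ((C0 * (V (N + k)%N - V N))%:E <= \sum_(N <= n < N + k) term n)%E.
  elim: k => [|k IH]; first by rewrite addn0 big_geq// subrr mulr0.
  rewrite addnS; set j := (N + k)%N in IH *.
  rewrite (@big_nat_recr _ _ _ j N) /=; last by rewrite leq_addr.
  have Nj : (N <= j)%N by rewrite leq_addr.
  have cj : c <= j%:R by rewrite (le_trans cm)// ler_nat (leq_trans mN).
  have jj : j%:R <= j.+1%:R :> R by rewrite ler_nat.
  have /andP[_ d1] := Psi_diff cj jj.
  rewrite -[X in _ * (X - _)]natr1 [_ + 1 - _]addrC addKr mulr1 in d1.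
  set x := Psi c h j%:R in d1 *; set y := Psi c h j.+1%:R in d1 *.
  have x2 : 2 <= x by apply: hN1; rewrite (leq_trans N1N).
  have xy : x <= y by exact: Psi_nd.
  have Vd := sqrt_ln_telescope x2 xy.
  apply: le_trans (leeD IH (lexx _)); rewrite /term -EFinM -EFinD lee_fin -/(phi j%:R).
  have prj : C0 * (x * Num.sqrt (ln x))^-1 <= pr j by apply: hpr; rewrite (leq_trans n0N).
  have i0 : 0 <= (x * Num.sqrt (ln x))^-1 by rewrite invr_ge0 mulr_ge0 ?sqrtr_ge0// (le_trans _ x2).
  have phij : 0 <= phi j%:R by rewrite ltW// phi_gt0.
  have h1 : C0 * (V j.+1 - V j) <= phi j%:R * pr j.
    apply: le_trans (ler_wpM2l phij prj); rewrite mulrCA ler_wpM2l ?(ltW C00)//.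
    by apply: (le_trans Vd); rewrite ler_wpM2r.
  by rewrite (alg _ _ (V j)); exact: lerD.
apply/eqyP => A _.
(* Once [V] exceeds [B], the telescoped lower bound exceeds [A]; this happens when Psi passes exp
   (B^2). *)
pose B := V N + `|A| / C0.
have [N2 hN2] := Psi_unbounded (expR (B ^+ 2)).
pose k := N2.
have B0 : 0 <= B by rewrite addr_ge0 ?sqrtr_ge0// divr_ge0// ltW.
have VB : B <= V (N + k)%N.
  have P1 : expR (B ^+ 2) <= Psi c h (N + k)%:R by apply: hN2; rewrite leq_addl.
  rewrite -(ger0_norm B0) -sqrtr_sqr ler_wsqrtr//.
  rewrite -[leLHS]expRK ler_ln ?posrE ?expR_gt0//.
  exact: lt_le_trans (expR_gt0 _) P1.
apply: (@le_trans _ _ (C0 * (V (N + k)%N - V N))%:E).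
  rewrite lee_fin -ler_pdivrMl// (le_trans (_ : _ <= `|A| / C0))//.
    by rewrite mulrC ler_wpM2r ?ler_norm// invr_ge0 ltW.
  by rewrite /B in VB; lra.
apply: le_trans (tele k) _.
apply: (@le_trans _ _ (\sum_(m <= n < N + k) term n)%E); last first.
  by apply: nneseries_lim_ge => n mn _; exact: term_ge0.
rewrite [leRHS](@big_cat_nat _ _ _ N)//= ?leq_addr//.
rewrite leeDr// big_nat_cond; apply: sume_ge0 => n /andP[/andP[mn _] _].
exact: term_ge0.
Qed.

End series.

End psi.

(** * Gaussian tail at the iterated-logarithm threshold *)

Section tail_asymptotics.
Context (R : realType) (G : R -> R) (J eps : R).
Hypothesis GJ : gauss_tail G J.
Hypothesis eps1 : -1 < eps.

Let q := (1 + eps) ^+ 2.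
(** The limiting constant. As [J] is the Gaussian integral sqrt (2 pi), it equals 1 / ((1 + eps)
    sqrt pi). *)
Let C1 := (2 / (J * ((1 + eps) * Num.sqrt 2)) : R).

Let eps10 : 0 < 1 + eps. Proof. by rewrite -ltrBlDl sub0r. Qed.
Let q0 : 0 < q. Proof. exact: exprn_gt0. Qed.
Let J0 : 0 < J. Proof. exact: gauss_total_gt0 GJ. Qed.

Lemma tail_constant_gt0 : 0 < C1.
Proof. by rewrite divr_gt0 ?mulr_gt0 ?sqrtr_gt0. Qed.

(** With x^2 = 2 q ln p, the power p^(-q) is exactly [gauss x], and the quotient becomes [C1] times
    [x * G x / gauss x], which Mills' bounds place between 1 - x^-2 and 1. *)
Lemma gauss_tail_ratio (p : R) : 1 < p ->
  `|2 * G ((1 + eps) * Num.sqrt (2 * ln p)) / J / ((Num.sqrt (ln p))^-1 * p `^ (- q)) - C1|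
    <= C1 / (2 * q * ln p).
Proof.
move=> p1; have p0 : 0 < p := lt_trans ltr01 p1.
have l0 : 0 < ln p := ln_gt0 p1.
set x := (1 + eps) * _.
have s0 : 0 < Num.sqrt (ln p) by rewrite sqrtr_gt0.
have xE : x = (1 + eps) * Num.sqrt 2 * Num.sqrt (ln p) by rewrite /x sqrtrM// mulrA.
have x0 : 0 < x by rewrite xE !mulr_gt0 ?sqrtr_gt0.
have x2 : x ^+ 2 = 2 * q * ln p by rewrite exprMn sqr_sqrtr ?mulr_ge0// ?(ltW l0)// mulrCA mulrA.
have gE : p `^ (- q) = gauss x.
  rewrite /powR gt_eqF// /gauss x2; congr expR; by field.
have g0 := gauss_gt0 x.
have -> : 2 * G x / J / ((Num.sqrt (ln p))^-1 * p `^ (- q)) = C1 * (x * G x / gauss x).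
  rewrite gE /C1 xE; field.
  by rewrite (gt_eqF (gauss_gt0 _)) (gt_eqF s0) (gt_eqF eps10) (gt_eqF J0) gt_eqF// sqrtr_gt0.

have C10 := tail_constant_gt0.
rewrite -[X in _ - X]mulr1 -mulrBr normrM (gtr0_norm C10) ler_wpM2l ?(ltW C10)//.
have U : x * G x / gauss x <= 1 by rewrite ler_pdivrMr// mul1r (mills_upper GJ).
have D : 1 - (2 * q * ln p)^-1 <= x * G x / gauss x.
  rewrite ler_pdivlMr// -x2; have := ler_wpM2l (ltW x0) (mills_lower GJ x0).
  by rewrite mulrA; congr (_ * _ <= _); field; rewrite gt_eqF.
rewrite ler0_norm ?subr_le0//; lra.
Qed.

(** The normal approximation error is divided by the Gaussian equivalent, whose inverse is at most
    psi^(q + 1) because sqrt (ln psi) <= psi. *)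
Lemma propto_of_rate (psi pr : R^nat) (kap C : R) (n0 : nat) : 0 < kap ->
  (forall M, exists N, forall n, (N <= n)%N -> M <= psi n) ->
  (forall e, 0 < e -> exists (D : R) N, 0 < D /\
     forall n, (N <= n)%N -> psi n <= D * n%:R `^ e) ->
  (forall n, (n0 <= n)%N ->
     `|pr n - 2 * G ((1 + eps) * Num.sqrt (2 * ln (psi n))) / J| <= C * n%:R `^ (- kap)) ->
  pr n / ((Num.sqrt (ln (psi n)))^-1 * psi n `^ (- q)) @[n --> \oo] --> C1.
Proof.
move=> kap0 psioo psiD rate; have q10 : 0 < q + 1 by rewrite addr_gt0.
(* This makes psi^(q + 1) at most a constant times n^(kap / 2), so half of the rate remains after
   the division. *)
pose e := kap / (2 * (q + 1)).
have e0 : 0 < e by rewrite divr_gt0// mulr_gt0.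
have [D [N1 [D0 hD]]] := psiD e e0.
have [N2 hN2] := psioo 2.
pose K := `|C| * D `^ (q + 1).
have K0 : 0 <= K by rewrite mulr_ge0// powR_ge0.
apply/cvgrPdist_le => r r0; have C10 := tail_constant_gt0.
(* Past [N3] the error in Mills' ratio is at most r / 2; past [N4] so is the normal approximation
   error after division. *)
have [N3 hN3] := psioo (expR (C1 / (q * r))).
pose N4 := (Num.trunc ((2 * K / r) `^ (2 / kap))).+1.
exists (maxn (maxn n0 N1) (maxn N2 (maxn N3 N4))) => // n /=.
rewrite !geq_max => /andP[/andP[nn0 nN1] /and3P[nN2 nN3 nN4]].
set p := psi n; have p2 : 2 <= p := hN2 n nN2.
have p1 : 1 < p by lra.
have p0 : 0 < p by lra.
have l0 : 0 < ln p := ln_gt0 p1.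
have s0 : 0 < Num.sqrt (ln p) by rewrite sqrtr_gt0.
set v := _ * p `^ (- q); have v0 : 0 < v by rewrite mulr_gt0 ?invr_gt0// powR_gt0.
have n1 : (0 < n)%N by exact: leq_trans nN4.
have A := gauss_tail_ratio p1; rewrite -/v in A.
have A2 : C1 / (2 * q * ln p) <= r / 2.
  have h : C1 / (q * r) <= ln p.
    by rewrite -[leLHS]expRK ler_ln ?posrE ?expR_gt0//; exact: hN3.
  rewrite ler_pdivrMr ?mulr_gt0// in h; rewrite ler_pdivrMr ?mulr_gt0//.
  by apply: le_trans h _; rewrite le_eqVlt; apply/orP; left; apply/eqP; field.
set g := 2 * G _ / J in A; have B := rate n nn0; rewrite -/p -/g in B.
have vp : v^-1 <= p `^ (q + 1).
  rewrite invfM invrK -powRN opprK addrC powRD ?(gt_eqF p0) ?implybT//.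
  rewrite ler_wpM2r ?powR_ge0// powRr1 ?(ltW p0)//.
  have lp : ln p <= p by have := @le_ln1Dx R (p - 1); rewrite addrCA subrr addr0; lra.
  rewrite -[leRHS](ger0_norm (ltW p0)) -sqrtr_sqr ler_wsqrtr//.
  by rewrite (le_trans lp)// expr2 ler_peMr// ltW.
have pn : p `^ (q + 1) <= D `^ (q + 1) * n%:R `^ (kap / 2).
  have -> : kap / 2 = e * (q + 1) by rewrite /e; field; rewrite gt_eqF.
  rewrite powRrM -powRM ?powR_ge0 ?(ltW D0)//.
  apply: ge0_ler_powR; rewrite ?nnegrE ?(ltW q10) ?(ltW p0)//.
    by rewrite mulr_ge0 ?powR_ge0 ?(ltW D0).
  exact: hD.
have n0' : 0 < n%:R :> R by rewrite ltr0n.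
have E : `|pr n - g| / v <= K * n%:R `^ (- (kap / 2)).
  have B' : `|pr n - g| <= `|C| * n%:R `^ (- kap).
    by apply: (le_trans B); rewrite ler_wpM2r ?powR_ge0// ler_norm.
  apply: (le_trans (ler_pM _ _ B' (le_trans vp pn))); rewrite ?invr_ge0 ?(ltW v0)//.
  have -> : - (kap / 2) = - kap + kap / 2 by field.
  by rewrite [n%:R `^ (- kap + _)]powRD ?(gt_eqF n0') ?implybT// mulrACA.
have nk : 2 * K / r <= n%:R `^ (kap / 2).
  have k2 : 0 <= 2 * K / r by rewrite divr_ge0 ?(ltW r0)// mulr_ge0.
  have nN : (2 * K / r) `^ (2 / kap) <= n%:R.
    by apply: (le_trans (ltW (truncnS_gt _))); rewrite ler_nat.
  have -> : 2 * K / r = ((2 * K / r) `^ (2 / kap)) `^ (kap / 2).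
    rewrite -powRrM (_ : 2 / kap * (kap / 2) = 1) ?powRr1//.
    by field; rewrite gt_eqF.
  by apply: ge0_ler_powR; rewrite ?nnegrE ?powR_ge0 ?ler0n// divr_ge0// ltW.
have E2 : K * n%:R `^ (- (kap / 2)) <= r / 2.
  rewrite powRN ler_pdivrMr ?powR_gt0//; rewrite ler_pdivrMr// in nk; lra.
have -> : C1 - pr n / v = - (g / v - C1) - (pr n - g) / v by ring.
rewrite (le_trans (ler_normB _ _))// normrN normrM (gtr0_norm (_ : 0 < v^-1)) ?invr_gt0//.
lra.
Qed.

End tail_asymptotics.

Lemma propto_bounds (R : realType) (u v : R^nat) (C : R) (n0 : nat) : 0 < C ->
  (forall n, (n0 <= n)%N -> 0 < v n) -> u n / v n @[n --> \oo] --> C ->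
  exists n1, forall n, (n1 <= n)%N -> C / 2 * v n <= u n <= 2 * C * v n.
Proof.
move=> C0 v0 /cvgrPdist_le uv; have C20 : 0 < C / 2 by rewrite divr_gt0.
have [n1 _ hn1] := uv _ C20.
exists (maxn n0 n1) => n; rewrite geq_max => /andP[/v0 vn /hn1/=].
rewrite ler_norml => /andP[lo hi]; rewrite -(ler_pdivlMr _ _ vn) -(ler_pdivrMr _ _ vn).
by apply/andP; split; lra.
Qed.

(** * Tail probabilities of the linear field *)

Section moments.
Context d (T : measurableType d) (R : realType) (P : probability T R).

Lemma same_law_integral (X Y : {RV P >-> R}) (f : R -> R) :
  (forall B, measurable B -> distribution P X B = distribution P Y B) ->
  measurable_fun setT f -> intble P (f \o X) ->
  intble P (f \o Y) /\ \int[P]_w f (Y w) = \int[P]_w f (X w).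
Proof.
move=> XY mf iX.
have mEf : measurable_fun setT (EFin \o f) by exact/measurable_EFinP.
have iY : intble P (f \o Y).
  apply/integrableP; split.
    by apply/measurable_EFinP; exact: measurableT_comp.
  have /integrableP[_] := iX.
  rewrite -[X in (X < _ -> _)%E](@ge0_integral_distribution _ _ _ _ _ P X (fun x => `|(f x)%:E|%E))//; last first.
    exact: measurableT_comp.
  rewrite -[X in (_ -> X < _)%E](@ge0_integral_distribution _ _ _ _ _ P Y (fun x => `|(f x)%:E|%E))//; last first.
    exact: measurableT_comp.
  by rewrite (eq_measure_integral (distribution P Y))// => B mB _; exact: XY.
split=> //; rewrite /Rintegral; congr fine.
rewrite -(@integral_distribution _ _ _ _ _ P Y (EFin \o f))//.
rewrite -(@integral_distribution _ _ _ _ _ P X (EFin \o f))//.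
by apply: eq_measure_integral => B mB _; rewrite -[LHS]XY.
Qed.

Lemma intble_of_Lnorm (X : T -> R) (p : R) : measurable_fun setT X -> 0 < p ->
  ('N[P]_p%:E[EFin \o X] < +oo)%E -> intble P (fun w => `|X w| `^ p).
Proof.
move=> mX p0 Xp; apply/integrableP; split.
  apply/measurable_EFinP.
  apply: (measurableT_comp (measurable_powR _)); exact: measurableT_comp.
have := poweR_lty p Xp; rewrite poweR_Lnorm ?gt_eqF//; apply: le_lt_trans.
rewrite le_eqVlt; apply/orP; left; apply/eqP; apply: eq_integral => w _ /=.
by rewrite ger0_norm// powR_ge0.
Qed.

Lemma moment_of_Lnorm (X : {RV P >-> R}) (p dl : R) : 0 < dl -> dl <= p - 2 ->
  ('N[P]_p%:E[EFin \o X] < +oo)%E -> intble P (fun w => X w ^+ 2 * `|X w| `^ dl).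
Proof.
move=> dl0 dlp Xp; have p0 : 0 < p by lra.
apply: (@intble_dominated _ _ _ P _ (fun w => 1 + `|X w| `^ p)).
- apply: measurable_funM; first exact: measurable_funX.
  apply: (measurableT_comp (measurable_powR _)); exact: measurableT_comp.
- by apply: intbleD; [exact: intble_cst|exact: intble_of_Lnorm].
- move=> w; rewrite -(real_normK (num_real (X w))); set x := `|X w|.
  have x0 : 0 <= x by exact: normr_ge0.
  rewrite ger0_norm ?mulr_ge0 ?powR_ge0 ?sqr_ge0//.
  have [x1|x1] := leP x 1.
    apply: (@le_trans _ _ 1); last by rewrite lerDl powR_ge0.
    rewrite -[leRHS]mulr1; apply: ler_pM; rewrite ?powR_ge0 ?sqr_ge0//.
      by rewrite expr2 -[leRHS]mulr1; apply: ler_pM.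
    by have := ge0_ler_powR (ltW dl0) (_ : x \in Num.nneg) (_ : 1 \in Num.nneg) x1; rewrite powR1 !nnegrE; apply.
  apply: (@le_trans _ _ (x `^ p)); last by rewrite lerDr.
  rewrite -powR_mulrn// -powRD; last by rewrite (gt_eqF (lt_trans ltr01 x1)) implybT.
  by apply: ler_powR; [exact: ltW|lra].
Qed.

End moments.

(** Write x^2 - y^2 = 2 x (x - y) - (x - y)^2 and split the cross term with weight [e], so that only
    a small multiple of x^2 is paid. *)
Lemma sqr_diff_le (R : realFieldType) (e x y : R) : 0 < e ->
  `|x ^+ 2 - y ^+ 2| <= e / 2 * x ^+ 2 + (2 / e + 1) * (x - y) ^+ 2.
Proof.
move=> e0; have e20 : 0 <= e / 2 by rewrite divr_ge0// ltW.
have hB := mulr_ge0 e20 (sqr_ge0 (x - 2 / e * (x - y))).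
have hD := mulr_ge0 e20 (sqr_ge0 (x + 2 / e * (x - y))).
rewrite ler_norml -subr_ge0 opprK -[X in _ && X]subr_ge0; apply/andP; split.
  move: hD; congr (_ <= _); field; rewrite gt_eqF//.
apply: le_trans (addr_ge0 hB (mulr_ge0 (ler0n R 2) (sqr_ge0 (x - y)))) _.
rewrite le_eqVlt; apply/orP; left; apply/eqP; field; rewrite gt_eqF//.
Qed.

Section innovations.
Context d (T : measurableType d) (R : realType) (P : probability T R).
Variables (xi0 : {RV P >-> R}) (xi : int * int -> {RV P >-> R}).
Hypothesis xi_iid : iid (innovations xi0 xi).

Lemma innovations_independent : mutually_independent xi.
Proof.
move=> J B mB; have [ind _] := xi_iid.
pose B' (o : option (int * int)) := if o is Some i then B i else setT.
have mB' o : measurable (B' o) by case: o => //=.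
have := ind (Some @` J)%fset B' mB'; rewrite big_imfset/=; last by move=> ? ? _ _ [].
move=> <-; congr (fine (P _)); apply/seteqP; split => w h.
  by move=> o /= /imfsetP[i iJ ->]; exact: h.
by move=> i iJ; apply: (h (Some i)); rewrite /= in_imfset.
Qed.

Lemma innovations_integral (f : R -> R) (u : int * int) : measurable_fun setT f ->
  intble P (f \o xi0) ->
  intble P (f \o xi u) /\ \int[P]_w f (xi u w) = \int[P]_w f (xi0 w).
Proof.
have [_ idd] := xi_iid.
by apply: same_law_integral => B mB; exact: (idd None (Some u)).
Qed.

End innovations.

Section linear_field.
Context d (T : measurableType d) (R : realType) (P : probability T R).
Variables (a : int * int -> R) (xi X : int * int -> {RV P >-> R}).
Hypothesis X_linear : is_linear_field a xi X.

Definition innovation_sites n (A : {fset int * int}) : seq (int * int) :=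
  undup [seq v - u | v <- lattice_box n, u <- A].

Lemma lattice_coef_off_sites n A u : u \notin innovation_sites n A ->
  lattice_coef a A n u = 0.
Proof.
rewrite mem_undup => uU; rewrite /lattice_coef big_seq_cond big1// => v /andP[vb vuA].
by case/negP: uU; apply/allpairsP; exists (v, v - u) => /=; split=> //; rewrite subKr.
Qed.

(** The double sum is regrouped by innovation: for fixed [v], the shift [rs] and the site
    [u = v - rs] determine each other. *)
Lemma lin_comb_sites n A w :
  \sum_(v <- lattice_box n)
    partial_sum (fun rs => a rs * xi (v.1 - rs.1, v.2 - rs.2) w) A =
  lin_comb xi (lattice_coef a A n) (innovation_sites n A) w.
Proof.
rewrite /lin_comb.
under [RHS]eq_bigr => u _ do rewrite /lattice_coef big_distrl/=.
rewrite [RHS](exchange_big_dep predT)//=; apply: eq_big_seq => v vb.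
transitivity (\sum_(rs <- A) a rs * xi (v - rs) w).
  by rewrite /partial_sum big_seq_fsetE.
rewrite -[RHS]big_filter.
have pE : perm_eq [seq u <- innovation_sites n A | v - u \in A] [seq v - u | u <- A].
  apply: uniq_perm; first by rewrite filter_uniq// undup_uniq.
    by rewrite map_inj_uniq ?fset_uniq//; exact: subrI.
  move=> u; rewrite mem_filter mem_undup; apply/andP/mapP.
    by move=> [vuA _]; exists (v - u) => //; rewrite subKr.
  move=> [r rA ->]; rewrite subKr; split=> //.
  by apply/allpairsP; exists (v, r).
rewrite (perm_big _ pE) big_map/=; apply: eq_bigr => r _.
by rewrite subKr.
Qed.

Lemma linear_field_approx (e : R) v : 0 < e -> exists A0, forall A, (A0 `<=` A)%fset ->
  let D w := X v w - partial_sum (fun rs => a rs * xi (v.1 - rs.1, v.2 - rs.2) w) A in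
  intble P (fun w => D w ^+ 2) /\ \int[P]_w (D w ^+ 2) <= e.
Proof.
move=> e0.
have mD A : measurable_fun setT
    (fun w => X v w - partial_sum (fun rs => a rs * xi (v.1 - rs.1, v.2 - rs.2) w) A).
  apply: measurable_funB => //.
  rewrite (_ : (fun _ => _) = fun w => \sum_(rs <- A) a rs * xi (v.1 - rs.1, v.2 - rs.2) w).
    by apply: measurable_sum => rs; exact: measurable_funM.
  by apply/funext => w; rewrite /partial_sum big_seq_fsetE.
have h := X_linear v.1 v.2.
have e0' : (0 < (Num.sqrt e)%:E :> \bar R)%E by rewrite lte_fin sqrtr_gt0.
have [A0 _ HA0] := h _ (open_ereal_lt' e0').
exists A0 => A A0A D; have {HA0} := HA0 A A0A.
rewrite /= -surjective_pairing -[X in Lnorm _ _ X]/(EFin \o D) => DN.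
have D2 w : `|D w| `^ 2 = D w ^+ 2 by rewrite powR_mulrn// real_normK// num_real.
have iD : intble P (fun w => `|D w| `^ 2).
  by apply: intble_of_Lnorm (lt_trans DN (ltry _)) => //; exact: mD.
under eq_Rintegral do rewrite -D2; split; first by under [X in intble _ X]funext do rewrite -D2.
have N2 : (2 : R) != 0 by [].
have := poweR_Lnorm P (EFin \o D) N2; have := Lnorm_ge0 P 2%:E (EFin \o D).
move: DN; case: ('N[P]_2[EFin \o D])%E => [r| |]// re r0.
rewrite poweR_EFin powR_mulrn// => rE.
rewrite (_ : \int[P]_w _ = r ^+ 2).
  rewrite -[leRHS](sqr_sqrtr (ltW e0)) ler_sqr ?nnegrE ?sqrtr_ge0//.
  by move: re; rewrite lte_fin => /ltW.
by rewrite /Rintegral; under eq_integral do rewrite -poweR_EFin; rewrite -rE.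
Qed.

Lemma field_sum_box n w : field_sum X n w = \sum_(v <- lattice_box n) X v w.
Proof. by rewrite /field_sum /lattice_box big_allpairs_dep. Qed.

Lemma measurable_field_sum n : measurable_fun setT (field_sum X n).
Proof.
rewrite (_ : field_sum X n = fun w => \sum_(v <- lattice_box n) X v w).
  exact: measurable_sum.
by apply/funext => w; exact: field_sum_box.
Qed.

Lemma field_sum_approx n (e : R) : 0 < e -> exists A0, forall A, (A0 `<=` A)%fset ->
  let D w := field_sum X n w -
    lin_comb xi (lattice_coef a A n) (innovation_sites n A) w in
  intble P (fun w => D w ^+ 2) /\ \int[P]_w (D w ^+ 2) <= e.
Proof.
(* One more than the number of summands, so that [N] is positive also for n = 0; Cauchy-Schwarz over
   the box and adding the bounds cost a factor [N] each. *)
move=> e0; pose N : R := (n * n).+1%:R.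
have N0 : 0 < N by rewrite ltr0n.
have e0' : 0 < e / N ^+ 2 by rewrite divr_gt0// exprn_gt0.
pose E A v w := X v w - partial_sum (fun rs => a rs * xi (v.1 - rs.1, v.2 - rs.2) w) A.
have [A0 hA0] := choice (fun v => linear_field_approx v e0').
pose U := (\bigcup_(v <- lattice_box n) A0 v)%fset.
exists U => A UA D.
have hE v : v \in lattice_box n ->
    intble P (fun w => E A v w ^+ 2) /\ \int[P]_w (E A v w ^+ 2) <= e / N ^+ 2.
  move=> vb; apply: hA0; apply: fsubset_trans UA.
  exact: bigfcup_sup.
(* Extended by 0 outside the box, since the rules for sums ask integrability at every index. *)
pose E' v w := if v \in lattice_box n then E A v w else 0.
have hE' v : intble P (fun w => E' v w ^+ 2) /\ \int[P]_w (E' v w ^+ 2) <= e / N ^+ 2.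
  rewrite /E'; have [vb|vb] := boolP (v \in lattice_box n); first exact: hE.
  rewrite expr0n/=; split; first exact: intble_cst.
  by rewrite RintegralT_cst ltW.
have DE w : D w = \sum_(v <- lattice_box n) E' v w.
  rewrite /D field_sum_box -lin_comb_sites -sumrB; apply: eq_big_seq => v vb.
  by rewrite /E' vb.
have iS : intble P (fun w => N * \sum_(v <- lattice_box n) E' v w ^+ 2).
  by apply: intbleZ; apply: intble_sum => v; exact: (hE' v).1.
have DS w : D w ^+ 2 <= N * \sum_(v <- lattice_box n) E' v w ^+ 2.
  rewrite DE; apply: (le_trans (sqr_sum_le _ _)); rewrite size_lattice_box.
  by rewrite ler_wpM2r ?sumr_ge0// => [v _|]; rewrite ?sqr_ge0// ler_nat.
have mD : measurable_fun setT D.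
  by apply: measurable_funB; [exact: measurable_field_sum|exact: measurable_lin_comb].
have iD : intble P (fun w => D w ^+ 2).
  apply: intble_dominated iS _; first exact: measurable_funX.
  by move=> w; rewrite ger0_norm ?sqr_ge0.
split=> //; apply: (le_trans (RintegralT_le iD iS DS)).
rewrite RintegralZl//; last by apply: intble_sum => v; exact: (hE' v).1.
rewrite RintegralT_sum; last by move=> v; exact: (hE' v).1.
have : \sum_(v <- lattice_box n) \int[P]_w (E' v w ^+ 2) <= N * (e / N ^+ 2).
  apply: (le_trans (ler_sum _ (fun v _ => (hE' v).2))).
  rewrite big_const_seq iter_addr_0 count_predT size_lattice_box -[leLHS]mulr_natl ler_wpM2r ?(ltW e0')//.
  by rewrite ler_nat.
move=> /(ler_wpM2l (ltW N0))/le_trans; apply; rewrite le_eqVlt; apply/orP; left.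
by apply/eqP; field; rewrite gt_eqF.
Qed.

Hypothesis ind_xi : mutually_independent xi.
Hypothesis iX2 : forall u, intble P (fun w => xi u w ^+ 2).
Hypothesis xi_mean : forall u, \int[P]_w xi u w = 0.
Hypothesis xi_var : forall u, \int[P]_w (xi u w ^+ 2) = 1.

Lemma field_sigma_sqr n : field_sigma X n ^+ 2 = \int[P]_w (field_sum X n w ^+ 2).
Proof.
rewrite /field_sigma unlock sqr_sqrtr// fine_ge0//.
by apply: integral_ge0 => w _; rewrite lee_fin sqr_ge0.
Qed.

Lemma normalized_field_approx n (e : R) : 0 < field_sigma X n -> 0 < e <= 1 ->
  exists A0, forall A, (A0 `<=` A)%fset ->
  let b u := lattice_coef a A n u / field_sigma X n in
  let D w := field_sum X n w / field_sigma X n - lin_comb xi b (innovation_sites n A) w in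
  [/\ intble P (fun w => D w ^+ 2), \int[P]_w (D w ^+ 2) <= e ^+ 2 &
      `|1 - \sum_(u <- innovation_sites n A) b u ^+ 2| <= e].
Proof.
move=> s0 /andP[e0 e1]; set s := field_sigma X n in s0 *.
have s20 : 0 < s ^+ 2 by rewrite exprn_gt0.
(* The 8 leaves room: [sqr_diff_le] multiplies this error by 2/e + 1, giving at most (3/8) e s^2,
   next to the (1/2) e s^2 of its first term. *)
have t0 : 0 < e ^+ 2 * s ^+ 2 / 8 by rewrite !mulr_gt0 ?invr_gt0.
have [A0 hA0] := field_sum_approx n t0.
exists A0 => A /hA0; set U := innovation_sites n A; set W := lin_comb _ _ _ => -[iD D2] b D.
have uU : uniq U by exact: undup_uniq.
have DE w : D w = s^-1 * (field_sum X n w - W w).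
  rewrite /D mulrBr [s^-1 * _]mulrC; congr (_ - _).
  rewrite /W /lin_comb big_distrr/=; apply: eq_bigr => u _.
  by rewrite /b mulrA [_ / s]mulrC.
have DE2 : (fun w => D w ^+ 2) = fun w => (s ^+ 2)^-1 * (field_sum X n w - W w) ^+ 2.
  by apply/funext => w; rewrite DE exprMn exprVn.
have [iW iW2 EW2] := lin_comb_moments ind_xi iX2 xi_mean xi_var (lattice_coef a A n) uU.
rewrite -/W in iW iW2 EW2.
rewrite DE2; split; first exact: intbleZ.
  rewrite RintegralZl// ler_pdivrMl//; apply: (le_trans D2).
  by have := mulr_ge0 (sqr_ge0 e) (sqr_ge0 s); rewrite [leRHS]mulrC; lra.
have -> : \sum_(u <- U) b u ^+ 2 = (\int[P]_w (W w ^+ 2)) / s ^+ 2.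
  by rewrite EW2 big_distrl/=; apply: eq_bigr => u _; rewrite /b exprMn exprVn.
pose S := field_sum X n.
have mS : measurable_fun setT S by exact: measurable_field_sum.
have iS2 : intble P (fun w => S w ^+ 2).
  apply: (@intble_dominated _ _ _ P _ (fun w => 2 * ((S w - W w) ^+ 2 + W w ^+ 2))).
  - exact: measurable_funX.
  - by apply: intbleZ; exact: intbleD.
  - move=> w; rewrite ger0_norm ?sqr_ge0//.
    have := sqr_ge0 (S w - W w - W w); rewrite !sqrrB; rewrite !expr2; lra.
have key w : `|S w ^+ 2 - W w ^+ 2| <= e / 2 * S w ^+ 2 + (2 / e + 1) * (S w - W w) ^+ 2.
  by exact: sqr_diff_le.
have iq : intble P (fun w => e / 2 * S w ^+ 2 + (2 / e + 1) * (S w - W w) ^+ 2).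
  by apply: intbleD; exact: intbleZ.
have := Rintegral_abs_le (intbleB iS2 iW2) iq key.
rewrite RintegralB// RintegralD//; [|exact: intbleZ|exact: intbleZ].
rewrite RintegralZl// RintegralZl// /S -field_sigma_sqr -/s.
set I := \int[P]_w (W w ^+ 2); set Q := \int[P]_w _ in D2 *.
have -> : 1 - I / s ^+ 2 = (s ^+ 2 - I) / s ^+ 2 by field; rewrite gt_eqF.
move=> h; rewrite normrM [ `|_^-1|]gtr0_norm ?invr_gt0// ler_pdivrMr//.
apply: (le_trans h).
have : (2 / e + 1) * Q <= (2 / e + 1) * (e ^+ 2 * s ^+ 2 / 8).
  by rewrite ler_wpM2l// addr_ge0// divr_ge0// ltW.
have -> : (2 / e + 1) * (e ^+ 2 * s ^+ 2 / 8) = e / 4 * s ^+ 2 + e / 8 * (e * s ^+ 2).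
  by field; rewrite gt_eqF.
have : e / 8 * (e * s ^+ 2) <= e / 8 * s ^+ 2.
  by rewrite ler_wpM2l ?divr_ge0 ?(ltW e0)// ger_pMl.
have es : 0 <= e * s ^+ 2 by rewrite mulr_ge0// ltW.
set x := s ^+ 2 in es *; rewrite -![e / _ * _]mulrA ![_^-1 * _]mulrC ![e * (_ / _)]mulrA.
move: (e * x) es => y; lra.
Qed.

End linear_field.

(** * Polynomial rate of normal approximation for the field *)

Section normal_rate.
Context d (T : measurableType d) (R : realType) (P : probability T R).
Variables (a : int * int -> R) (xi X : int * int -> {RV P >-> R}) (dl : R).
Hypothesis X_linear : is_linear_field a xi X.
Hypothesis ind_xi : mutually_independent xi.
Hypothesis iX2 : forall u, intble P (fun w => xi u w ^+ 2).
Hypothesis xi_mean : forall u, \int[P]_w xi u w = 0.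
Hypothesis xi_var : forall u, \int[P]_w (xi u w ^+ 2) = 1.
Hypothesis dl01 : 0 < dl <= 1.
Hypothesis iXdl : forall u, intble P (fun w => xi u w ^+ 2 * `|xi u w| `^ dl).
Variable m : R.
Hypothesis X_dl : forall u, \int[P]_w (xi u w ^+ 2 * `|xi u w| `^ dl) <= m.
Hypothesis sigma_gt0 : forall n, (0 < n)%N -> 0 < field_sigma X n.

(** If [a] were 0, every approximating combination would have variance 0, while after normalisation
    its variance must be within 1/2 of 1. *)
Lemma linear_field_coef_neq0 : exists v, a v != 0.
Proof.
apply: contrapT => na.
have a0 v : a v = 0 by apply/eqP/negPn/negP => av; apply: na; exists v.
have h01 : 0 < (2^-1 : R) <= 1 by rewrite invr_gt0 ltr0n/= invf_le1// ler1n.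
have [A0 hA0] := normalized_field_approx X_linear ind_xi iX2 xi_mean xi_var (sigma_gt0 (ltn0Sn 0)) h01.
have [_ _] := hA0 A0 (fsubset_refl _).
rewrite big1 => [|u _].
  by rewrite subr0 normr1 leNgt invf_lt1// ltr1n.
by rewrite /lattice_coef big1 ?mul0r ?expr0n// => v _; exact: a0.
Qed.

(** Apply [normal_two_sided_rate] with [B] of order n^(-kap / 2). The smoothing width sqrt B is then
    of order n^(-kap / 4), and the power [dl] gives the exponent. *)
Lemma field_normal_rate (G : R -> R) (J : R) : gauss_tail G J -> coef_dominated a ->
  exists (kap C : R) (n0 : nat), 0 < kap /\ forall n (x : R), (n0 <= n)%N -> 0 <= x ->
    `|fine (P [set w | x < `|field_sum X n w / field_sigma X n|]) - 2 * G x / J|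
      <= C * n%:R `^ (- kap).
Proof.
move=> GJ [kap [C [n0 [kap0 C0 hC]]]]; have /andP[dl0 dl1] := dl01.
have m0 : 0 <= m.
  apply: le_trans (X_dl 0); apply: Rintegral_ge0 => w _.
  by rewrite mulr_ge0 ?sqr_ge0 ?powR_ge0.
pose n1 := (Num.trunc ((2 * C) `^ kap^-1)).+1.
exists (kap / 4 * dl), (2 * rate_cst dl m J * Num.sqrt (Num.sqrt (2 * C)) `^ dl), (maxn n0 n1).
split; first by rewrite mulr_gt0// divr_gt0.
move=> n x; rewrite geq_max => /andP[nn0 nn1] x0.
have n_gt0 : (0 < n)%N by exact: leq_trans nn1.
have nR0 : 0 < n%:R :> R by rewrite ltr0n.
have C20 : 0 < 2 * C by rewrite mulr_gt0.
(* [B] is both the accuracy of the L^2 approximation and the bound on normalised coefficients. The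
   factor 2 absorbs the normalised variance, at most 1 + B <= 2; [n1] ensures B <= 1. *)
pose B := Num.sqrt (2 * C * n%:R `^ (- kap)).
have CnB : 0 < 2 * C * n%:R `^ (- kap) by rewrite mulr_gt0// powR_gt0.
have B0 : 0 < B by rewrite sqrtr_gt0.
have B1 : B <= 1.
  rewrite -sqrtr1 ler_sqrt// powRN ler_pdivrMr ?powR_gt0// mul1r.
  have -> : 2 * C = ((2 * C) `^ kap^-1) `^ kap.
    by rewrite -powRrM mulVf ?gt_eqF// powRr1// ltW.
  apply: ge0_ler_powR; rewrite ?nnegrE ?powR_ge0 ?(ltW kap0)//.
  by apply: le_trans (ltW (truncnS_gt _)) _; rewrite ler_nat.
have B01 : 0 < B <= 1 by rewrite B0.
have s0 := sigma_gt0 n_gt0; set s := field_sigma X n in s0 *.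
have [A0 hA0] := normalized_field_approx X_linear ind_xi iX2 xi_mean xi_var s0 B01.
have [A1 [V [uV hV]]] := hC n nn0.
pose A := (A0 `|` A1)%fset.
have [iD D2 b2] := hA0 A (fsubsetUl _ _).
have hA := hV A (fsubsetUr _ _).
set b := fun u => lattice_coef a A n u / s in iD D2 b2.
set U := innovation_sites n A in iD D2 b2.
have uU : uniq U by exact: undup_uniq.
(* Sites of [V] outside [U] carry zero coefficients, so passing from [V] to [U] loses nothing. *)
have VU : \sum_(v <- V) lattice_coef a A n v ^+ 2 <= \sum_(u <- U) lattice_coef a A n u ^+ 2.
  rewrite (bigID (mem U))/= [X in _ + X]big1 ?addr0; last first.
    by move=> v vU; rewrite lattice_coef_off_sites// expr0n.
  rewrite -big_filter [leRHS](bigID (mem V))/= -[X in _ <= X + _]big_filter.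
  rewrite (perm_big [seq u <- U | u \in V]); last first.
    apply: uniq_perm; rewrite ?filter_uniq// => v.
    by rewrite !mem_filter andbC.
  by rewrite lerDl sumr_ge0// => u _; exact: sqr_ge0.
have b_le u : `|b u| <= B.
  rewrite -sqrtr_sqr ler_wsqrtr// /b exprMn exprVn.
  have bU : \sum_(v <- U) lattice_coef a A n v ^+ 2 / s ^+ 2 <= 2.
    rewrite (eq_bigr (fun v => b v ^+ 2)) => [|v _]; last by rewrite /b exprMn exprVn.
    by move: b2; rewrite ler_norml => /andP[+ _]; move: B1; lra.
  rewrite ler_pdivrMr ?exprn_gt0//; apply: (le_trans (hA u)).
  rewrite -big_distrl/= ler_pdivrMr ?exprn_gt0// in bU.
  have Cq : 0 <= C * n%:R `^ (- kap) by rewrite mulr_ge0 ?powR_ge0// ltW.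
  apply: le_trans (ler_wpM2l Cq (le_trans VU bU)) _.
  by rewrite [leLHS]mulrA [_ * 2]mulrC [2 * (_ * _)]mulrA.
have mY : measurable_fun setT (fun w => field_sum X n w / s).
  by apply: measurable_funM => //; exact: measurable_field_sum.
have := normal_two_sided_rate ind_xi iX2 xi_mean xi_var dl01 iXdl X_dl m0 GJ uU B01 b_le b2 mY iD D2 x0.
move=> /le_trans; apply; rewrite le_eqVlt; apply/orP; left; apply/eqP.
rewrite -!mulrA; congr (_ * (_ * _)).
rewrite /B !sqrtrM ?sqrtr_ge0 ?(ltW C20)// powRM ?sqrtr_ge0//; congr (_ * _).
rewrite -!powR12_sqrt ?powR_ge0// -!powRrM; congr (_ `^ _); by field.
Qed.

End normal_rate.

Lemma coef_dominated_of_memory (R : realType) (a : int * int -> R) :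
  square_summable a -> (exists v, a v != 0) -> short_memory a \/ long_memory a ->
  coef_dominated a.
Proof.
move=> a2 a0 [sa|la]; last exact: long_memory_dominated.
have [M aM] := summable_abs_bounded sa.1.
have [s0 [A1 [s00 hA1]]] := short_memory_sums sa.
exact: short_memory_dominated aM _ ltr01 (mass_grows_of_sums s00 hA1).
Qed.

Section tail_probability.
Context d (T : measurableType d) (R : realType) (P : probability T R).
Variables (X : int * int -> {RV P >-> R}) (c : R) (h : R -> R).

Lemma measurable_tail_event n (y : R) : measurable [set w | y < `|field_sum X n w|].
Proof.
rewrite (_ : [set w | _] = (fun w => `|field_sum X n w|) @^-1` `]y, +oo[); last first.
  by apply/seteqP; split => w; rewrite /= in_itv/= andbT.
rewrite -[X in measurable X]setTI; apply: measurableT_comp => //.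
exact: measurable_field_sum.
Qed.

Lemma tail_probE eps n : tail_prob X c h eps n = (fine (tail_prob X c h eps n))%:E.
Proof. by rewrite fineK// fin_num_measure//; exact: measurable_tail_event. Qed.

Lemma fine_tail_prob_ge0 eps n : 0 <= fine (tail_prob X c h eps n).
Proof. by rewrite fine_ge0. Qed.

Lemma tail_prob_anti eps eps' n : eps <= eps' ->
  fine (tail_prob X c h eps' n) <= fine (tail_prob X c h eps n).
Proof.
move=> ee; rewrite -lee_fin -!tail_probE; apply: le_measure; rewrite ?inE.
- exact: measurable_tail_event.
- exact: measurable_tail_event.
move=> w /=; apply: le_lt_trans.
by rewrite !ler_wpM2r ?sqrtr_ge0// lerD2l.
Qed.

Lemma tail_prob_normalized eps n : 0 < field_sigma X n ->
  tail_prob X c h eps n =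
  P [set w | (1 + eps) * Num.sqrt (2 * ln (Psi c h n%:R)) <
             `|field_sum X n w / field_sigma X n|].
Proof.
move=> s0; rewrite /tail_prob; congr (P _); apply/seteqP.
by split => w /=; rewrite normrM [ `|_^-1|]gtr0_norm ?invr_gt0// ltr_pdivlMr// mulrAC.
Qed.

End tail_probability.

(** * Tail equivalence and the dichotomy for the series *)

Theorem theorem3p1 (R : realType) (d : measure_display) (T : measurableType d)
  (P : probability T R)
  (a : int * int -> R) (xi0 : {RV P >-> R})
  (xi X : int * int -> {RV P >-> R})
  (a_l2 : square_summable a)
  (xi_iid : iid (innovations xi0 xi))
  (xi0_mean : ('E_P[xi0] = 0)%E)
  (xi0_var : ('E_P[(fun w => (xi0 w ^+ 2)%R)] = 1)%E)
  (X_linear : is_linear_field a xi X)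
  (sigma_gt0 : forall n : nat, (0 < n)%N -> 0 < field_sigma X n)
  (DG : condition_DG xi0 a)
  (c : R) (c_ge1 : 1 <= c) (h : R -> R)
  (h_gt0 : forall t : R, c <= t -> 0 < h t)
  (h_nd : forall s t : R, c <= s -> s <= t -> h s <= h t)
  (h_int : (\int[lebesgue_measure]_(t in `[c, +oo[) ((t * h t)^-1)%:E = +oo)%E)
  (m : nat) (m_first : first_time_above_one c h m) :
  (forall eps : R, -1 < eps ->
     propto (fun n : nat => fine (tail_prob X c h eps n))
            (fun n : nat => (Num.sqrt (ln (Psi c h n%:R)))^-1
                            * Psi c h n%:R `^ (- (1 + eps) ^+ 2)))
  /\
  (forall eps : R,
     (0 < eps -> (S_Psi X c h m eps < +oo)%E) /\
     (eps <= 0 -> S_Psi X c h m eps = +oo%E)).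
Proof.
have [[p p2 xip] memory] := DG.
(* The interpolation exponent of [taylor_remainder] may not exceed 1, and 2 + dl may not exceed the
   available moment [p]. *)
pose dl := Num.min 1 (p - 2).
have dl01 : 0 < dl <= 1 by rewrite lt_min ge_min lexx ltr01 subr_gt0 p2.
have dlp : dl <= p - 2 by rewrite ge_min lexx orbT.
have /andP[dl0 _] := dl01.
have iXdl0 := moment_of_Lnorm dl0 dlp xip.
have i02 : intble P (fun w => xi0 w ^+ 2).
  apply/integrableP; split; first by apply/measurable_EFinP; exact: measurable_funX.
  move: xi0_var; rewrite unlock => E; under eq_integral do rewrite /= ger0_norm ?sqr_ge0//.
  by rewrite E ltry.
have i0 : intble P xi0 by exact: intble_of_sqr i02.
have m0 : \int[P]_w xi0 w = 0.
  by move: xi0_mean; rewrite unlock /Rintegral => ->.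
have v0 : \int[P]_w (xi0 w ^+ 2) = 1.
  by move: xi0_var; rewrite unlock /Rintegral => ->.
have ind_xi := innovations_independent xi_iid.
pose f2 (x : R) := x ^+ 2.
have mf2 : measurable_fun setT f2 by exact: measurable_funX.
pose fdl (x : R) := x ^+ 2 * `|x| `^ dl.
have mfdl : measurable_fun setT fdl.
  apply: measurable_funM => //; apply: (measurableT_comp (measurable_powR _)).
  exact: normr_measurable.
have iX2 u : intble P (fun w => xi u w ^+ 2) := (innovations_integral xi_iid u mf2 i02).1.
have xi_var u : \int[P]_w (xi u w ^+ 2) = 1.
  by rewrite -v0; exact: (innovations_integral xi_iid u mf2 i02).2.
have xi_mean u : \int[P]_w xi u w = 0.
  by rewrite -m0; exact: (innovations_integral xi_iid u (@measurable_id _ _ setT) i0).2.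
have iXdl u : intble P (fun w => xi u w ^+ 2 * `|xi u w| `^ dl) :=
  (innovations_integral xi_iid u mfdl iXdl0).1.
have X_dl u : \int[P]_w (xi u w ^+ 2 * `|xi u w| `^ dl) <= \int[P]_w (fdl (xi0 w)).
  by rewrite (innovations_integral xi_iid u mfdl iXdl0).2.
have [G [J GJ]] := gauss_tail_exists R.
have a0 := linear_field_coef_neq0 X_linear ind_xi iX2 xi_mean xi_var sigma_gt0.
have [kap [C [n0 [kap0 rate]]]] := field_normal_rate X_linear ind_xi iX2 xi_mean xi_var
  dl01 iXdl X_dl sigma_gt0 GJ (coef_dominated_of_memory a_l2 a0 memory).
have Psioo := Psi_unbounded c_ge1 h_gt0 h_nd h_int.
pose pr eps n := fine (tail_prob X c h eps n).
pose v eps n := (Num.sqrt (ln (Psi c h n%:R)))^-1 * Psi c h n%:R `^ (- (1 + eps) ^+ 2).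
have asym eps : -1 < eps -> exists2 C1 : R, 0 < C1 & pr eps n / v eps n @[n --> \oo] --> C1.
  move=> eps1; eexists; first exact: tail_constant_gt0 GJ eps1.
  apply: (@propto_of_rate _ G J eps GJ eps1 (fun n => Psi c h n%:R) _ kap C (maxn n0 1)) => //.
    move=> e e0; have [D [N [D0 hD]]] := Psi_subpolynomial c_ge1 h_gt0 h_nd e0.
    by exists D, N.
  move=> n; rewrite geq_max => /andP[nn0 n1].
  rewrite /pr tail_prob_normalized; last exact: sigma_gt0.
  apply: rate => //; rewrite mulr_ge0 ?sqrtr_ge0//; lra.
split=> // eps.
have [[_ cm _] _] := m_first.
(* From [N0] on, ln Psi is at least 1: the comparison sequence is positive, and its factor 1 / sqrt
   (ln Psi) can be bounded by 1 in the convergent case. *)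
have [N0 hN0] := Psioo (expR 1).
have P1 n : (N0 <= n)%N -> 0 < Psi c h n%:R /\ 1 <= Num.sqrt (ln (Psi c h n%:R)).
  move=> /hN0 e1; have p0 := lt_le_trans (expR_gt0 1) e1; split=> //.
  by rewrite -[leLHS]sqrtr1 ler_wsqrtr// -[leLHS]expRK ler_ln ?posrE ?expR_gt0.
have vpos e n : (N0 <= n)%N -> 0 < v e n.
  move=> /P1[p0 s1]; rewrite mulr_gt0 ?powR_gt0// invr_gt0.
  exact: lt_le_trans ltr01 s1.
have SE : S_Psi X c h m eps = (\sum_(m <= n <oo) ((n%:R * h n%:R)^-1)%:E * (pr eps n)%:E)%E.
  by apply: congr_lim; apply/funext => k; apply: eq_bigr => n _; rewrite -tail_probE.
rewrite SE; split=> [eps0|eps0].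
  have [C1 C10 cv] := asym eps (lt_trans (ltrN10 R) eps0).
  have [n1 hn1] := propto_bounds C10 (vpos eps) cv.
  apply: (weighted_series_finite c_ge1 h_gt0 h_nd h_int cm _ (q := (1 + eps) ^+ 2)
    (C := 2 * C1) (n0 := maxn N0 n1)).
  - by move=> n; exact: fine_tail_prob_ge0.
  - by rewrite -[ltLHS](expr1n _ 2) ltr_pXn2r ?nnegrE//; lra.
  move=> n; rewrite geq_max => /andP[/P1[p0 s1] /hn1/andP[_ U]].
  apply: (le_trans U); rewrite ler_wpM2l ?mulr_ge0 ?(ltW C10)// /v.
  by rewrite -[leRHS]mul1r ler_wpM2r ?powR_ge0// invf_le1// (lt_le_trans ltr01).
(* The lower bound at exponent 0 also serves eps <= -1, where the threshold is no longer positive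
   and the equivalence is not at hand. *)
have [C1 C10 cv] := asym 0 (ltrN10 R).
have [n1 hn1] := propto_bounds C10 (vpos 0) cv.
apply: (weighted_series_infinite c_ge1 h_gt0 h_nd h_int cm _ (C0 := C1 / 2)
    (n0 := maxn N0 n1)).
- by move=> n; exact: fine_tail_prob_ge0.
- by rewrite divr_gt0.
move=> n; rewrite geq_max => /andP[/P1[p0 s1] /hn1/andP[L _]].
apply: le_trans (tail_prob_anti X c h n eps0); apply: le_trans L.
rewrite /v addr0 expr1n powRN powRr1 ?(ltW p0)// -invfM.
by rewrite [X in _ <= _ * X^-1]mulrC.
Qed.
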